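(* Suppose that the Ruelle-expanding semigroup $\mathcal S$ generated by $\{T_i\}_{i\in\mathcal W}$ is jointly topologically mixing and finitely aperiodic, and that every potential $\varphi_i$, $i\in\mathcal W$, is $\alpha$-Hölder and summable. Let $\rho$ be a non-singular probability measure supported on a topologically mixing one-sided subshift of finite type $\Sigma\subset\mathcal W^{\mathbb N}$ such that every $\log p_i$, $i\in\mathcal W$, is Hölder continuous on $\Sigma$. Let $k_0$, $\beta$, $m$ and $\pi$ be as in the context. Then there exist $r\in(0,1)$ and a constant $C>0$ such that for all $f\in\mathcal H_\alpha$, $x\in X$ and $n\ge2k_0$, $$\left|\frac{\mathcal A_n(f)(x)}{\mathcal A_n(\mathbf 1)(x)}-\int f\,d\pi\right|\le C\,r^n\big(\overline D(f)+\|f\|_m\big).$$ Moreover, there exists a positive function $h\in\mathcal H_\alpha$ such that (after possibly enlarging $C$) for all $f\in\mathcal H_\alpha$, $x\in X$ and $n\ge2k_0$, $$\left|\frac{\mathcal A_n(f)(x)}{\beta^nh(x)}-\int f\,d\pi\right|\le C\,r^n\big(\overline D(f)+\|f\|_m\big).$$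
   Context: Setting. $(X,d)$ is a complete separable metric space, $\mathcal W$ a finite alphabet, and for each $i\in\mathcal W$, $T_i:X\to X$ is continuous and surjective. For a finite word $v=i_1\cdots i_n$ put $|v|=n$ and $T_v=T_{i_n}\circ\cdots\circ T_{i_1}$ (with $T_\emptyset=\mathrm{id}$). $\mathcal S$ is the semigroup generated by $\{T_i\}$. Let $d_v(x,y)=\max\{d(x,y),\,d(T_{i_1\cdots i_j}(x),T_{i_1\cdots i_j}(y)):1\le j<n\}$. A map $T$ is $(a,\lambda)$-Ruelle-expanding ($a>0$, $\lambda\in(0,1)$) if for all $x,y,\tilde x\in X$ with $d(x,y)<a$ and $T(\tilde x)=x$ there is a unique $\tilde y\in X$ with $T(\tilde y)=y$ and $d(\tilde x,\tilde y)<a$, and this $\tilde y$ satisfies $d(\tilde x,\tilde y)\le\lambda d(x,y)$. $\mathcal S$ is Ruelle-expanding if every $T_i$ is $(a,\lambda)$-Ruelle-expanding for common $a,\lambda$. $\mathcal S$ is jointly topologically mixing if for all nonempty open $U,V\subset X$ there is $m\in\mathbb N$ with $T_w^{-1}(U)\cap V\ne\emptyset$ for all finite words $w$ with $|w|\ge m$. $\mathcal S$ is finitely aperiodic if there are $n\in\mathbb N$, a finite set $K\subset X$ and $r>0$ such that for all $x\in X$ and $w\in\mathcal W^n$ there are $\xi,\eta\in K$ with: (i) there is $\xi^*\in T_w^{-1}(\xi)$ with $d_w(x,\xi^* )<a$; (ii) there is $x^*\in T_w^{-1}(x)$ with $d(x^*,\eta)<a$ and $d_w(x^*,\eta)<r$.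 Potentials and operators. Fix $\alpha\in(0,1]$, $D_\alpha(f)=\sup_{x\ne y}|f(x)-f(y)|/d(x,y)^\alpha$, and $\mathcal H_\alpha$ the space of bounded $f:X\to\mathbb R$ with $D_\alpha(f)<\infty$. Potentials are functions $\varphi_i:X\to\mathbb R$; $\varphi_i$ is $\alpha$-Hölder if $D_\alpha(\varphi_i)<\infty$. For $v=i_1\cdots i_n$, $\varphi_v=\varphi_{i_1}+\varphi_{i_2}\circ T_{i_1}+\cdots+\varphi_{i_n}\circ T_{i_1\cdots i_{n-1}}$ and $L_v(f)(x)=\sum_{T_v(y)=x}e^{\varphi_v(y)}f(y)$ ($L_\emptyset=\mathrm{id}$). $\varphi_i$ is summable if $\|L_i(\mathbf 1)\|_\infty<\infty$. $\mathbb P_u^v(f)=L_v(f\cdot L_u(\mathbf 1))/L_{uv}(\mathbf 1)$, with dual $(\mathbb P_u^v)^*$ acting on the Borel probability measures $\mathcal M_1(X)$. $C_\varphi=\max_i D_\alpha(\varphi_i)/(1-\lambda^\alpha)$, $\Delta=\max\{4C_\varphi,a^{-\alpha}\}$, $d^*(x,y)=\min\{1,\Delta d(x,y)^\alpha\}$, $\overline D(f)=\max\{\sup_{x,y}|f(x)-f(y)|,\ \Delta^{-1}\sup\{|f(x)-f(y)|/d(x,y)^\alpha:0<d(x,y)<\Delta^{-1/\alpha}\}\}$, and $\overline W$ is the Wasserstein-1 metric on $\mathcal M_1(X)$ for $d^*$. The integer $k_0\in\mathbb N$ is fixed, together with some $s\in(0,1)$, such that for all finite words $u,v$ with $|v|\ge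 k_0$, all $\nu_1,\nu_2\in\mathcal M_1(X)$ and all $f$ with $\overline D(f)<\infty$: $\overline W((\mathbb P_u^v)^*\nu_1,(\mathbb P_u^v)^*\nu_2)\le s^{|v|}\overline W(\nu_1,\nu_2)$ and $\overline D(\mathbb P_u^vf)\le s^{|v|}\overline D(f)$ (such $k_0,s$ exist under the hypotheses of the claim). For an infinite word $\omega$, $[\omega]_n$ is its initial word of length $n$, and $\mu_\omega$ is the Borel probability measure $\mu_\omega=\lim_{l\to\infty}(\mathbb P_\emptyset^{[\omega]_l})^*(\nu)$ (which exists and is independent of $\nu\in\mathcal M_1(X)$). Put $\lambda_{i,\omega}=\int L_i(\mathbf 1)\,d\mu_\omega$. Base measure. $\theta$ is the one-sided shift on $\Sigma=\operatorname{supp}\rho$, with a usual metric, e.g. $2^{-\min\{j:\omega_j\ne\omega'_j\}}$. For $i\in\mathcal W$, $p_i(\omega)=\frac{d\rho}{d\rho\circ\theta}(i\omega)$, i.e. $\rho(\{i\omega:\omega\in B\})=\int_Bp_i\,d\rho$ for Borel $B\subset\{\omega\in\Sigma:i\omega\in\Sigma\}$; $p_i(\omega)=0$ if $i\omega\notin\Sigma$, and Hölder continuity of $\log p_i$ is required on $\{\omega\in\Sigma:i\omega\in\Sigma\}$. The annealed operators are $\mathcal A_n(f)(x)=\int_\Sigma L_{[\omega]_n}(f)(x)\,d\rho(\omega)$. $\beta$, $m$, $\pi$, $\|\cdot\|_m$. Let $\iota(g)(\omega)=\sum_{i\in\mathcal W}\lambda_{i,\omega}p_i(\omega)g(i\omega)$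 on $C(\Sigma)$ (sum over $i$ with $i\omega\in\Sigma$). By Ruelle's Perron–Frobenius theorem there are $\beta>0$, a Borel probability measure $m$ on $\Sigma$ and a positive $g_o\in C(\Sigma)$ with $\iota^*m=\beta m$, $\iota(g_o)=\beta g_o$, $\int g_o\,dm=1$. Then $\int f\,d\pi=\int_\Sigma\int_Xf\,d\mu_\omega\,dm(\omega)$ and $\|f\|_m=\sup_{\omega\in\Sigma}\int|f|\,d\mu_\omega$. *)

(* Defs.v *)
From HB Require Import structures.
From mathcomp Require Import all_boot all_order all_algebra.
From mathcomp Require Import all_classical all_reals all_analysis.

Set Implicit Arguments.
Unset Strict Implicit.
Unset Printing Implicit Defensive.

Import Order.TTheory GRing.Theory Num.Theory.
Import numFieldNormedType.Exports.

Local Open Scope classical_set_scope.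
Local Open Scope ring_scope.

(* Both structures are pointed because MathComp-Analysis only puts a
   sigma-algebra on nonempty types. *)
#[short(type="completeMetricType")]
HB.structure Definition CompleteMetric (R : numDomainType) :=
  {T of CompletePseudoMetric R T & Metric R T}.

#[short(type="alphabetType")]
HB.structure Definition Alphabet := {W of Finite W & Pointed W}.

Definition separable_space (T : topologicalType) :=
  exists D : set T, countable D /\ dense D.

Notation borel T := (g_sigma_algebraType (@open T)).

Definition msupport (R : realType) (T : ptopologicalType)
    (mu : set (borel T) -> \bar R) : set T :=
  [set x | forall U : set T, open U -> U x -> (0 < mu U)%E].

(* Sum of a real family over an arbitrary index set; it is the value of the
   sum whenever the family is absolutely summable. *)
Definition sum_over (R : realType) (T : choiceType) (A : set T) (g : T -> R) : R :=
  fine (\esum_(y in A) (g^\+ y)%:E) - fine (\esum_(y in A) (g^\- y)%:E).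

Definition coupling (R : realType) (T : ptopologicalType)
    (nu1 nu2 : probability (borel T) R) :
    set (probability (borel T * borel T)%type R) :=
  [set gamma | forall A : set (borel T), measurable A ->
    gamma (A `*` setT) = nu1 A /\ gamma (setT `*` A) = nu2 A].

(* The parameter R only selects the scalars in which distances are measured. *)
Definition words (R : realType) (W : Type) : Type := nat -> W.

Section words_metric.
Context (R : realType) (W : choiceType).
Implicit Types x y z : words R W.

Definition word_dist x y : R :=
  if pselect (exists j, x j != y j) is left neq_xy
  then 2^-1 ^+ ex_minn neq_xy else 0.

Let word_distxx x : word_dist x x = 0.
Proof.
by rewrite /word_dist; case: pselect => // E; exfalso; case: E => j; rewrite eqxx.
Qed.

Let word_dist_pos x y : word_dist x y = 0 -> x = y.
Proof.
rewrite /word_dist; case: pselect => [neq_xy /eqP|eq_xy _].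
  by rewrite expf_eq0 invr_eq0 pnatr_eq0 andbF.
apply/funext => j; apply: contrapT => /eqP xyj; apply: eq_xy; by exists j.
Qed.

Let word_dist_ge x y j : x j != y j -> 2^-1 ^+ j <= word_dist x y.
Proof.
move=> xyj; rewrite /word_dist; case: pselect => [E|]; last by case; exists j.
case: ex_minnP => n _ /(_ _ xyj) nj.
by rewrite ler_wiXn2l// ?invr_ge0// invf_le1// ler1n.
Qed.

Let word_dist_ge0 x y : 0 <= word_dist x y.
Proof. by rewrite /word_dist; case: pselect => // E; rewrite exprn_ge0// invr_ge0. Qed.

Let word_dist_sym x y : word_dist x y = word_dist y x.
Proof.
apply/eqP; rewrite eq_le; apply/andP; split; rewrite {1}/word_dist.
  case: pselect => // E; case: ex_minnP => n + _.
  by rewrite eq_sym => /word_dist_ge.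
case: pselect => // E; case: ex_minnP => n + _.
by rewrite eq_sym => /word_dist_ge.
Qed.

Let word_dist_triangle y x z :
  word_dist x z <= word_dist x y + word_dist y z.
Proof.
rewrite {1}/word_dist; case: pselect => [E|_]; last by rewrite addr_ge0.
case: ex_minnP => n xzn _.
have [xyn|xyn] := eqVneq (x n) (y n).
  by rewrite ler_wpDl// word_dist_ge// -xyn.
by rewrite ler_wpDr// word_dist_ge.
Qed.

HB.instance Definition _ := Choice.on (words R W).
HB.instance Definition _ := @isMetric.Build R (words R W) word_dist
  word_distxx word_dist_pos word_dist_sym word_dist_triangle.

End words_metric.

HB.instance Definition _ (R : realType) (W : pointedType) :=
  isPointed.Build (words R W) (fun=> point).

Definition word_shift (R : realType) (W : Type) (omega : words R W) : words R W :=
  fun j => omega j.+1.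

Definition wcons (R : realType) (W : Type) (i : W) (omega : words R W) :
    words R W :=
  fun j => if j is k.+1 then omega k else i.

Definition prefix_word (W : Type) (omega : nat -> W) (n : nat) : seq W :=
  mkseq omega n.

Section subshifts.
Context (R : realType) (W : alphabetType).
Implicit Types Sigma : set (words R W).

Definition subshift_of_finite_type Sigma :=
  exists forbidden : seq (seq W), Sigma =
    [set omega | forall w, w \in forbidden -> forall k,
       prefix_word (iter k (@word_shift R W) omega) (size w) != w].

Definition topologically_mixing_subshift Sigma :=
  forall U V : set (words R W), open U -> open V ->
    Sigma `&` U !=set0 -> Sigma `&` V !=set0 ->
    exists N, forall n, (N <= n)%N ->
      exists omega, [/\ Sigma omega, V omega & U (iter n (@word_shift R W) omega)].

Definition nonsingular_shift (rho : probability (borel (words R W)) R) :=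
  forall B : set (borel (words R W)), measurable B ->
    rho (@word_shift R W @^-1` B) = 0%E <-> rho B = 0%E.

Definition branch_dom Sigma (i : W) : set (words R W) :=
  [set omega | Sigma omega /\ Sigma (wcons i omega)].

Definition base_jacobian (rho : probability (borel (words R W)) R) Sigma
    (p : W -> words R W -> R) :=
  (forall i (B : set (borel (words R W))), measurable B ->
     B `<=` branch_dom Sigma i ->
     rho (@wcons R W i @` B) = (\int[rho]_(omega in B) (p i omega)%:E)%E) /\
  (forall i omega, ~ Sigma (wcons i omega) -> p i omega = 0).

(* Positivity on the domain is part of the requirement that log p_i be a
   real-valued function there, since ln is 0 on nonpositive reals. *)
Definition log_hoelder Sigma (p : W -> words R W -> R) :=
  forall i, (forall omega, branch_dom Sigma i omega -> 0 < p i omega) /\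
    exists kappa H : R, 0 < kappa /\
      forall omega omega', branch_dom Sigma i omega ->
        branch_dom Sigma i omega' ->
        `|ln (p i omega) - ln (p i omega')| <= H * mdist omega omega' `^ kappa.

End subshifts.

Section semigroup.
Context (R : realType) (X : completeMetricType R) (W : alphabetType).
Variables (T : W -> X -> X).

Definition Tw (v : seq W) (x : X) : X := foldl (fun y i => T i y) x v.

Definition dw (v : seq W) (x y : X) : R :=
  Num.max (mdist x y)
    (\big[Num.max/0]_(1 <= j < size v) mdist (Tw (take j v) x) (Tw (take j v) y)).

Definition ruelle_expanding_map (a lambda : R) (S : X -> X) :=
  forall x y x' : X, mdist x y < a -> S x' = x ->
    exists y' : X, unique (fun z => S z = y /\ mdist x' z < a) y' /\
      mdist x' y' <= lambda * mdist x y.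

Definition ruelle_expanding (a lambda : R) :=
  [/\ 0 < a, 0 < lambda < 1 & forall i, ruelle_expanding_map a lambda (T i)].

Definition jointly_topologically_mixing :=
  forall U V : set X, open U -> open V -> U !=set0 -> V !=set0 ->
    exists m : nat, forall w : seq W, (m <= size w)%N ->
      Tw w @^-1` U `&` V !=set0.

Definition finitely_aperiodic (a : R) :=
  exists (n : nat) (K : set X) (r : R), finite_set K /\ 0 < r /\
    forall (x : X) (w : seq W), size w = n ->
      exists xi eta : X, [/\ K xi, K eta,
        exists xis : X, Tw w xis = xi /\ dw w x xis < a
      & exists xs : X, [/\ Tw w xs = x, mdist xs eta < a & dw w xs eta < r]].

End semigroup.

Section operators.
Context (R : realType) (X : completeMetricType R) (W : alphabetType).
Variables (T : W -> X -> X) (a lambda alpha : R) (phi : W -> X -> R).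

(* On a one-point X the set is empty and the supremum is -oo, which fine reads
   as 0 in Cphi and which the first term dominates in the maximum Dbar. *)
Definition Dalpha (f : X -> R) : \bar R :=
  ereal_sup [set (`|f z.1 - f z.2| / mdist z.1 z.2 `^ alpha)%:E
            | z in [set z : X * X | z.1 != z.2]].

Definition hoelder_space (f : X -> R) :=
  bounded_fun (f : X -> R^o) /\ (Dalpha f < +oo)%E.

Fixpoint phiw (v : seq W) (y : X) : R :=
  if v is i :: v' then phi i y + phiw v' (T i y) else 0.

Definition Lop (v : seq W) (f : X -> R) (x : X) : R :=
  sum_over (Tw T v @^-1` [set x]) (fun y => expR (phiw v y) * f y).

(* Stated in \bar R: a divergent L_i(1)(x) must not be read as 0. *)
Definition summable_potential (i : W) :=
  (ereal_sup (range (fun x : X =>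
     \esum_(y in T i @^-1` [set x]) (expR (phi i y))%:E)) < +oo)%E.

Definition Pop (u v : seq W) (f : X -> R) (x : X) : R :=
  Lop v (fun y => f y * Lop u (cst 1) y) x / Lop (u ++ v) (cst 1) x.

(* nu' = (P_u^v)^* nu; bounded continuous f suffice to determine nu'. *)
Definition dual_P (u v : seq W) (nu nu' : probability (borel X) R) :=
  forall f : X -> R, continuous f -> bounded_fun (f : X -> R^o) ->
    \int[nu']_x f x = \int[nu]_x Pop u v f x.

Definition Cphi : R :=
  \big[Num.max/0]_(i : W) fine (Dalpha (phi i)) / (1 - lambda `^ alpha).

Definition Delta : R := Num.max (4 * Cphi) (a `^ (- alpha)).

Definition dstar (x y : X) : R := Num.min 1 (Delta * mdist x y `^ alpha).

Definition Dbar (f : X -> R) : \bar R :=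
  maxe (ereal_sup (range (fun z : X * X => `|f z.1 - f z.2|%:E)))
    ((Delta^-1)%:E *
     ereal_sup [set (`|f z.1 - f z.2| / mdist z.1 z.2 `^ alpha)%:E
       | z in [set z : X * X | (0 < mdist z.1 z.2 < Delta `^ (- alpha^-1))%R]])%E.

Definition Wbar (nu1 nu2 : probability (borel X) R) : \bar R :=
  ereal_inf [set (\int[gamma]_z (dstar z.1 z.2)%:E)%E | gamma in coupling nu1 nu2].

Definition contraction_from (k0 : nat) (s : R) :=
  forall u v : seq W, (k0 <= size v)%N ->
    (forall nu1 nu2 nu1' nu2' : probability (borel X) R,
       dual_P u v nu1 nu1' -> dual_P u v nu2 nu2' ->
       (Wbar nu1' nu2' <= (s ^+ size v)%:E * Wbar nu1 nu2)%E) /\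
    (forall f : X -> R, (Dbar f < +oo)%E ->
       (Dbar (Pop u v f) <= (s ^+ size v)%:E * Dbar f)%E).

(* mu_omega is the weak limit of (P_{empty}^{[omega]_l})^* nu, for every nu;
   the integral of f against that dual measure is the nu-integral of P f,
   as in dual_P. *)
Definition fiber_measures (mu : words R W -> probability (borel X) R) :=
  forall (omega : words R W) (nu : probability (borel X) R) (f : X -> R),
    continuous f -> bounded_fun (f : X -> R^o) ->
    (fun l : nat => \int[nu]_x Pop [::] (prefix_word omega l) f x) @ \oo -->
      \int[mu omega]_x f x.

Definition annealed (rho : probability (borel (words R W)) R)
    (Sigma : set (words R W)) (n : nat) (f : X -> R) (x : X) : R :=
  \int[rho]_(omega in Sigma) Lop (prefix_word omega n) f x.

Definition lambda_fiber (mu : words R W -> probability (borel X) R)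
    (i : W) (omega : words R W) : R :=
  \int[mu omega]_x Lop [:: i] (cst 1) x.

Definition iota_op (mu : words R W -> probability (borel X) R)
    (Sigma : set (words R W)) (p : W -> words R W -> R)
    (g : words R W -> R) (omega : words R W) : R :=
  \sum_(i : W | `[< Sigma (wcons i omega) >])
    lambda_fiber mu i omega * p i omega * g (wcons i omega).

Definition RPF_data (mu : words R W -> probability (borel X) R)
    (Sigma : set (words R W)) (p : W -> words R W -> R)
    (beta : R) (m : probability (borel (words R W)) R) (go : words R W -> R) :=
  [/\ 0 < beta, m Sigma = 1%E,
      forall g : words R W -> R, {within Sigma, continuous g} ->
        \int[m]_(omega in Sigma) iota_op mu Sigma p g omega =
        beta * \int[m]_(omega in Sigma) g omega
    & [/\ {within Sigma, continuous go},
          forall omega, Sigma omega -> 0 < go omega,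
          forall omega, Sigma omega ->
            iota_op mu Sigma p go omega = beta * go omega
        & \int[m]_(omega in Sigma) go omega = 1]].

Definition int_pi (mu : words R W -> probability (borel X) R)
    (Sigma : set (words R W)) (m : probability (borel (words R W)) R)
    (f : X -> R) : R :=
  \int[m]_(omega in Sigma) \int[mu omega]_x f x.

Definition norm_m (mu : words R W -> probability (borel X) R)
    (Sigma : set (words R W)) (f : X -> R) : \bar R :=
  ereal_sup [set (\int[mu omega]_x `|f x|%:E)%E | omega in Sigma].

End operators.

(* Main.v *)
(* Fix x and write G_n(w) = L_{[w]_n}(1)(x) and F(w) = int f dmu_w. Contraction of
   the operators P gives L_{[w]_n}(f)(x) = G_n(w) (F(w) + O(s^n)); applied to
   f = L_i(1) it gives G_{n+1}(iw) = lambda_{i,w} G_n(w) (1 + O(s^n)). By the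
   Jacobian of rho, int G_{n+1} g drho therefore equals int G_n iota(g) drho up to
   a factor 1 + O(s^n), so beta^-n int G_n g_o drho converges geometrically to some
   h(x) > 0. The Markov operator Q(g) = iota(g_o g) / (beta g_o) has a spectral gap,
   by a Doeblin minorisation (the subshift is mixing) and the log-Hoelder
   continuity of its weights. For g = F / g_o, half of the n steps bring Q^{n/2}(g)
   close to its mean int F dm, while the other half keeps the O(s^{n/2}) error of
   replacing G_n by G_{n/2} under control; this is why n >= 2 k_0. Uniformity in x,
   also for small n, comes from a lower bound on L_i(1), which is what finite
   aperiodicity provides. *)

Require Import Defs.
From mathcomp Require Import all_boot all_order all_algebra.
From mathcomp Require Import all_classical all_reals all_analysis.
From mathcomp Require Import ring lra.

Set Implicit Arguments.
Unset Strict Implicit.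
Unset Printing Implicit Defensive.

Import Order.TTheory GRing.Theory Num.Theory.
Import numFieldNormedType.Exports.

Local Open Scope classical_set_scope.
Local Open Scope ring_scope.

(** All errors are kept relative. Contraction bounds [L_v(f) - F L_v(1)] by a multiple of [L_v(1)]
    at the same point, so [G_n] stays a factor of every error and integrates to a multiple of h(x);
    this keeps the constants free of x. The defect in [G_{n+1}(iw)] is O(s^n) for the current length
    n. Trading the letters from n down to k for iterates of Q thus costs a geometric sum of order
    s^k: trading all of them leaves an error that does not decay, trading too few leaves Q no time.
    Regularity on Sigma is counted in common letters, at the rate tau, the larger of s and the rate
    of the [p i], and only beyond M letters, where both the memory of the subshift and k_0 are
    covered. The function h is Hoelder because the distortion of [L_v(1)] has a constant independent
    of v, which survives integration over v and the limit. The first estimate is the second one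
    divided by its case f = 1. Where n is too small for the error in that case to be below 1, the
    denominator is bounded below by a two-sided comparison of beta^-n A_n(1)(x) with h(x). *)

Lemma geometric_eventually_le (R : realType) (r C e : R) (k0 : nat) :
  0 < r < 1 -> 0 < e -> exists2 n, (k0 <= n)%N & C * r ^+ n <= e.
Proof.
move=> /andP[r0 r1] e0.
have : (fun n => C * r ^+ n) @ \oo --> C * 0.
  by apply: cvgM; [exact: cvg_cst|apply: cvg_expr; rewrite gtr0_norm].
rewrite mulr0 => /cvgrPdist_le/(_ _ e0)[n _ Hn]; exists (maxn k0 n).
  exact: leq_maxl.
by have := Hn _ (leq_maxr k0 n); rewrite sub0r normrN; exact/le_trans/ler_norm.
Qed.

Lemma finite_min_gt0 (R : realType) (I : finType) (f : I -> R) :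
  (forall i, 0 < f i) -> exists2 c, 0 < c & forall i, c <= f i.
Proof.
move=> f0; have s0 : 0 <= \sum_i (f i)^-1.
  by apply: sumr_ge0 => i _; rewrite invr_ge0 ltW.
(* No minimiser is chosen: [(f i)^-1] is at most the sum of all the inverses, and the summand 1
   keeps the witness positive when [I] is empty. *)
exists (1 + \sum_i (f i)^-1)^-1 => [|i]; first by rewrite invr_gt0 ltr_pwDl.
rewrite -[leRHS]invrK lef_pV2 ?posrE ?invr_gt0 ?ltr_pwDl//.
rewrite (bigD1 i)//= addrCA lerDl addr_ge0//.
by apply: sumr_ge0 => j _; rewrite invr_ge0 ltW.
Qed.

(** This is [1 - t <= expR (- t)] multiplied by [expR t], so the sign of [t] is free. *)
Lemma expR_sub1_le_mul (R : realType) (t : R) : expR t - 1 <= t * expR t.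
Proof.
have := ler_wpM2l (expR_ge0 t) (expR_ge1Dx (- t)).
by rewrite expRN divff ?gt_eqF ?expR_gt0//; lra.
Qed.

Lemma expR_sub1_le (R : realType) (t b : R) : `|t| <= b -> `|expR t - 1| <= `|t| * expR b.
Proof.
move=> tb.
have h1 := expR_ge1Dx t.
have h2 := expR_sub1_le_mul t.
have b0 : 0 <= b := le_trans (normr_ge0 _) tb.
have eb : 1 <= expR b by rewrite (le_trans _ (expR_ge1Dx b))// lerDl.
have [t0|t0] := lerP 0 t.
  rewrite (ger0_norm t0) in tb *; rewrite ger0_norm; last lra.
  by rewrite (le_trans h2)// ler_wpM2l// ler_expR.
have e1 : expR t <= 1 by rewrite -(expR0 R) ler_expR ltW.
rewrite ler0_norm ?subr_le0// (ltr0_norm t0).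
have : - t * 1 <= - t * expR b by apply: ler_wpM2l => //; lra.
lra.
Qed.

(** Converts multiplicative distortion into an additive modulus that is linear in [d]; the cap [m]
    on [k * d] enters only the constant. It serves for [L_i(1)], for the [p i] and for h. *)
Lemma expR_ratio_diff (R : realType) (k m u v S d : R) :
  0 <= v -> v <= S -> 0 <= k * d -> k * d <= m -> u <= expR (k * d) * v ->
  u - v <= S * (expR m * k) * d.
Proof.
move=> v0 vS kd0 kdm uv.
have e1 := expR_sub1_le_mul (k * d).
have e2 : k * d * expR (k * d) <= k * d * expR m.
  by apply: ler_wpM2l => //; rewrite ler_expR.
have e3 := ler_wpM2r v0 (le_trans e1 e2).
have e4 := ler_wpM2l (mulr_ge0 (expR_ge0 m) kd0) vS; lra.
Qed.

(** * Words *)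

Section words_topology.
Context (R : realType) (W : alphabetType).
Implicit Types (x y : words R W) (Sigma : set (words R W)).

(** By [mdist_agree] these are the closed balls of radius 2^-n. Counting letters makes prepending a
    letter a gain of exactly one. *)
Definition agree (n : nat) x y := forall j, (j < n)%N -> x j = y j.

Lemma agree_sym n x y : agree n x y -> agree n y x.
Proof. by move=> xy j /xy. Qed.

Lemma agree_le n k x y : (k <= n)%N -> agree n x y -> agree k x y.
Proof. by move=> kn xy j jk; apply: xy; exact: leq_trans kn. Qed.

Lemma agree_prefix n x y : agree n x y -> prefix_word x n = prefix_word y n.
Proof. by move=> xy; apply/eq_in_map => j; rewrite mem_iota add0n => /xy. Qed.

Lemma prefix_agree n x y : prefix_word x n = prefix_word y n -> agree n x y.
Proof.
move=> xy j jn; have := congr1 (fun v => nth point v j) xy.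
by rewrite !nth_mkseq.
Qed.

Lemma agree_wcons n i x y : agree n x y -> agree n.+1 (wcons i x) (wcons i y).
Proof. by move=> xy [|j]//; rewrite ltnS => /xy. Qed.

Lemma wcons_shift x : wcons (x 0%N) (word_shift x) = x.
Proof. by apply/funext => -[]. Qed.

Lemma iter_shiftE k x j : iter k (@word_shift R W) x j = x (k + j)%N.
Proof. by elim: k j => [//|k IH] j; rewrite iterS /word_shift IH addnS addSn. Qed.

Lemma mdist_agree n x y : mdist x y <= 2^-1 ^+ n <-> agree n x y.
Proof.
change (mdist x y) with (word_dist x y); rewrite /word_dist.
have h0 : (0 : R) < 2^-1 by rewrite invr_gt0.
have h1 : 2^-1 < 1 :> R by rewrite invf_lt1// ltr1n.
case: pselect => [E|nE]; last first.
  split=> _; last by rewrite exprn_ge0// ltW.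
  by move=> j _; apply: contrapT => /eqP xyj; apply: nE; exists j.
case: ex_minnP => j xyj minj; rewrite ler_iXn2l//; split=> [nj k kn|xy].
  apply/eqP; apply: contraT => /minj jk.
  by have := leq_trans kn (leq_trans nj jk); rewrite ltnn.
by rewrite leqNgt; apply: contra xyj => /xy ->.
Qed.

Lemma nbhs_agree n x : nbhs x (agree n x).
Proof.
rewrite -metricType_numDomainType.filter_from_mdist_nbhs; exists (2^-1 ^+ n) => /=.
  by rewrite exprn_gt0// invr_gt0.
by move=> y /= /ltW /mdist_agree.
Qed.

Lemma agree_nbhs x (U : set (words R W)) :
  nbhs x U -> exists n, agree n x `<=` U.
Proof.
rewrite -metricType_numDomainType.filter_from_mdist_nbhs => -[e /= e0 xU].
have [n ne] : exists n, 2^-1 ^+ n < e.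
  have : (fun n => 2^-1 ^+ n : R) @ \oo --> (0 : R).
    by apply: cvg_expr; rewrite ger0_norm ?invr_ge0// invf_lt1// ltr1n.
  move/cvgrPdist_lt => /(_ _ e0)[n _ /(_ n (leqnn n))].
  rewrite sub0r normrN ger0_norm => [ne|]; first by exists n.
  by rewrite exprn_ge0// invr_ge0.
by exists n => y /mdist_agree xy; apply: xU; exact: le_lt_trans ne.
Qed.

(** The alphabet is finite, so an ultrafilter on words contains, for each j, the set of words with
    some fixed j-th letter; the word made of these letters is its limit. *)
Lemma words_compact : compact [set: words R W].
Proof.
rewrite compact_ultra => F FU _.
have Fj j : exists i, F [set x : words R W | x j = i].
  apply: contrapT => /forallNP nF.
  have /filter_ex[x /(_ (x j))] : F [set x : words R W | forall i, x j <> i].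
    apply: filter_forall => i.
    by have [/nF|] := @in_ultra_setVsetC _ F [set x : words R W | x j = i] FU.
  by [].
have [y Fy] := boolp.choice Fj.
exists y; split=> //= U /agree_nbhs[n yU]; apply: filterS yU _.
have : forall n, F (agree n (y : words R W)).
  elim=> [|k IH]; first by apply: filterE.
  apply: filterS (filterI IH (Fy k)) => x [/= xy xk] j.
  by rewrite ltnS leq_eqVlt => /predU1P[->//|/xy].
exact.
Qed.

(** For closed Sigma, which is then compact, this is the same as continuity on Sigma; boundedness,
    measurability and integrability all follow from it. *)
Definition ucont Sigma (g : words R W -> R) := forall e, 0 < e ->
  exists n, forall x y, Sigma x -> Sigma y -> agree n x y -> `|g x - g y| <= e.

Lemma ucont_within Sigma g : ucont Sigma g -> {within Sigma, continuous g}.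
Proof.
move=> gu; apply/subspace_continuousP => x Sx.
apply/cvgrPdist_le => e /gu[n gn].
rewrite near_withinE; apply: filterS (nbhs_agree n x) => y xy Sy.
exact: gn.
Qed.

(** Compactness in its near-covering form. Since [agree n] is an equivalence relation, words that
    agree with x inherit its estimate with the same n, and only [e] is halved. *)
Lemma within_ucont Sigma g :
  closed Sigma -> {within Sigma, continuous g} -> ucont Sigma g.
Proof.
move=> cS /subspace_continuousP gc e e0.
have /compact_near_coveringP/near_covering_withinP cov : compact Sigma.
  by apply: subclosed_compact words_compact _.
have {cov} := cov nat \oo
  (fun n x => forall y, Sigma y -> agree n x y -> `|g x - g y| <= e) _.
case=> [x Sx|n _ /(_ _ (leqnn n)) H]; last first.
  by exists n => x y /H; exact.
have e20 : 0 < e / 2 by rewrite divr_gt0.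
have /cvgrPdist_le/(_ _ e20) := gc x Sx.
rewrite near_withinE => /agree_nbhs[n xn].
exists (agree n x, [set k | (n <= k)%N]).
  by split; [exact: nbhs_agree|exists n].
case=> y k [/= xy nk] Sy z Sz yz.
rewrite -(subrKA (g x)) (splitr e) (le_trans (ler_normD _ _))// lerD//.
  by rewrite distrC; exact: xn.
apply: xn => // j jn; rewrite xy// yz//; exact: leq_trans nk.
Qed.

Lemma ucont_norm Sigma g : ucont Sigma g -> ucont Sigma (fun x => `|g x|).
Proof.
move=> gu e /gu[n gn]; exists n => x y Sx Sy xy.
exact: le_trans (ler_dist_dist _ _) (gn _ _ Sx Sy xy).
Qed.

Lemma ucont_bounded Sigma g : closed Sigma -> ucont Sigma g ->
  exists2 B, 0 <= B & forall x, Sigma x -> `|g x| <= B.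
Proof.
move=> cS gu.
have [S0|/set0P S0] := eqVneq Sigma set0; first by exists 0 => // x; rewrite S0.
have kS : compact Sigma by apply: subclosed_compact words_compact _.
have gc := ucont_within (ucont_norm gu).
have [c cS' cmax] := compact_EVT_max S0 kS gc.
exists `|g c| => // x Sx; exact/cmax/mem_set.
Qed.

Lemma ucont_cst Sigma c : ucont Sigma (fun=> c).
Proof. by move=> e e0; exists 0%N => x y _ _ _; rewrite subrr normr0 ltW. Qed.

Lemma ucontD Sigma g h :
  ucont Sigma g -> ucont Sigma h -> ucont Sigma (fun x => g x + h x).
Proof.
move=> gu hu e e0; have e20 : 0 < e / 2 by rewrite divr_gt0.
have [n gn] := gu _ e20; have [k hk] := hu _ e20.
exists (maxn n k) => x y Sx Sy xy.
rewrite opprD addrACA (splitr e) (le_trans (ler_normD _ _))// lerD//.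
  by apply: gn => //; apply: agree_le xy; rewrite leq_maxl.
by apply: hk => //; apply: agree_le xy; rewrite leq_maxr.
Qed.

Lemma ucontM Sigma g h : closed Sigma ->
  ucont Sigma g -> ucont Sigma h -> ucont Sigma (fun x => g x * h x).
Proof.
move=> cS gu hu e e0.
have [B B0 gB] := ucont_bounded cS gu; have [D D0 hD] := ucont_bounded cS hu.
have e1 : 0 < e / 2 / (D + 1) by rewrite !divr_gt0// ltr_wpDl.
have e2 : 0 < e / 2 / (B + 1) by rewrite !divr_gt0// ltr_wpDl.
have [n gn] := gu _ e1; have [k hk] := hu _ e2.
exists (maxn n k) => x y Sx Sy xy.
have -> : g x * h x - g y * h y = (g x - g y) * h x + g y * (h x - h y) by ring.
rewrite (splitr e) (le_trans (ler_normD _ _))// lerD// normrM.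
  have := gn x y Sx Sy (agree_le (leq_maxl _ _) xy).
  rewrite ler_pdivlMr; last by rewrite ltr_wpDl.
  apply: le_trans; rewrite ler_wpM2l//.
  by rewrite (le_trans (hD _ Sx))// lerDl.
have := hk x y Sx Sy (agree_le (leq_maxr _ _) xy).
rewrite ler_pdivlMr; last by rewrite ltr_wpDl.
apply: le_trans; rewrite mulrC ler_wpM2l//.
by rewrite (le_trans (gB _ Sy))// lerDl.
Qed.

Lemma ucontN Sigma g : ucont Sigma g -> ucont Sigma (fun x => - g x).
Proof.
move=> gu e /gu[n gn]; exists n => x y Sx Sy xy.
by rewrite -opprD normrN gn.
Qed.

Lemma ucont_sum Sigma (I : Type) (r : seq I) (P : pred I) (g : I -> words R W -> R) :
  (forall i, P i -> ucont Sigma (g i)) ->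
  ucont Sigma (fun x => \sum_(i <- r | P i) g i x).
Proof.
move=> gu; elim: r => [|i r IH].
  rewrite (_ : (fun x => _) = fun=> 0); first exact: ucont_cst.
  by apply/funext => x; rewrite big_nil.
rewrite (_ : (fun x => _) = if P i then
    fun x => g i x + \sum_(j <- r | P j) g j x
  else fun x => \sum_(j <- r | P j) g j x); last first.
  by apply/funext => x; rewrite big_cons; case: ifP.
by case: ifPn => // Pi; apply: ucontD => //; exact: gu.
Qed.

Lemma locally_constant_ucont Sigma g n :
  (forall x y, agree n x y -> g x = g y) -> ucont Sigma g.
Proof.
move=> gn e e0; exists n => x y _ _ /gn ->.
by rewrite subrr normr0 ltW.
Qed.

Lemma ucont_inv Sigma g c : 0 < c -> (forall x, Sigma x -> c <= g x) ->
  ucont Sigma g -> ucont Sigma (fun x => (g x)^-1).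
Proof.
move=> c0 gc gu e e0.
have [n gn] : exists n, forall x y, Sigma x -> Sigma y -> agree n x y ->
    `|g x - g y| <= e * c ^+ 2 by apply: gu; rewrite mulr_gt0// exprn_gt0.
exists n => x y Sx Sy xy.
have gx0 := lt_le_trans c0 (gc _ Sx); have gy0 := lt_le_trans c0 (gc _ Sy).
have -> : (g x)^-1 - (g y)^-1 = (g y - g x) / (g x * g y).
  by field; rewrite !gt_eqF.
have gxy0 : 0 < g x * g y by rewrite mulr_gt0.
rewrite normrM normfV distrC (gtr0_norm gxy0) ler_pdivrMr//.
rewrite (le_trans (gn _ _ Sx Sy xy))// ler_wpM2l//; first exact: ltW.
by rewrite expr2 ler_pM ?gc// ltW.
Qed.

End words_topology.

(** * Integration of uniformly continuous functions on words *)

Section integration_on_words.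
Context (R : realType) (W : alphabetType).
Variables (P : probability (borel (words R W)) R) (Sigma : set (words R W)).
Hypothesis Sigma_closed : closed Sigma.

Lemma closed_measurable_borel : measurable (Sigma : set (borel (words R W))).
Proof.
rewrite -(setCK Sigma); apply: measurableC.
by apply: sub_sigma_algebra; exact/closed_openC.
Qed.

Lemma ucont_measurable g : ucont Sigma g ->
  measurable_fun (Sigma : set (borel (words R W))) g.
Proof.
move=> gu; apply: (measurability _ (measurable_realfun.RGenOpens.measurableE R)).
move=> _ [_ [a [b ->] <-]].
have /continuousP gc := ucont_within gu.
have oS : open (g @^-1` `]a, b[ : set (subspace Sigma)) by exact/gc/interval_open.
have /open_subspaceP[U oU UE] := oS.
rewrite setIC -UE setIC; apply: measurableI; first exact: closed_measurable_borel.
exact: sub_sigma_algebra.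
Qed.

Lemma ucont_integrable g : ucont Sigma g -> P.-integrable Sigma (EFin \o g).
Proof.
move=> gu; apply: measurable_bounded_integrable.
- exact: closed_measurable_borel.
- exact: le_lt_trans (probability_le1 _ closed_measurable_borel) (ltry _).
- exact: ucont_measurable.
- have [B B0 gB] := ucont_bounded Sigma_closed gu.
  exists B; split; first exact: num_real.
  by move=> C BC x Sx; apply: le_trans (gB _ Sx) (ltW BC).
Qed.

Local Notation I g := (\int[P]_(x in Sigma) g x).

Lemma wintD g h : ucont Sigma g -> ucont Sigma h ->
  I (fun x => g x + h x) = I g + I h.
Proof.
by move=> gu hu; apply: RintegralD; [exact: closed_measurable_borel|
  exact: ucont_integrable..].
Qed.

Lemma wintZ c g : ucont Sigma g -> I (fun x => c * g x) = c * I g.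
Proof.
by move=> gu; apply: RintegralZl; [exact: closed_measurable_borel|
  exact: ucont_integrable].
Qed.

Lemma wintB g h : ucont Sigma g -> ucont Sigma h ->
  I (fun x => g x - h x) = I g - I h.
Proof.
by move=> gu hu; apply: RintegralB; [exact: closed_measurable_borel|
  exact: ucont_integrable..].
Qed.

Lemma wint_le g h : ucont Sigma g -> ucont Sigma h ->
  (forall x, Sigma x -> g x <= h x) -> I g <= I h.
Proof.
by move=> gu hu gh; apply: le_Rintegral; [exact: closed_measurable_borel|
  exact: ucont_integrable..|].
Qed.

Lemma wint_norm g : ucont Sigma g -> `|I g| <= I (fun x => `|g x|).
Proof.
by move=> gu; apply: le_normr_Rintegral; [exact: closed_measurable_borel|
  exact: ucont_integrable].
Qed.

Lemma wint_cst c : I (fun=> c) = c * fine (P Sigma).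
Proof. by apply: Rintegral_cst; exact: closed_measurable_borel. Qed.

Lemma wint_eq g h : (forall x, Sigma x -> g x = h x) -> I g = I h.
Proof. by move=> gh; apply: eq_Rintegral => x /[!inE]; exact: gh. Qed.

Lemma wint_sum (J : Type) (r : seq J) (Q : pred J) (g : J -> words R W -> R) :
  (forall i, Q i -> ucont Sigma (g i)) ->
  I (fun x => \sum_(i <- r | Q i) g i x) = \sum_(i <- r | Q i) I (g i).
Proof.
move=> gu; elim: r => [|i r IH].
  rewrite big_nil (@wint_eq _ (fun=> 0)) ?wint_cst ?mul0r// => x _.
  by rewrite big_nil.
rewrite big_cons -IH; case: ifPn => Qi.
  rewrite -wintD; [|exact: gu|exact: ucont_sum].
  by apply: wint_eq => x _; rewrite big_cons Qi.
by apply: wint_eq => x _; rewrite big_cons (negPf Qi).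
Qed.

End integration_on_words.

(** * Cylinders, the support and the Jacobian of the base measure *)

Section base_measure.
Context (R : realType) (W : alphabetType).
Implicit Types (x y : words R W) (Sigma : set (words R W)).

Lemma msupport_closed (T : ptopologicalType) (mu : set (borel T) -> \bar R) :
  closed (msupport mu).
Proof.
rewrite -(setCK (msupport mu)); apply: open_closedC.
rewrite openE => x /existsNP[U /not_implyP[oU /not_implyP[Ux mU]]].
rewrite /interior nbhsE; exists U => // y Uy /(_ U oU Uy); exact: mU.
Qed.

Definition cyl (v : seq W) : set (words R W) :=
  [set x | prefix_word x (size v) = v].

Lemma cyl_prefix x n : cyl (prefix_word x n) x.
Proof. by rewrite /cyl/= size_mkseq. Qed.

Lemma cyl_agree v x y : cyl v x -> cyl v y -> agree (size v) x y.
Proof. by move=> xv yv; apply: prefix_agree; rewrite xv yv. Qed.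

Lemma cyl_open v : open (cyl v).
Proof.
rewrite openE => x xv; apply: filterS (nbhs_agree (size v) x) => y.
by move=> /agree_prefix xy; rewrite /cyl/= -xy.
Qed.

Lemma cyl_measurable v : measurable (cyl v : set (borel (words R W))).
Proof. by apply: sub_sigma_algebra; exact: cyl_open. Qed.

Lemma prefix_wcons (i : W) x n :
  prefix_word (wcons i x) n.+1 = i :: prefix_word x n.
Proof.
rewrite /prefix_word /mkseq /= (iotaDl 1 0) -map_comp.
by congr cons.
Qed.

(** A point outside the support lies in a null open set, hence in a null cylinder, and there are
    only countably many cylinders. *)
Lemma msupport_full (rho : probability (borel (words R W)) R) :
  rho (msupport rho) = 1%E.
Proof.
have mS : measurable (msupport rho : set (borel (words R W))).
  by apply: closed_measurable_borel; exact: msupport_closed.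
suff : rho (~` msupport rho) = 0%E.
  move=> S0; rewrite -[X in rho X]setCK probability_setC ?S0 ?sube0//.
  exact: measurableC.
(* [unpickle] enumerates the finite words; those with a non-null cylinder contribute the empty
   set. *)
pose F (n : nat) : set (borel (words R W)) :=
  if @unpickle (seq W) n is Some v then
    if rho (cyl v) == 0%E then cyl v else set0 else set0.
have nF : rho.-negligible (\bigcup_n F n).
  apply: negligible_bigcup => n; rewrite /F.
  case: unpickle => [v|]; last exact: negligible_set0.
  case: ifPn => [/eqP v0|_]; last exact: negligible_set0.
  by exists (cyl v); split => //; exact: cyl_measurable.
apply/negligibleP; first exact: measurableC.
apply: negligibleS nF => x /existsNP[U /not_implyP[oU /not_implyP[Ux]]] /negP.
rewrite -leNgt => U0.
have [n xU] : exists n, agree n (x : words R W) `<=` U.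
  by apply: agree_nbhs; exact: open_nbhs_nbhs.
exists (pickle (prefix_word x n)) => //.
rewrite /F pickleK ifT; first exact: cyl_prefix.
rewrite eq_le measure_ge0 andbT (le_trans _ U0)// le_measure ?inE//.
- exact: cyl_measurable.
- exact: sub_sigma_algebra.
move=> y xy; apply: xU; have := cyl_agree (cyl_prefix x n) xy.
by rewrite size_mkseq.
Qed.

Variables (rho : probability (borel (words R W)) R) (Sigma : set (words R W)).
Variables (p : W -> words R W -> R) (M : nat).
Hypothesis Sigma_closed : closed Sigma.
Hypothesis Sigma_shift : forall x, Sigma x -> Sigma (word_shift x).
Hypothesis Sigma_memory : forall i x y, Sigma x -> Sigma y -> agree M x y ->
  Sigma (wcons i x) -> Sigma (wcons i y).

(** Extension by 0 off the domain of the branch. It keeps [ucont], because M letters of x decide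
    whether [wcons i x] is in Sigma, and it is harmless under the weight [p i], which vanishes
    there. *)
Definition branch i (g : words R W -> R) x : R :=
  if pselect (Sigma (wcons i x)) then g (wcons i x) else 0.

Lemma ucont_branch i g : ucont Sigma g -> ucont Sigma (branch i g).
Proof.
move=> gu e e0; have [n gn] := gu e e0.
exists (maxn M n) => x y Sx Sy xy; rewrite /branch.
have xyM := agree_le (leq_maxl M n) xy.
case: pselect => ix; case: pselect => iy.
- apply: gn => //; apply: (@agree_le _ _ n.+1) => //; apply: agree_wcons.
  exact: agree_le (leq_maxr M n) xy.
- by case: iy; exact: Sigma_memory ix.
- by case: ix; apply: Sigma_memory iy => //; exact: agree_sym.
- by rewrite subrr normr0 ltW.
Qed.

Hypothesis p_jacobian : base_jacobian rho Sigma p.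
Hypothesis p_ucont : forall i, ucont Sigma (p i).

(** The transfer operator with weights [p], whose dual fixes [rho] by [jacobian_integral]. *)
Definition pullback g x := \sum_i p i x * g (wcons i x).

Let pg_branch i g x : p i x * g (wcons i x) = p i x * branch i g x.
Proof.
rewrite /branch; case: pselect => //= ix.
by have [_ ->//] := p_jacobian; rewrite !mul0r.
Qed.

Lemma ucont_pg i g : ucont Sigma g ->
  ucont Sigma (fun x => p i x * g (wcons i x)).
Proof.
move=> gu; under eq_fun do rewrite pg_branch.
by apply: ucontM => //; exact: ucont_branch.
Qed.

Lemma ucont_pullback g : ucont Sigma g -> ucont Sigma (pullback g).
Proof. by move=> gu; apply: ucont_sum => i _; exact: ucont_pg. Qed.


Let ind v : words R W -> R := \1_(cyl v).

Let ind_ucont v : ucont Sigma (ind v).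
Proof.
apply: (@locally_constant_ucont _ _ _ _ (size v)) => x y /agree_prefix xy.
rewrite /ind !indicE; congr (_%:R); congr nat_of_bool.
by apply/idP/idP => /set_mem xv; apply/mem_set; move: xv;
  rewrite /cyl/= ?xy// -?xy.
Qed.

Let cyl_wcons i v x : cyl (i :: v) (wcons i x) <-> cyl v x.
Proof. by rewrite /cyl/= prefix_wcons; split => [[]|->]. Qed.

(** Only the letter i contributes, and [wcons i] maps the part of [branch_dom Sigma i] in [cyl v]
    onto the part of Sigma in [cyl (i :: v)]; surjectivity is the shift invariance of Sigma. What
    remains is the defining property of [p i]. *)
Let pullback_ind i v : \int[rho]_(x in Sigma) pullback (ind (i :: v)) x =
  \int[rho]_(x in Sigma) ind (i :: v) x.
Proof.
have mS := closed_measurable_borel Sigma_closed.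
(* The domain is measurable as the set where the [ucont] function [branch i (fun=> 1)] is
   positive. *)
have mb : measurable (branch_dom Sigma i : set (borel (words R W))).
  rewrite (_ : branch_dom Sigma i =
      Sigma `&` (branch i (fun=> 1) @^-1` `]0, +oo[)); last first.
    apply/seteqP; split=> x /=; rewrite /branch; case: pselect => ix [Sx].
    - by rewrite in_itv/= ltr01.
    - by [].
    - by [].
    - by rewrite in_itv/= ltxx.
  apply: (ucont_measurable Sigma_closed _ mS); last exact: measurable_itv.
  by apply: ucont_branch; exact: ucont_cst.
transitivity (\int[rho]_(x in Sigma) ((p i \_ (branch_dom Sigma i `&` cyl v)) x)).
  apply: wint_eq => x Sx; rewrite /pullback (bigD1 i)//= big1 ?addr0.
    rewrite patchE /ind indicE; case: ifPn => [/set_mem[[_ ix] xv]|ixv].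
      by rewrite mem_set ?mulr1//; exact/cyl_wcons.
    have [ix|nix] := pselect (Sigma (wcons i x)).
      rewrite memNset ?mulr0// => /cyl_wcons xv.
      by move/negP: ixv; apply; apply/mem_set.
    by have [_ ->//] := p_jacobian; rewrite mul0r.
  move=> j ji; rewrite /ind indicE memNset ?mulr0//.
  rewrite /cyl/= prefix_wcons => -[ij _]; by rewrite ij eqxx in ji.
rewrite -Rintegral_mkcondr setIA [Sigma `&` _](_ : _ = branch_dom Sigma i); last first.
  by apply/seteqP; split => x /= [].
have [pj _] := p_jacobian.
rewrite /Rintegral -pj; last 2 first.
- by apply: measurableI => //; exact: cyl_measurable.
- by move=> x [].
rewrite integral_indic//; last exact: cyl_measurable.
congr (fine (rho _)); apply/seteqP; split => [_ [x [[Sx ix] xv] <-]|x [xv Sx]].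
  by split => //; exact/cyl_wcons.
have x0 : x 0%N = i by move: xv; rewrite /cyl/= => -[].
have ix := @wcons_shift R W x; rewrite x0 in ix.
exists (@word_shift R W x) => //; split; last by apply/(cyl_wcons i); rewrite ix.
by split; [exact: Sigma_shift|rewrite ix].
Qed.

(* Both sides agree on cylinder indicators, and these approximate [g] uniformly. *)
Lemma jacobian_integral g : ucont Sigma g ->
  \int[rho]_(x in Sigma) g x = \int[rho]_(x in Sigma) pullback g x.
Proof.
move=> gu; set K := \int[rho]_(x in Sigma) \sum_i `|p i x|.
suff H e : 0 < e -> `|\int[rho]_(x in Sigma) g x -
    \int[rho]_(x in Sigma) pullback g x| <= e * (1 + K).
  apply/eqP; rewrite -subr_eq0 -normr_le0; apply/ler_addgt0Pr => e e0.
  have K0 : 0 <= K by apply: Rintegral_ge0 => x _; exact: sumr_ge0.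
  have K1 : 0 < 1 + K by rewrite ltr_wpDr.
  by rewrite add0r (le_trans (H _ (divr_gt0 e0 K1)))// divfK// gt_eqF.
move=> e0; have [n gn] := gu e e0.
(* Words of length n.+1 rather than n, because [pullback_ind] needs a first letter. A cylinder that
   misses Sigma gets the value 0. *)
pose rep (v : n.+1.-tuple W) : R :=
  if pselect (exists x, Sigma x /\ cyl v x) is left ex then g (projT1 (cid ex)) else 0.
pose h x := \sum_v rep v * ind v x.
have hu : ucont Sigma h.
  by apply: ucont_sum => v _; apply: ucontM => //; exact: ucont_cst.
have gh x : Sigma x -> `|g x - h x| <= e.
  move=> Sx; rewrite /h.
  have sv : size (prefix_word x n.+1) == n.+1 by rewrite size_mkseq.
  rewrite (bigD1 (Tuple sv))//= big1 ?addr0 => [|v vx]; last first.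
    rewrite /ind indicE memNset ?mulr0// => xv; move/eqP : vx; apply.
    by apply/val_inj => /=; rewrite -xv size_tuple.
  have xv : cyl (prefix_word x n.+1) x := cyl_prefix x n.+1.
  rewrite /ind indicE mem_set// mulr1 /rep.
  case: pselect => [ex|[]]; last by exists x.
  case: cid => y /= [Sy yv]; apply: gn => //.
  apply: (@agree_le _ _ n.+1) => //.
  by have := cyl_agree xv yv; rewrite size_mkseq.
have ghu : ucont Sigma (fun x => g x - h x).
  by apply: ucontD => //; exact: ucontN.
have hh : \int[rho]_(x in Sigma) h x = \int[rho]_(x in Sigma) pullback h x.
  rewrite (@wint_eq _ _ _ _ (pullback h) (fun x => \sum_v rep v * pullback (ind v) x)); last first.
    move=> x _; rewrite /pullback /h.
    under eq_bigr do rewrite mulr_sumr.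
    rewrite exchange_big/=; apply: eq_bigr => v _.
    by rewrite mulr_sumr; apply: eq_bigr => i _; rewrite mulrCA.
  rewrite !wint_sum//; last 2 first.
  - by move=> v _; apply: ucontM => //; [exact: ucont_cst|exact: ucont_pullback].
  - by move=> v _; apply: ucontM => //; exact: ucont_cst.
  apply: eq_bigr => v _; rewrite !wintZ//; last exact: ucont_pullback.
  congr (_ * _); move: (size_tuple v); case: (tval v) => [//|i v' _].
  exact: esym (pullback_ind i v').
rewrite -(subrKA (\int[rho]_(x in Sigma) h x)) [X in _ + (X - _)]hh.
have pu := ucont_pullback.
have B1 := wintB rho Sigma_closed gu hu.
have B2 := wintB rho Sigma_closed (pu _ hu) (pu _ gu).
rewrite -B1 -B2 mulrDr mulr1 (le_trans (ler_normD _ _))// lerD//.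
  rewrite (le_trans (wint_norm _ _ _))//.
  apply: (@le_trans _ _ (\int[rho]_(x in Sigma) e)).
    by apply: wint_le => //; [exact: ucont_norm|exact: ucont_cst].
  have mS := closed_measurable_borel Sigma_closed.
  rewrite wint_cst// ler_piMr//; first exact: ltW.
  by rewrite -lee_fin fineK ?probability_le1//; exact: fin_num_measure.
have Ku : ucont Sigma (fun x => \sum_i `|p i x|).
  by apply: ucont_sum => i _; exact: ucont_norm.
have hgu : ucont Sigma (fun x => pullback h x - pullback g x).
  apply: ucontD; first exact: pu.
  by apply: ucontN; exact: pu.
rewrite /K -wintZ// (le_trans (wint_norm _ _ _))//.
apply: wint_le => //; first exact: ucont_norm.
  by apply: ucontM => //; exact: ucont_cst.
move=> x Sx; rewrite /pullback -sumrB mulr_sumr (le_trans (ler_norm_sum _ _ _))//.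
apply: ler_sum => i _; rewrite -mulrBr normrM mulrC.
have [ix|nix] := pselect (Sigma (wcons i x)).
  by rewrite ler_wpM2r// distrC gh.
by have [_ ->//] := p_jacobian; rewrite normr0 !mulr0.
Qed.

End base_measure.

(** * Transfer operators *)

Section signed_sums.
Context (R : realType) (T : choiceType) (A : set T).
Implicit Types f g : T -> R.

Definition abs_summable f := summable A (EFin \o f).

Lemma abs_summable_le f g :
  (forall y, A y -> `|f y| <= g y) -> (\esum_(y in A) (g y)%:E < +oo)%E ->
  abs_summable f.
Proof.
move=> fg goo; rewrite /abs_summable /summable (le_lt_trans _ goo)//.
by apply: le_esum => y Ay; rewrite /= lee_fin fg.
Qed.

Lemma sum_over_ge0E g : (forall y, A y -> 0 <= g y) ->
  sum_over A g = fine (\esum_(y in A) (g y)%:E).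
Proof.
move=> g0; rewrite /sum_over [X in _ - fine X]esum1 ?subr0; last first.
  by move=> y Ay; rewrite /funrneg; congr EFin; apply/max_idPr; rewrite oppr_le0 g0.
by congr fine; apply: eq_esum => y Ay; rewrite /funrpos; congr EFin; apply/max_idPl/g0.
Qed.

Lemma esum_lty f : abs_summable f -> (forall y, A y -> 0 <= f y) ->
  (\esum_(y in A) (f y)%:E < +oo)%E.
Proof.
move=> fs f0; rewrite (le_lt_trans _ fs)//; apply: le_esum => y Ay.
by rewrite /= lee_fin ler_norm.
Qed.

Lemma esum_fin f : abs_summable f -> (forall y, A y -> 0 <= f y) ->
  (\esum_(y in A) (f y)%:E \is a fin_num).
Proof.
by move=> fs f0; rewrite ge0_fin_numE ?esum_lty ?esum_ge0.
Qed.

(** Finite partial sums give one inequality; the same inequality for [c^-1] and [c * f] gives the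
    other. *)
Lemma ge0_esumZ c f : 0 <= c -> (forall y, 0 <= f y) ->
  (\esum_(y in A) (c * f y)%:E = c%:E * \esum_(y in A) (f y)%:E)%E.
Proof.
have le d g : 0 <= d -> (forall y, 0 <= g y) ->
    (\esum_(y in A) (d * g y)%:E <= d%:E * \esum_(y in A) (g y)%:E)%E.
  move=> d0 g0; apply: ge_ereal_sup => _ [X [finX XA] <-].
  under eq_fsbigr do rewrite EFinM.
  rewrite -ge0_mule_fsumr; last by move=> y; rewrite lee_fin.
  apply: lee_wpmul2l; first by rewrite lee_fin.
  by apply: ereal_sup_ubound; exists X.
rewrite le_eqVlt => /predU1P[<- _|c0 f0].
  by rewrite mul0e esum1// => y _; rewrite mul0r.
apply/eqP; rewrite eq_le le ?(ltW c0)//= -lee_pdivlMl//.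
apply: le_trans (le c^-1 (fun y => c * f y) _ _).
- by apply: le_esum => y _; rewrite mulKf ?gt_eqF.
- by rewrite invr_ge0 ltW.
- by move=> y; rewrite mulr_ge0// ltW.
Qed.

(** Every decomposition g = f1 - f2 into nonnegative summable families computes the sum, not only
    the one into positive and negative parts, because g^+ + f2 = g^- + f1. Linearity of [sum_over]
    rests on this freedom. *)
Lemma sum_overE f1 f2 : abs_summable f1 -> abs_summable f2 ->
  (forall y, A y -> 0 <= f1 y) -> (forall y, A y -> 0 <= f2 y) ->
  sum_over A (fun y => f1 y - f2 y) = sum_over A f1 - sum_over A f2.
Proof.
move=> s1 s2 p1 p2; rewrite (sum_over_ge0E p1) (sum_over_ge0E p2).
set g := fun y => f1 y - f2 y; rewrite /sum_over.
have fin h : (forall y, A y -> 0 <= h y <= f1 y + f2 y) ->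
    (\esum_(y in A) (h y)%:E \is a fin_num).
  move=> H; apply: esum_fin => [|y /H/andP[]//].
  apply: (@abs_summable_le _ (fun y => f1 y + f2 y)) => [y /H/andP[h0 hf]|].
    by rewrite ger0_norm.
  under eq_esum do rewrite EFinD.
  rewrite esumD => [|y Ay|y Ay]; [|by rewrite lee_fin ?p1 ?p2..].
  by rewrite lte_add_pinfty// esum_lty.
have gp : (\esum_(y in A) (g^\+ y)%:E \is a fin_num)%R.
  apply: fin => y Ay; rewrite /funrpos /g le_max lexx orbT/= ge_max.
  by have := p1 _ Ay; have := p2 _ Ay; lra.
have gn : (\esum_(y in A) (g^\- y)%:E \is a fin_num)%R.
  apply: fin => y Ay; rewrite /funrneg /g le_max lexx orbT/= ge_max.
  by have := p1 _ Ay; have := p2 _ Ay; lra.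
have f1n : (\esum_(y in A) (f1 y)%:E \is a fin_num) by exact: esum_fin.
have f2n : (\esum_(y in A) (f2 y)%:E \is a fin_num) by exact: esum_fin.
suff : (\esum_(y in A) (g^\+ y)%:E + \esum_(y in A) (f2 y)%:E =
        \esum_(y in A) (g^\- y)%:E + \esum_(y in A) (f1 y)%:E)%E.
  move=> /(congr1 fine); rewrite !fineD// => H; lra.
rewrite -!esumD => [|y Ay|y Ay|y Ay|y Ay]; last 4 first.
- by rewrite lee_fin /funrneg le_max lexx orbT.
- by rewrite lee_fin p1.
- by rewrite lee_fin /funrpos le_max lexx orbT.
- by rewrite lee_fin p2.
apply: eq_esum => y Ay; rewrite -!EFinD; congr EFin.
rewrite /funrpos /funrneg /g.
by have [h|h] := lerP 0 (f1 y - f2 y); have [h'|h'] := lerP 0 (- (f1 y - f2 y)); lra.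
Qed.

Lemma abs_summableD f g : abs_summable f -> abs_summable g ->
  abs_summable (fun y => f y + g y).
Proof. exact: summableD. Qed.

Lemma abs_summable_norm f g :
  (forall y, A y -> `|f y| <= `|g y|) -> abs_summable g -> abs_summable f.
Proof. by move=> fg gs; exact: (@abs_summable_le _ (fun y => `|g y|)). Qed.

Lemma abs_summable_pos f : abs_summable f -> abs_summable f^\+.
Proof.
apply: abs_summable_norm => y _; rewrite /funrpos.
by have [h|h] := lerP 0 (f y); rewrite ?normr0.
Qed.

Lemma abs_summable_neg f : abs_summable f -> abs_summable f^\-.
Proof.
apply: abs_summable_norm => y _; rewrite /funrneg.
by have [h|h] := lerP 0 (- f y); rewrite ?normr0// normrN.
Qed.

Lemma eq_sum_over f g : (forall y, A y -> f y = g y) ->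
  sum_over A f = sum_over A g.
Proof.
move=> fg; rewrite /sum_over; congr (fine _ - fine _); apply: eq_esum => y Ay;
  by rewrite /funrpos /funrneg fg.
Qed.

Lemma sum_overN f : sum_over A (fun y => - f y) = - sum_over A f.
Proof.
rewrite /sum_over opprB; congr (fine _ - fine _); apply: eq_esum => y Ay//.
by rewrite /funrneg opprK.
Qed.

Let ge0_sum_overD f g : abs_summable f -> abs_summable g ->
  (forall y, A y -> 0 <= f y) -> (forall y, A y -> 0 <= g y) ->
  sum_over A (fun y => f y + g y) = sum_over A f + sum_over A g.
Proof.
move=> fs gs f0 g0; rewrite !sum_over_ge0E//; last first.
  by move=> y Ay; rewrite addr_ge0 ?f0 ?g0.
under eq_esum do rewrite EFinD.
rewrite esumD => [|y Ay|y Ay]; [|by rewrite lee_fin ?f0 ?g0..].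
by rewrite fineD ?esum_fin.
Qed.

Lemma sum_overD f g : abs_summable f -> abs_summable g ->
  sum_over A (fun y => f y + g y) = sum_over A f + sum_over A g.
Proof.
move=> fs gs.
have fpn (h : T -> R) y : h y = h^\+ y - h^\- y :> R.
  rewrite /funrpos /funrneg.
  by have [?|?] := lerP 0 (h y); have [?|?] := lerP 0 (- h y); lra.
have p0 (h : T -> R) y : 0 <= h^\+ y :> R by rewrite /funrpos le_max lexx orbT.
have n0 (h : T -> R) y : 0 <= h^\- y :> R by rewrite /funrneg le_max lexx orbT.
have ps := abs_summable_pos; have ns := abs_summable_neg.
rewrite (@eq_sum_over _ (fun y => (f^\+ y + g^\+ y) - (f^\- y + g^\- y))); last first.
  by move=> y _; rewrite (fpn f) (fpn g); ring.
rewrite sum_overE; last 4 first.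
- by apply: abs_summableD; exact: ps.
- by apply: abs_summableD; exact: ns.
- by move=> y _; rewrite addr_ge0.
- by move=> y _; rewrite addr_ge0.
rewrite !ge0_sum_overD//; [|exact: ns|exact: ns|exact: ps|exact: ps].
rewrite (@eq_sum_over f (fun y => f^\+ y - f^\- y))//.
rewrite (@eq_sum_over g (fun y => g^\+ y - g^\- y))//.
rewrite !sum_overE//; [|exact: ps|exact: ns|exact: ps|exact: ns].
by ring.
Qed.

Lemma le_sum_over f g : abs_summable f -> abs_summable g ->
  (forall y, A y -> f y <= g y) -> sum_over A f <= sum_over A g.
Proof.
move=> fs gs fg; rewrite -subr_ge0 -sum_overN -sum_overD//; last first.
  by apply: abs_summable_le fs => y Ay; rewrite normrN.
rewrite sum_over_ge0E => [|y Ay]; last by rewrite subr_ge0 fg.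
by apply/fine_ge0/esum_ge0 => y Ay; rewrite lee_fin subr_ge0 fg.
Qed.

Lemma sum_overZ c f : abs_summable f ->
  sum_over A (fun y => c * f y) = c * sum_over A f.
Proof.
move=> fs.
wlog c0 : c / 0 <= c => [H|].
  have [/H->//|c0] := lerP 0 c.
  rewrite -(opprK c) mulNr -H ?oppr_ge0 ?(ltW c0)//.
  by rewrite -sum_overN; apply: eq_sum_over => y _; rewrite mulNr.
have Zpos (h : T -> R) : abs_summable h -> (forall y, 0 <= h y) ->
    sum_over A (fun y => c * h y) = c * sum_over A h.
  move=> hs h0; rewrite !sum_over_ge0E// => [|y _]; last by rewrite mulr_ge0.
  by rewrite ge0_esumZ// fineM// esum_fin.
have Zs (h : T -> R) : abs_summable h -> abs_summable (fun y => c * h y).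
  move=> hs; apply: (@abs_summable_le _ (fun y => c * `|h y|)) => [y _|].
    by rewrite normrM ger0_norm.
  by rewrite ge0_esumZ// lte_mul_pinfty// esum_ge0.
have fpn y : f y = f^\+ y - f^\- y :> R.
  rewrite /funrpos /funrneg.
  by have [?|?] := lerP 0 (f y); have [?|?] := lerP 0 (- f y); lra.
have p0 y : 0 <= f^\+ y :> R by rewrite /funrpos le_max lexx orbT.
have n0 y : 0 <= f^\- y :> R by rewrite /funrneg le_max lexx orbT.
have ps := abs_summable_pos fs; have ns := abs_summable_neg fs.
rewrite (@eq_sum_over f (fun y => f^\+ y - f^\- y))// sum_overE//.
rewrite mulrBr -!Zpos// -sum_overE//; [|exact: Zs|exact: Zs|..].
- by apply: eq_sum_over => y _; rewrite {1}fpn mulrBr.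
- by move=> y _; rewrite mulr_ge0.
- by move=> y _; rewrite mulr_ge0.
Qed.

End signed_sums.

Section transfer_operators.
Context (R : realType) (X : completeMetricType R) (W : alphabetType).
Variables (T : W -> X -> X) (phi : W -> X -> R).
Implicit Types (f g : X -> R) (v : seq W) (x y z : X).

Definition bnd f := exists B, forall y, `|f y| <= B.

Lemma bnd_cst c : bnd (fun=> c). Proof. by exists `|c|. Qed.

Lemma bndD f g : bnd f -> bnd g -> bnd (fun y => f y + g y).
Proof.
move=> [B fB] [D gD]; exists (B + D) => y.
by rewrite (le_trans (ler_normD _ _))// lerD.
Qed.

Lemma bndM f g : bnd f -> bnd g -> bnd (fun y => f y * g y).
Proof.
by move=> [B fB] [D gD]; exists (B * D) => y; rewrite normrM ler_pM.
Qed.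

(** The preimages of x under [Tw T (i :: v)] are grouped by their image under [T i]; nonnegativity
    permits the regrouping over arbitrary index sets. *)
Lemma esum_fiber i v x (k : X -> \bar R) : (forall y, 0 <= k y)%E ->
  (\esum_(y in Tw T (i :: v) @^-1` [set x]) k y =
   \esum_(z in Tw T v @^-1` [set x]) \esum_(y in T i @^-1` [set z]) k y)%E.
Proof.
move=> k0; rewrite (@esum_esum _ _ _ _ (fun z => T i @^-1` [set z]) (fun _ y => k y))//.
rewrite (reindex_esum ((Tw T v @^-1` [set x]) `*`` (fun z => T i @^-1` [set z]))
  _ (fun q : X * X => q.2))//.
split=> [[z y] /= [zx yz]|[z y] [z' y'] /set_mem[/= _ yz] /set_mem[/= _ yz'] /= yy'|y /= yx].
- by rewrite yz.
- by rewrite -yz -yz' yy'.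
- by exists (T i y, y).
Qed.

Hypothesis phi_summable : forall i, summable_potential T phi i.

Lemma summable_potential_bound : exists2 S, 0 <= S & forall i x,
  (\esum_(y in T i @^-1` [set x]) (expR (phi i y))%:E <= S%:E)%E.
Proof.
pose s i := ereal_sup (range (fun x : X =>
     \esum_(y in T i @^-1` [set x]) (expR (phi i y))%:E)).
have e0 i x : (0 <= \esum_(y in T i @^-1` [set x]) (expR (phi i y))%:E)%E.
  by apply: esum_ge0 => y _; rewrite lee_fin expR_ge0.
have s_ge i x : (\esum_(y in T i @^-1` [set x]) (expR (phi i y))%:E <= s i)%E.
  by apply: ereal_sup_ubound; exists x.
have s0 i : (0 <= s i)%E := le_trans (e0 i point) (s_ge i point).
exists (\sum_i fine (s i)) => [|i x]; first by apply: sumr_ge0 => i _; exact: fine_ge0.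
rewrite (le_trans (s_ge i x))// -(@fineK _ (s i)); last first.
  by rewrite ge0_fin_numE//; exact: phi_summable.
by rewrite lee_fin (bigD1 i)//= lerDl sumr_ge0// => j _; exact: fine_ge0.
Qed.

Lemma esum_weight_bound v : exists2 B, 0 <= B & forall x,
  (\esum_(y in Tw T v @^-1` [set x]) (expR (phiw T phi v y))%:E <= B%:E)%E.
Proof.
have [S S0 HS] := summable_potential_bound.
elim: v => [|i v [B B0 HB]].
  exists 1 => // x; rewrite (_ : Tw T [::] @^-1` [set x] = [set x])//.
  by rewrite esum_set1 ?lee_fin ?expR_ge0//= expR0.
exists (S * B) => [|x]; first by rewrite mulr_ge0.
rewrite esum_fiber; last by move=> y; rewrite lee_fin expR_ge0.
apply: (@le_trans _ _ (\esum_(z in Tw T v @^-1` [set x])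
    (S * expR (phiw T phi v z))%:E)%E).
  apply: le_esum => z zx /=.
  rewrite (@eq_esum _ _ _ _ (fun y => (expR (phiw T phi v z) * expR (phi i y))%:E)%E).
    rewrite ge0_esumZ ?expR_ge0// [S * _]mulrC EFinM.
    by apply: lee_wpmul2l; rewrite ?lee_fin ?expR_ge0.
  by move=> y /= <-; rewrite expRD mulrC.
rewrite ge0_esumZ//.
by rewrite EFinM; apply: lee_wpmul2l; rewrite ?lee_fin.
Qed.

Lemma weight_summable v f x : bnd f ->
  abs_summable (Tw T v @^-1` [set x]) (fun y => expR (phiw T phi v y) * f y).
Proof.
move=> [B fB]; have [D D0 HD] := esum_weight_bound v.
have B0 : 0 <= B := le_trans (normr_ge0 _) (fB point).
apply: (@abs_summable_le _ _ _ _ (fun y => B * expR (phiw T phi v y))).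
  by move=> y _; rewrite normrM ger0_norm ?expR_ge0// mulrC ler_wpM2r// expR_ge0.
rewrite ge0_esumZ//.
apply: lte_mul_pinfty => //; last exact: le_lt_trans (HD x) (ltry _).
Qed.

Local Notation L := (Lop T phi).

Lemma LopD v f g x : bnd f -> bnd g ->
  L v (fun y => f y + g y) x = L v f x + L v g x.
Proof.
move=> fb gb; rewrite /Lop -sum_overD; [|exact: weight_summable..].
by apply: eq_sum_over => y _; rewrite mulrDr.
Qed.

Lemma LopZ v c f x : bnd f -> L v (fun y => c * f y) x = c * L v f x.
Proof.
move=> fb; rewrite /Lop -sum_overZ; last exact: weight_summable.
by apply: eq_sum_over => y _; rewrite mulrCA.
Qed.

Lemma Lop_le v f g x : bnd f -> bnd g -> (forall y, f y <= g y) ->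
  L v f x <= L v g x.
Proof.
move=> fb gb fg; apply: le_sum_over; [exact: weight_summable..|].
by move=> y _; rewrite ler_wpM2l// expR_ge0.
Qed.

Lemma Lop_ge0 v f x : (forall y, 0 <= f y) -> 0 <= L v f x.
Proof.
move=> f0; rewrite /Lop sum_over_ge0E => [|y _]; last by rewrite mulr_ge0// expR_ge0.
by apply/fine_ge0/esum_ge0 => y _; rewrite lee_fin mulr_ge0// expR_ge0.
Qed.

Lemma Lop_cst v c x : L v (fun=> c) x = c * L v (cst 1) x.
Proof.
rewrite -LopZ; last exact: bnd_cst.
by apply: eq_sum_over => y _; rewrite mulr1.
Qed.

Lemma Lop1_bnd v : bnd (L v (cst 1)).
Proof.
have [D D0 HD] := esum_weight_bound v; exists D => x.
rewrite ger0_norm ?Lop_ge0// /Lop sum_over_ge0E => [|y _]; last first.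
  by rewrite mulr_ge0// expR_ge0.
rewrite -lee_fin; under eq_esum do rewrite mulr1.
rewrite fineK// ge0_fin_numE ?(le_lt_trans (HD x)) ?ltry// esum_ge0//.
Qed.

Lemma Lop_norm_le v f B x : (forall y, `|f y| <= B) ->
  `|L v f x| <= B * L v (cst 1) x.
Proof.
move=> fB; have fb : bnd f by exists B.
rewrite ler_norml -mulNr -!Lop_cst !Lop_le//; try exact: bnd_cst.
- by move=> y; rewrite (le_trans (ler_norm _)).
- by move=> y; rewrite lerNl (le_trans (ler_norm _))// normrN.
Qed.

Lemma Lop_bnd v f : bnd f -> bnd (L v f).
Proof.
move=> [B fB]; have [D LD] := Lop1_bnd v; exists (B * D) => x.
have B0 : 0 <= B := le_trans (normr_ge0 _) (fB point).
rewrite (le_trans (Lop_norm_le v x fB))// ler_wpM2l//.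
by rewrite (le_trans (ler_norm _)).
Qed.

Lemma Lop_nil f : L [::] f = f.
Proof.
apply/funext => x; rewrite /Lop (_ : Tw T [::] @^-1` [set x] = [set x])//.
rewrite /sum_over !esum_set1 ?lee_fin ?le_max ?lexx ?orbT//=.
rewrite /funrpos /funrneg expR0 mul1r.
by have [h|h] := lerP 0 (f x); have [h'|h'] := lerP 0 (- f x); lra.
Qed.

(** For nonnegative [f] the sums may be regrouped by [esum_fiber]. A bounded [f] becomes nonnegative
    after adding its bound [B], and the constant is subtracted again by additivity. *)
Lemma Lop_cons i v f : bnd f -> L (i :: v) f = L v (L [:: i] f).
Proof.
have pos g : bnd g -> (forall y, 0 <= g y) -> forall x,
    L (i :: v) g x = L v (L [:: i] g) x.
  move=> gb g0 x; rewrite /Lop sum_over_ge0E => [|y _]; last first.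
    by rewrite mulr_ge0// expR_ge0.
  rewrite [RHS]sum_over_ge0E => [|y _]; last first.
    by rewrite mulr_ge0 ?expR_ge0//; exact: Lop_ge0.
  congr fine; rewrite esum_fiber; last first.
    by move=> y; rewrite lee_fin mulr_ge0// expR_ge0.
  apply: eq_esum => z zx; rewrite -/(L [:: i] g z).
  rewrite (@eq_esum _ _ _ _ (fun y => (expR (phiw T phi v z) *
      (expR (phiw T phi [:: i] y) * g y))%:E)%E); last first.
    by move=> y /= <-; rewrite addr0 expRD mulrAC mulrC mulrA.
  rewrite ge0_esumZ ?expR_ge0//; last first.
    by move=> y; rewrite mulr_ge0// expR_ge0.
  rewrite EFinM /Lop sum_over_ge0E => [|y _]; last by rewrite mulr_ge0// expR_ge0.
  rewrite fineK//; apply: esum_fin; first exact: (@weight_summable [:: i]).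
  by move=> y _; rewrite mulr_ge0// expR_ge0.
move=> fb; have [B fB] := fb; apply/funext => x.
have Bb : bnd (fun=> B) by exact: bnd_cst.
have gb : bnd (fun y => f y + B) by apply: bndD.
have := pos _ gb _ x; rewrite LopD// => H.
have {H}-> : L (i :: v) f x = L v (L [:: i] (fun y => f y + B)) x - L (i :: v) (fun=> B) x.
  rewrite -H ?addrK// => y; have := fB y; rewrite ler_norml => /andP[+ _].
  by rewrite -subr_ge0 opprK.
have B0 : 0 <= B := le_trans (normr_ge0 _) (fB point).
rewrite pos//.
have -> : L [:: i] (fun y => f y + B) = fun y => L [:: i] f y + L [:: i] (fun=> B) y.
  by apply/funext => z; rewrite LopD.
by rewrite LopD ?addrK//; exact: Lop_bnd.
Qed.

Lemma Lop_cat u v f : bnd f -> L (u ++ v) f = L v (L u f).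
Proof.
elim: u f => [|i u IH] f fb; first by rewrite Lop_nil.
rewrite (Lop_cons i u fb) -(IH _ (Lop_bnd [:: i] fb)).
exact: Lop_cons.
Qed.

Lemma Lop1_ge v x y : Tw T v y = x -> expR (phiw T phi v y) <= L v (cst 1) x.
Proof.
move=> yx; rewrite /Lop sum_over_ge0E => [|z _]; last by rewrite mulr_ge0// expR_ge0.
rewrite -lee_fin fineK; last first.
  apply: esum_fin; first by apply: weight_summable; exact: bnd_cst.
  by move=> z _; rewrite mulr_ge0// expR_ge0.
apply: esum_ge; exists [set y]; first by split; [exact: finite_set1|move=> _ ->].
by rewrite fsbig_set1 mulr1.
Qed.

Hypothesis T_surjective : forall i y, exists x, T i x = y.

Lemma Tw_surjective v x : exists y, Tw T v y = x.
Proof.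
elim: v => [|i v [z zx]] /=; first by exists x.
by have [y yz] := T_surjective i z; exists y; rewrite yz.
Qed.

Lemma Lop1_gt0 v x : 0 < L v (cst 1) x.
Proof.
have [y yx] := Tw_surjective v x.
by rewrite (lt_le_trans _ (Lop1_ge yx))// expR_gt0.
Qed.

Lemma Pop0E v f x : Pop T phi [::] v f x = L v f x / L v (cst 1) x.
Proof.
rewrite /Pop /= Lop_nil; congr (Lop T phi v _ x / _).
by apply/funext => y; rewrite mulr1.
Qed.

End transfer_operators.

(** * Hoelder seminorms and the quantity [Dbar] *)

Section hoelder_seminorms.
Context (R : realType) (X : completeMetricType R) (W : alphabetType).
Variables (a lambda alpha : R) (phi : W -> X -> R).
Implicit Types (f g : X -> R) (x y : X).
Hypothesis alpha_gt0 : 0 < alpha.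
Hypothesis a_gt0 : 0 < a.

Lemma continuous_borel_measurable f : continuous f ->
  measurable_fun [set: borel X] f.
Proof.
move=> /continuousP cf; apply: (measurability _ (measurable_realfun.RGenOpens.measurableE R)).
move=> _ [_ [c [b ->] <-]]; rewrite setTI.
by apply: sub_sigma_algebra; exact/cf/interval_open.
Qed.

Lemma Dalpha_hoelder f : (Dalpha alpha f < +oo)%E ->
  exists2 H, 0 <= H & forall x y, `|f x - f y| <= H * mdist x y `^ alpha.
Proof.
move=> fD; exists (Num.max 0 (fine (Dalpha alpha f))) => [|x y].
  by rewrite le_max lexx.
have [->|xy] := eqVneq x y; first by rewrite subrr normr0 mulr_ge0 ?powR_ge0 ?le_max ?lexx.
have d0 : 0 < mdist x y `^ alpha by rewrite powR_gt0// mdist_gt0.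
rewrite -ler_pdivrMr// le_max; apply/orP; right.
have q : ((`|f x - f y| / mdist x y `^ alpha)%:E <= Dalpha alpha f)%E.
  by apply: ereal_sup_ubound; exists (x, y).
rewrite -lee_fin fineK// fin_numElt fD (lt_le_trans _ q)//.
by rewrite ltNyr.
Qed.

Lemma hoelder_Dalpha f C : (forall x y, `|f x - f y| <= C * mdist x y `^ alpha) ->
  (Dalpha alpha f < +oo)%E.
Proof.
move=> fC; apply: (@le_lt_trans _ _ C%:E); last exact: ltry.
apply: ge_ereal_sup => _ [[x y]/= xy <-]; rewrite lee_fin ler_pdivrMr//.
by rewrite powR_gt0// mdist_gt0.
Qed.

Local Notation Delta := (Delta a lambda alpha phi).
Local Notation Dbar := (Dbar a lambda alpha phi).

Lemma Delta_gt0 : 0 < Delta.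
Proof. by rewrite lt_max powR_gt0// orbT. Qed.

(** The term a^-alpha in [Delta] has this purpose: the local part of [Dbar] only sees pairs closer
    than [a], the range in which expansion pairs up the preimages. Hence [Dbar_lty] asks for nothing
    beyond it. *)
Lemma Delta_radius_le : Delta `^ (- alpha^-1) <= a.
Proof.
have aD : a `^ (- alpha) <= Delta by rewrite le_max lexx orbT.
rewrite powRN -[leRHS]invrK lef_pV2 ?posrE ?powR_gt0 ?invr_gt0 ?Delta_gt0//.
have -> : a^-1 = (a `^ (- alpha)) `^ alpha^-1.
  by rewrite -powRrM mulNr divff ?gt_eqF// powR_inv1// ltW.
by apply: ge0_ler_powR => //; rewrite ?nnegrE ?invr_ge0 ?ltW ?powR_gt0 ?Delta_gt0.
Qed.

Lemma Dbar_ge f x y : (`|f x - f y|%:E <= Dbar f)%E.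
Proof.
rewrite /Dbar le_max; apply/orP; left.
by apply: ereal_sup_ubound; exists (x, y).
Qed.

Lemma Dbar_ge0 f : (0 <= Dbar f)%E.
Proof. by apply: le_trans (Dbar_ge f point point); rewrite lee_fin. Qed.

Lemma Dbar_fin f : (Dbar f < +oo)%E -> Dbar f = (fine (Dbar f))%:E.
Proof. by move=> fD; rewrite fineK// ge0_fin_numE// Dbar_ge0. Qed.

Lemma Dbar_osc f x y : (Dbar f < +oo)%E -> `|f x - f y| <= fine (Dbar f).
Proof. by move=> /Dbar_fin fE; rewrite -lee_fin -fE Dbar_ge. Qed.

Lemma Dbar_bnd f : (Dbar f < +oo)%E -> bnd f.
Proof.
move=> fD; exists (`|f point| + fine (Dbar f)) => y.
have -> : f y = f point + (f y - f point) by ring.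
by rewrite (le_trans (ler_normD _ _))// lerD2l Dbar_osc.
Qed.

Lemma bnd_bounded f : bnd f <-> bounded_fun (f : X -> R^o).
Proof.
split=> [[B fB]|[B [_ fB]]]; last first.
  by exists (B + 1) => y; apply: fB => //; rewrite ltrDl.
exists B; split; first exact: num_real.
by move=> C BC x _; apply: le_trans (fB _) (ltW BC).
Qed.

Lemma Dbar_continuous f : (Dbar f < +oo)%E -> continuous f.
Proof.
move=> fD x; set D := fine (Dbar f).
have r0 : 0 < Delta `^ (- alpha^-1) by rewrite powR_gt0// Delta_gt0.
have D0 : 0 <= D by exact/fine_ge0/Dbar_ge0.
have fH y : mdist x y < Delta `^ (- alpha^-1) ->
    `|f x - f y| <= Delta * D * mdist x y `^ alpha.
  move=> xyr; have [->|xy] := eqVneq x y.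
    by rewrite subrr normr0 !mulr_ge0 ?powR_ge0// ltW// Delta_gt0.
  have d0 : 0 < mdist x y by rewrite mdist_gt0.
  rewrite -ler_pdivrMr ?powR_gt0// -ler_pdivrMl ?Delta_gt0//.
  rewrite -lee_fin -Dbar_fin// /Defs.Dbar le_max; apply/orP; right.
  rewrite EFinM; apply: lee_wpmul2l; first by rewrite lee_fin invr_ge0 ltW// Delta_gt0.
  by apply: ereal_sup_ubound; exists (x, y) => //=; rewrite d0.
apply/cvgrPdist_le => e e0.
have c0 : 0 < Delta * D + 1 by rewrite ltr_wpDl// mulr_ge0// ltW// Delta_gt0.
(* Chosen so that [d] to the power [alpha] is [e / (Delta * D + 1)]; the added 1 avoids a division
   by zero when [D = 0]. *)
pose d := (e / (Delta * D + 1)) `^ alpha^-1.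
have d0 : 0 < d by rewrite powR_gt0// divr_gt0.
have : nbhs x [set y | mdist x y < Num.min d (Delta `^ (- alpha^-1))].
  rewrite -metricType_numDomainType.filter_from_mdist_nbhs.
  by exists (Num.min d (Delta `^ (- alpha^-1))) => //=; rewrite lt_min d0.
apply: filterS => y /=; rewrite lt_min => /andP[yd /fH]; move/le_trans; apply.
have : mdist x y `^ alpha <= e / (Delta * D + 1).
  have -> : e / (Delta * D + 1) = d `^ alpha.
    by rewrite -powRrM mulVf ?gt_eqF// powRr1// ltW// divr_gt0.
  by apply: ge0_ler_powR; rewrite ?nnegrE ?mdist_ge0// ltW.
rewrite ler_pdivlMr// mulrC; apply: le_trans.
by rewrite ler_wpM2r ?powR_ge0// lerDl.
Qed.

Lemma Dbar_lty f C : bnd f ->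
  (forall x y, mdist x y < a -> `|f x - f y| <= C * mdist x y `^ alpha) ->
  (Dbar f < +oo)%E.
Proof.
move=> [B fB] fC; rewrite /Dbar gt_max; apply/andP; split.
  apply: (@le_lt_trans _ _ (B + B)%:E); last exact: ltry.
  apply: ge_ereal_sup => _ [[x y] _ <-]; rewrite lee_fin/=.
  by rewrite (le_trans (ler_normB _ _))// lerD.
apply: (@le_lt_trans _ _ ((Delta^-1)%:E * C%:E)%E); last exact: ltry.
apply: lee_wpmul2l; first by rewrite lee_fin invr_ge0 ltW// Delta_gt0.
apply: ge_ereal_sup => _ [[x y]/= /andP[d0 dr] <-]; rewrite lee_fin.
rewrite ler_pdivrMr ?powR_gt0// fC// (lt_le_trans dr)//.
exact: Delta_radius_le.
Qed.

Lemma hoelder_space_Dbar f : hoelder_space alpha f -> (Dbar f < +oo)%E.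
Proof.
move=> [/bnd_bounded fb /Dalpha_hoelder[H H0 fH]].
exact: (Dbar_lty fb (fun x y _ => fH x y)).
Qed.

End hoelder_seminorms.

(** * Distortion and lower bounds for the transfer operators *)

Section fiber_operators.
Context (R : realType) (X : completeMetricType R) (W : alphabetType).
Variables (T : W -> X -> X) (a lambda alpha : R) (phi : W -> X -> R).
Hypothesis T_surjective : forall i y, exists x, T i x = y.
Hypothesis T_expanding : ruelle_expanding T a lambda.
Hypothesis alpha_gt0 : 0 < alpha.
Hypothesis phi_hoelder : forall i, (Dalpha alpha (phi i) < +oo)%E.
Hypothesis phi_summable : forall i, summable_potential T phi i.
Implicit Types (f g : X -> R) (v : seq W) (x y z : X).
Local Notation L := (Lop T phi).
Local Notation Dbar := (Dbar a lambda alpha phi).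

Let a_gt0 : 0 < a. Proof. by case: T_expanding. Qed.
Let lambda_gt0 : 0 < lambda. Proof. by case: T_expanding => _ /andP[]. Qed.
Let lambda_lt1 : lambda < 1. Proof. by case: T_expanding => _ /andP[]. Qed.

Lemma phi_uniform_hoelder : exists2 H, 0 <= H &
  forall i x y, `|phi i x - phi i y| <= H * mdist x y `^ alpha.
Proof.
have Hi i : exists H, 0 <= H /\
    forall x y, `|phi i x - phi i y| <= H * mdist x y `^ alpha.
  by have [H H0 HH] := Dalpha_hoelder (phi_hoelder i); exists H.
have [H HH] := boolp.choice Hi.
exists (\sum_i H i) => [|i x y]; first by apply: sumr_ge0 => i _; case: (HH i).
rewrite (le_trans ((HH i).2 x y))// ler_wpM2r ?powR_ge0//.
by rewrite (bigD1 i)//= lerDl sumr_ge0// => j _; case: (HH j).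
Qed.

(** Expansion sends each preimage of x to its unique close preimage of y. Exchanging x and y gives a
    map back, and uniqueness makes the two maps inverse to each other. *)
Lemma inverse_branches i x y : mdist x y < a ->
  exists b : X -> X, set_bij (T i @^-1` [set x]) (T i @^-1` [set y]) b /\
    forall x', T i x' = x -> mdist x' (b x') <= lambda * mdist x y.
Proof.
move=> xya; have [_ _ /(_ i) Te] := T_expanding.
have yxa : mdist y x < a by rewrite metric_sym.
have B x' : exists y', T i x' = x -> unique (fun z => T i z = y /\ mdist x' z < a) y' /\
    mdist x' y' <= lambda * mdist x y.
  have [xx'|nx] := pselect (T i x' = x); last by exists point.
  by have [y' Hy] := Te x y x' xya xx'; exists y'.
have [b Hb] := boolp.choice B; exists b; split; last by move=> x' /Hb[].
split=> [x' /Hb[[[]]]//|x1 x2 /set_mem/= Tx1 /set_mem/= Tx2 b12|y' /= Ty'].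
- have [[[Tb1 d1] _] _] := Hb _ Tx1; have [[[Tb2 d2] _] _] := Hb _ Tx2.
  have [x0 [[_ U] _]] := Te y x (b x1) yxa Tb1.
  have <- := U x1 (conj Tx1 _); last by rewrite metric_sym.
  by apply: U; rewrite b12 metric_sym.
- have [x' [[[Tx' d'] _] _]] := Te y x y' yxa Ty'.
  exists x' => //; have [[_ U] _] := Hb _ Tx'.
  by apply: U; rewrite metric_sym.
Qed.

(** The sum over the preimages of y is reindexed by those of x. Paired preimages are closer by the
    factor [lambda], which turns the joint contribution [H + K] of the weight and of [f] into
    [(H + K) * lambda ^ alpha]. *)
Lemma Lop1_distortion_step H i f K : 0 <= H -> 0 <= K ->
  (forall x y, `|phi i x - phi i y| <= H * mdist x y `^ alpha) ->
  bnd f -> (forall x, 0 <= f x) ->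
  (forall x y, mdist x y < a -> f x <= expR (K * mdist x y `^ alpha) * f y) ->
  forall x y, mdist x y < a ->
    L [:: i] f x <= expR ((H + K) * lambda `^ alpha * mdist x y `^ alpha) * L [:: i] f y.
Proof.
move=> H0 K0 HH fb f0 fK x y xya.
have [b [bb bd]] := inverse_branches i xya.
have w0 z : 0 <= expR (phiw T phi [:: i] z) * f z by rewrite mulr_ge0// expR_ge0.
rewrite /Lop !sum_over_ge0E//.
have fin z : (\esum_(y in Tw T [:: i] @^-1` [set z])
    (expR (phiw T phi [:: i] y) * f y)%:E \is a fin_num)%E.
  by apply: esum_fin => //; exact: weight_summable.
rewrite -lee_fin EFinM !fineK//.
have bb' : set_bij (Tw T [:: i] @^-1` [set x]) (Tw T [:: i] @^-1` [set y]) b := bb.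
rewrite (reindex_esum _ _ _ _ bb') -ge0_esumZ ?expR_ge0//.
apply: le_esum => x' /= Tx'; rewrite lee_fin !addr0.
have lx := bd _ Tx'; set x'' := b x' in lx *.
have la : mdist x' x'' `^ alpha <= lambda `^ alpha * mdist x y `^ alpha.
  rewrite -powRM ?mdist_ge0 ?(ltW lambda_gt0)//.
  apply: ge0_ler_powR; rewrite ?nnegrE ?mdist_ge0 ?(ltW alpha_gt0)//.
  by rewrite mulr_ge0 ?mdist_ge0// ltW.
have xa : mdist x' x'' < a.
  rewrite (le_lt_trans lx)// (le_lt_trans _ xya)// ler_piMl ?mdist_ge0//.
  exact: ltW.
rewrite mulrA -expRD.
apply: (@le_trans _ _ (expR (phi i x') * (expR (K * mdist x' x'' `^ alpha) * f x''))).
  by rewrite ler_wpM2l ?expR_ge0// fK.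
rewrite mulrA -expRD ler_wpM2r// ler_expR -mulrA.
have := HH x' x''; rewrite ler_norml => /andP[_] Hx.
have := ler_wpM2l (addr_ge0 H0 K0) la; lra.
Qed.

Lemma lambda_powR_lt1 : lambda `^ alpha < 1.
Proof.
have -> : 1 = 1 `^ alpha :> R by rewrite powR1.
by apply: gt0_ltr_powR; rewrite ?nnegrE// ltW.
Qed.

(** [K] is the fixed point of the map K -> (H + K) lambda^alpha, so one constant serves words of all
    lengths. The induction is on the last letter, which is the operator applied last. *)
Lemma Lop1_distortion : exists2 K, 0 <= K & forall v x y, mdist x y < a ->
  L v (cst 1) x <= expR (K * mdist x y `^ alpha) * L v (cst 1) y.
Proof.
have [H H0 HH] := phi_uniform_hoelder.
have l1 : 0 < 1 - lambda `^ alpha by rewrite subr_gt0 lambda_powR_lt1.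
pose K := H * lambda `^ alpha / (1 - lambda `^ alpha).
have K0 : 0 <= K by rewrite !mulr_ge0 ?powR_ge0// invr_ge0 ltW.
have KE : (H + K) * lambda `^ alpha = K by rewrite /K; field; rewrite gt_eqF.
exists K => //; elim/last_ind => [|v i IH] x y xya.
  rewrite !Lop_nil /= mulr1 (le_trans _ (expR_ge1Dx _))// lerDl.
  by rewrite mulr_ge0// powR_ge0.
rewrite -cats1 !Lop_cat//; [|exact: bnd_cst..].
rewrite -{1}KE; apply: Lop1_distortion_step => //.
- exact: Lop1_bnd.
- by move=> z; exact: Lop_ge0.
Qed.

(** This admits [L_i(1)] as a test function for the fibre measures, hence gives a modulus for
    lambda_{i,w} and the defect of [G_{n+1}(iw)]. *)
Lemma Dbar_Lop1 i : (Dbar (L [:: i] (cst 1%R)) < +oo)%E.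
Proof.
have [K K0 HK] := Lop1_distortion.
have [S HS] := Lop1_bnd phi_summable [:: i].
have S0 : 0 <= S := le_trans (normr_ge0 _) (HS point).
apply: (@Dbar_lty _ _ _ _ _ _ _ alpha_gt0 a_gt0 _ (S * (expR (K * a `^ alpha) * K))).
  by exists S.
have half x y : mdist x y < a -> L [:: i] (cst 1) x - L [:: i] (cst 1) y <=
    S * (expR (K * a `^ alpha) * K) * mdist x y `^ alpha.
  move=> xya; apply: expR_ratio_diff (HK [:: i] x y xya).
  - exact: Lop_ge0.
  - exact: le_trans (ler_norm _) (HS y).
  - by rewrite mulr_ge0// powR_ge0.
  - rewrite ler_wpM2l// ge0_ler_powR ?nnegrE ?mdist_ge0//; exact: ltW.
move=> x y xya; rewrite ler_norml half// andbT -opprB lerN2 metric_sym half//.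
by rewrite metric_sym.
Qed.

(* Some preimage of [x] under [T i] lies within [r] of the finite set
   [T_i^(n-1) K], which bounds [phi i] from below there. *)
Lemma Lop1_lower_bound : finitely_aperiodic T a ->
  exists2 c, 0 < c & forall i x, c <= L [:: i] (cst 1) x.
Proof.
move=> [n [K [r [/finite_seqP[s Ks] [r0 Hap]]]]].
have [H H0 HH] := phi_uniform_hoelder.
pose B i := \sum_(eta <- s) `|phi i (Tw T (nseq n.-1 i) eta)|.
have pre i x : exists y, T i y = x /\
    exists2 eta, K eta & mdist y (Tw T (nseq n.-1 i) eta) < r.
  (* For the empty word the preimage in condition (ii) is the point itself. So it is applied to an
     arbitrary preimage y of x, which then lies within [r] of [K]. *)
  case: n Hap {B} => [|n] Hap.
    have [y yx] := T_surjective i x; exists y; split => //.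
    have [_ [eta [_ Keta _ [xs [xsy _]]]]] := Hap y [::] erefl.
    rewrite /dw gt_max => /andP[xsr _]; exists eta => //.
    by rewrite -xsy.
  have [_ [eta [_ Keta _ [xs [xsx _ dr]]]]] := Hap x (nseq n.+1 i) (size_nseq _ _).
  exists (Tw T (nseq n i) xs); split.
    by rewrite -xsx -addn1 nseqD /Tw foldl_cat.
  exists eta => //=; apply: le_lt_trans dr; rewrite /dw le_max.
  (* The distance sought is the term of [dw] with the last index, the length of the word minus 1.
     For a one-letter word that maximum is empty and the term [mdist] of [dw] is used. *)
  case: n {Hap xsx} => [|n]; first by rewrite lexx.
  apply/orP; right; rewrite size_nseq.
  have tk : nseq n.+1 i = take n.+1 (nseq n.+2 i) by rewrite take_nseq.
  rewrite {1 2}tk; set F := fun j => mdist (Tw T (take j (nseq n.+2 i)) xs)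
    (Tw T (take j (nseq n.+2 i)) eta).
  apply: (@unstable.le_bigmax_seq _ R 0 _ _ n.+1 xpredT F) => //.
  by rewrite mem_index_iota ltnSn.
exists (expR (- (\sum_i (B i + H * r `^ alpha)))) => [|i x]; first exact: expR_gt0.
have [y [yx [eta Keta yr]]] := pre i x.
apply: (@le_trans _ _ (expR (phiw T phi [:: i] y))); last exact: Lop1_ge.
rewrite ler_expR /= addr0 lerNl.
have rr : mdist y (Tw T (nseq n.-1 i) eta) `^ alpha <= r `^ alpha.
  by rewrite ge0_ler_powR ?nnegrE ?mdist_ge0// ltW.
have h1 := HH i y (Tw T (nseq n.-1 i) eta).
have h2 := ler_wpM2l H0 rr.
have Bt j : 0 <= B j + H * r `^ alpha.
  by rewrite addr_ge0 ?mulr_ge0 ?powR_ge0// sumr_ge0.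
apply: (@le_trans _ _ (B i + H * r `^ alpha)); last first.
  by rewrite (bigD1 i)//= lerDl sumr_ge0.
have : `|phi i (Tw T (nseq n.-1 i) eta)| <= B i.
  have es : eta \in s by move: Keta; rewrite Ks.
  by rewrite /B (big_rem eta)//= lerDl sumr_ge0.
move: h1; rewrite !ler_norml => /andP[h3 h4] /andP[h5 h6]; lra.
Qed.

End fiber_operators.

(** * Fibre measures *)

Section fiber_measures.
Context (R : realType) (X : completeMetricType R) (W : alphabetType).
Variables (T : W -> X -> X) (a lambda alpha : R) (phi : W -> X -> R).
Variables (k0 : nat) (s : R) (mu : words R W -> probability (borel X) R).
Hypothesis T_surjective : forall i y, exists x, T i x = y.
Hypothesis phi_summable : forall i, summable_potential T phi i.
Hypothesis a_gt0 : 0 < a.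
Hypothesis alpha_gt0 : 0 < alpha.
Hypothesis k0_contraction : contraction_from T a lambda alpha phi k0 s.
Hypothesis mu_fiber : fiber_measures T phi mu.
Hypothesis s_range : 0 < s < 1.
Implicit Types (f g : X -> R) (v : seq W) (x y z : X) (w : words R W).
Local Notation L := (Lop T phi).
Local Notation Dbar := (Dbar a lambda alpha phi).
Local Notation F f w := (\int[mu w]_x f x).

Let s0 : 0 < s. Proof. by case/andP: s_range. Qed.

Let Pop_Dbar v f : (k0 <= size v)%N -> (Dbar f < +oo)%E ->
  (Dbar (Pop T phi [::] v f) <= (s ^+ size v)%:E * Dbar f)%E.
Proof. by move=> kv fD; have [_] := k0_contraction [::] kv; exact. Qed.

Let Pop_lty v f : (k0 <= size v)%N -> (Dbar f < +oo)%E ->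
  (Dbar (Pop T phi [::] v f) < +oo)%E.
Proof.
move=> kv fD; rewrite (le_lt_trans (Pop_Dbar kv fD))// Dbar_fin// -EFinM.
exact: ltry.
Qed.

Let Pop_osc v f x y : (k0 <= size v)%N -> (Dbar f < +oo)%E ->
  `|L v f x / L v (cst 1) x - L v f y / L v (cst 1) y| <= s ^+ size v * fine (Dbar f).
Proof.
move=> kv fD; rewrite -!Pop0E.
rewrite (le_trans (Dbar_osc _ _ (Pop_lty kv fD)))//.
rewrite -lee_fin -Dbar_fin ?Pop_lty// EFinM -Dbar_fin//; exact: Pop_Dbar.
Qed.

(** [mu_fiber] is tested with the Dirac mass at y. Evaluating the integral needs measurability of
    [Pop], which comes from the contraction and so only from length k0 on; the limit does not
    notice. *)
Lemma fiber_cvg w f y : (Dbar f < +oo)%E ->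
  (fun l => L (prefix_word w l) f y / L (prefix_word w l) (cst 1) y) @ \oo --> F f w.
Proof.
move=> fD; have := @mu_fiber w (\d_(y : borel X) : probability (borel X) R) f
  (Dbar_continuous alpha_gt0 a_gt0 fD).
move=> /(_ (iffLR (bnd_bounded f) (Dbar_bnd fD))).
apply: cvg_trans; apply: near_eq_cvg; exists k0 => // l /= kl.
have kv : (k0 <= size (prefix_word w l))%N by rewrite size_mkseq.
rewrite -Pop0E /Rintegral integral_dirac//; first by rewrite diracT mul1e.
apply/measurable_realfun.measurable_EFinP; apply: continuous_borel_measurable.
exact: (Dbar_continuous alpha_gt0 a_gt0 (Pop_lty kv fD)).
Qed.

(** By contraction the ratio [L_v(f) / L_v(1)] is nearly a constant c on X. Since [L_u] is positive
    and [L_{vu} = L_u L_v], the ratio for every longer word stays equally close to c, and so does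
    its limit, the fibre integral. *)
Lemma fiber_approx w f n x : (k0 <= n)%N -> (Dbar f < +oo)%E ->
  `|L (prefix_word w n) f x - F f w * L (prefix_word w n) (cst 1) x| <=
  s ^+ n * fine (Dbar f) * L (prefix_word w n) (cst 1) x.
Proof.
move=> kn fD; set v := prefix_word w n; set D := fine (Dbar f).
have sv : size v = n by rewrite size_mkseq.
have kv : (k0 <= size v)%N by rewrite sv.
have v1 := Lop1_gt0 phi_summable T_surjective v.
have fb := Dbar_bnd fD.
set c := L v f x / L v (cst 1) x.
suff : `|c - F f w| <= s ^+ n * D.
  have -> : c - F f w = (L v f x - F f w * L v (cst 1) x) / L v (cst 1) x.
    by rewrite /c; field; rewrite gt_eqF.
  by rewrite normrM normfV [X in _ / X]gtr0_norm// ler_pdivrMr.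
have near_c z : `|L v f z - c * L v (cst 1) z| <= s ^+ n * D * L v (cst 1) z.
  have := Pop_osc z x kv fD; rewrite sv -/c -/D.
  have -> : L v f z / L v (cst 1) z - c = (L v f z - c * L v (cst 1) z) / L v (cst 1) z.
    by field; rewrite gt_eqF.
  by rewrite normrM normfV [X in _ / X]gtr0_norm// ler_pdivrMr.
have cl l : (n <= l)%N ->
    `|c - L (prefix_word w l) f x / L (prefix_word w l) (cst 1) x| <= s ^+ n * D.
  move=> nl; have [u ->] : exists u, prefix_word w l = v ++ u.
    exists (drop n (prefix_word w l)); rewrite -[LHS](cat_take_drop n).
    by congr (_ ++ _); rewrite /v /prefix_word /mkseq -map_take take_iota (minn_idPl nl).
  have b1 := bnd_cst X (1 : R).
  rewrite !Lop_cat//.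
  set f1 := L v f; set e1 := L v (cst 1).
  have f1b : bnd f1 by exact: Lop_bnd.
  have e1b : bnd e1 by exact: Lop_bnd.
  have cb := bnd_cst X (- c).
  have ce1b : bnd (fun z => - c * e1 z) by exact: bndM.
  have u1 : 0 < L u e1 x by rewrite /e1 -Lop_cat//; exact: Lop1_gt0.
  have bound t : (forall z, `|f1 z - c * e1 z| <= t * e1 z) ->
      `|L u f1 x - c * L u e1 x| <= t * L u e1 x.
    move=> ht; have tb : bnd (fun z => t * e1 z) by apply: bndM => //; exact: bnd_cst.
    have tb' : bnd (fun z => - t * e1 z) by apply: bndM => //; exact: bnd_cst.
    have db : bnd (fun z => f1 z + - c * e1 z) by exact: bndD.
    have -> : L u f1 x - c * L u e1 x = L u (fun z => f1 z + - c * e1 z) x.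
      by rewrite LopD// LopZ// mulNr.
    rewrite ler_norml -mulNr -!LopZ//; apply/andP; split; apply: Lop_le => // z;
      have := ht z; rewrite ler_norml !mulNr => /andP[]//.
  have -> : c - L u f1 x / L u e1 x = - ((L u f1 x - c * L u e1 x) / L u e1 x).
    by field; rewrite gt_eqF.
  by rewrite normrN normrM normfV [X in _ / X]gtr0_norm// ler_pdivrMr// bound.
apply/ler_addgt0Pr => e e0.
have /cvgrPdist_le/(_ _ e0)[N _ HN] := @fiber_cvg w _ x fD.
have := HN (maxn n N) (leq_maxr _ _); have := cl (maxn n N) (leq_maxl _ _).
set q := _ / _ => h1 h2; rewrite -(subrKA q) (le_trans (ler_normD _ _))//.
by rewrite lerD// distrC.
Qed.

(** Positivity of [L] gives these bounds for every ratio [L f / L 1], and they pass to the limit. *)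
Lemma fiber_range w f c C : (Dbar f < +oo)%E -> (forall y, c <= f y <= C) ->
  c <= F f w <= C.
Proof.
move=> fD fc; have fb := Dbar_bnd fD.
have rng l : let q := L (prefix_word w l) f point / L (prefix_word w l) (cst 1) point in
    c <= q <= C.
  have v1 := Lop1_gt0 phi_summable T_surjective (prefix_word w l) point.
  rewrite /= ler_pdivlMr// ler_pdivrMr// -!Lop_cst//.
  by apply/andP; split; apply: Lop_le => //; try exact: bnd_cst;
    move=> y; case/andP: (fc y).
apply/andP; split; apply/ler_addgt0Pr => e e0;
  have /cvgrPdist_le/(_ _ e0)[N _ /(_ N (leqnn N))] := @fiber_cvg w _ point fD;
  rewrite ler_norml => /andP[h1 h2]; have /andP[h3 h4] := rng N; lra.
Qed.

(** Both integrals are approximated by the same ratio, which depends only on the common first n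
    letters. *)
Lemma fiber_diff w w' f n : (k0 <= n)%N -> agree n w w' -> (Dbar f < +oo)%E ->
  `|F f w - F f w'| <= 2 * fine (Dbar f) * s ^+ n.
Proof.
move=> kn /agree_prefix ww' fD.
have := fiber_approx w point kn fD; have := fiber_approx w' point kn fD.
rewrite ww'; set l := L _ _ _; set e := L _ _ _ => h1 h2.
have e0 : 0 < e by exact: Lop1_gt0.
rewrite -(ler_pM2r e0) -{1}(gtr0_norm e0) -normrM.
have -> : (F f w - F f w') * e = (l - F f w' * e) - (l - F f w * e) by ring.
rewrite (le_trans (ler_normB _ _))//; move: h1 h2; lra.
Qed.

Lemma fiber_ucont Sigma f : (Dbar f < +oo)%E -> ucont Sigma (fun w => F f w).
Proof.
move=> fD e e0; set D := fine (Dbar f).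
have D0 : 0 <= D by exact/fine_ge0/Dbar_ge0.
have [n kn ne] := geometric_eventually_le (2 * D) k0 s_range e0.
by exists n => w w' _ _ ww'; rewrite (le_trans (fiber_diff kn ww' fD)).
Qed.

Lemma fiber_norm_m Sigma w f : (Dbar f < +oo)%E -> Sigma w ->
  (`|F f w|%:E <= norm_m mu Sigma f)%E.
Proof.
move=> fD Sw.
have mf := continuous_borel_measurable (Dbar_continuous alpha_gt0 a_gt0 fD).
have fi : (mu w).-integrable setT (EFin \o f).
  apply: measurable_bounded_integrable => //.
    exact: le_lt_trans (probability_le1 _ measurableT) (ltry _).
  have [B fB] := Dbar_bnd fD; exists B; split; first exact: num_real.
  by move=> C BC x _; apply: le_trans (fB _) (ltW BC).
rewrite EFin_normr_Rintegral//; apply: le_trans (le_abse_integral _ _ _) _ => //.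
  exact/measurable_realfun.measurable_EFinP.
by apply: ereal_sup_ubound; exists w.
Qed.

End fiber_measures.

(** * Spectral gap on the subshift *)

Section subshift_of_finite_type.
Context (R : realType) (W : alphabetType).
Implicit Types (x y z : words R W) (Sigma : set (words R W)).
Local Notation shift := (@word_shift R W).

Lemma sft_shift Sigma x : subshift_of_finite_type Sigma ->
  Sigma x -> Sigma (shift x).
Proof. by move=> [fb ->] Sx v /Sx + k => /(_ k.+1); rewrite iterSr. Qed.

Lemma sft_iter_shift Sigma N x : subshift_of_finite_type Sigma ->
  Sigma x -> Sigma (iter N shift x).
Proof. by move=> S Sx; elim: N => //= N; exact: sft_shift. Qed.

(** M is the maximal length of a forbidden word. The glued word agrees with x on N + M letters, so a
    forbidden word that starts before N would already occur in x, and one that starts later would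
    occur in y. *)
Lemma sft_glue Sigma : subshift_of_finite_type Sigma ->
  exists M, forall N x y, Sigma x -> Sigma y -> agree M (iter N shift x) y ->
  exists z, [/\ Sigma z, agree N z x & iter N shift z = y].
Proof.
move=> [fb SE]; exists (\max_(v <- fb) size v) => N x y Sx Sy xy.
pose z : words R W := fun j => if (j < N)%N then x j else y (j - N)%N.
have zy k : (N <= k)%N -> iter k shift z = iter (k - N) shift y.
  move=> Nk; apply/funext => j; rewrite !iter_shiftE /z ltnNge.
  by rewrite (leq_trans Nk (leq_addr _ _))/= addnBAC.
have zx j : (j < N + \max_(v <- fb) size v)%N -> z j = x j.
  move=> jM; rewrite /z; have [//|Nj] := ltnP j N.
  by rewrite -xy ?ltn_subLR// iter_shiftE subnKC.
exists z; split.
- rewrite SE => v vfb k; have [Nk|kN] := leqP N k.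
    by rewrite zy//; move: Sy; rewrite SE; exact.
  have -> : prefix_word (iter k shift z) (size v) = prefix_word (iter k shift x) (size v).
    apply: agree_prefix => j jv; rewrite !iter_shiftE zx//.
    rewrite -addnS leq_add ?(ltnW kN)// (leq_trans jv)//.
    exact: (@leq_bigmax_seq _ _ _ (fun v => size v)).
  by move: Sx; rewrite SE; exact.
- by move=> j jN; rewrite zx// ltn_addr.
- by rewrite zy// subnn.
Qed.

(** Gluing after one letter replaces the tail of [wcons i x] by y. *)
Lemma sft_memory Sigma : subshift_of_finite_type Sigma ->
  exists M, forall i x y, Sigma x -> Sigma y -> agree M x y ->
  Sigma (wcons i x) -> Sigma (wcons i y).
Proof.
move=> /sft_glue[M glue]; exists M => i x y Sx Sy xy ix.
have [z [Sz zi zy]] := glue 1%N (wcons i x) y ix Sy xy.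
have z0 : z 0%N = i := zi 0%N isT.
by rewrite -zy -z0 wcons_shift.
Qed.

(** Mixing supplies a waiting time for each of the finitely many cylinders of length M, hence a
    common N; gluing then replaces a tail in the right cylinder by y itself. The common N is what
    makes the later minorisation uniform. *)
Lemma sft_mixing Sigma eta n1 : subshift_of_finite_type Sigma ->
  topologically_mixing_subshift Sigma -> Sigma eta ->
  exists2 N, (0 < N)%N & forall y, Sigma y ->
    exists z, [/\ Sigma z, agree n1 z eta & iter N shift z = y].
Proof.
move=> Ssft Smix Seta; have [M glue] := sft_glue Ssft.
have HN (u : M.-tuple W) : exists N, forall y, Sigma y -> cyl u y ->
    forall n, (N <= n)%N ->
    exists x, [/\ Sigma x, agree n1 x eta & cyl u (iter n shift x)].
  have [[y0 [Sy0 uy0]]|nu] := pselect (exists y, Sigma y /\ cyl u y); last first.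
    by exists 0%N => y Sy uy; case: nu; exists y.
  have [N HN] := Smix (cyl u) (cyl (prefix_word eta n1)) (@cyl_open R W u) (@cyl_open R W _)
    (ex_intro _ y0 (conj Sy0 uy0)) (ex_intro _ eta (conj Seta (cyl_prefix eta n1))).
  exists N => y _ _ n /HN[x [Sx xe ux]]; exists x; split => //.
  have := cyl_agree xe (cyl_prefix eta n1).
  by rewrite size_mkseq.
have [Nu HNu] := boolp.choice HN.
(* Exceeding n1 ensures that gluing at N leaves the first n1 letters untouched. *)
pose N := maxn n1.+1 (\max_u Nu u).
exists N => [|y Sy]; first by rewrite leq_max.
have sy : size (prefix_word y M) == M by rewrite size_mkseq.
have NN : (Nu (Tuple sy) <= N)%N by rewrite leq_max leq_bigmax ?orbT.
have [x [Sx xe ux]] := HNu (Tuple sy) y Sy (cyl_prefix y M) N NN.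
have xy : agree M (iter N shift x) y.
  have := cyl_agree ux (cyl_prefix y M); by rewrite size_mkseq.
have [z [Sz zx zy]] := glue N x y Sx Sy xy; exists z; split => //.
move=> j jn; rewrite zx ?xe//; by rewrite leq_max (ltnW (leq_ltn_trans jn _)).
Qed.

End subshift_of_finite_type.

(** * Contraction of the normalised Ruelle operator *)

Section spectral_gap.
Context (R : realType) (W : alphabetType).
Variables (Sigma : set (words R W)) (M : nat) (psi : W -> words R W -> R).
Variables (pmin H tau beta : R) (go : words R W -> R).
Implicit Types (x y z : words R W) (g : words R W -> R).
Local Notation shift := (@word_shift R W).
Hypothesis Sigma_closed : closed Sigma.
Hypothesis Sigma0 : Sigma !=set0.
Hypothesis Sigma_sft : subshift_of_finite_type Sigma.
Hypothesis Sigma_mixing : topologically_mixing_subshift Sigma.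
Hypothesis Sigma_memory : forall i x y, Sigma x -> Sigma y -> agree M x y ->
  Sigma (wcons i x) -> Sigma (wcons i y).
Hypothesis tau_range : 0 < tau < 1.
Hypothesis H_ge0 : 0 <= H.
Hypothesis pmin_gt0 : 0 < pmin.
Hypothesis psi_ge : forall i x, Sigma x -> Sigma (wcons i x) -> pmin <= psi i x.
Hypothesis psi_log : forall n i x y, (M <= n)%N -> Sigma x -> Sigma y ->
  agree n x y -> Sigma (wcons i x) -> psi i x <= expR (H * tau ^+ n) * psi i y.

(* For [psi i w = lambda_{i,w} p_i(w)] this is the operator iota. *)
Definition ruelle_op g x :=
  \sum_(i | `[< Sigma (wcons i x) >]) psi i x * g (wcons i x).

Hypothesis beta_gt0 : 0 < beta.
Hypothesis go_ucont : ucont Sigma go.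
Hypothesis go_gt0 : forall x, Sigma x -> 0 < go x.
Hypothesis go_eigen : forall x, Sigma x -> ruelle_op go x = beta * go x.

Let tau_gt0 : 0 < tau. Proof. by case/andP: tau_range. Qed.
Let tau_lt1 : tau < 1. Proof. by case/andP: tau_range. Qed.
Let taun0 n : 0 < tau ^+ n. Proof. exact: exprn_gt0. Qed.
Let taun1 n : tau ^+ n <= 1. Proof. by rewrite exprn_ile1// ltW. Qed.

Let memE x y : Sigma x -> Sigma y -> agree M x y ->
  (fun i => `[< Sigma (wcons i x) >]) =1 (fun i => `[< Sigma (wcons i y) >]).
Proof.
move=> Sx Sy xy i; apply/asboolP/asboolP; apply: Sigma_memory => //.
exact: agree_sym.
Qed.

Lemma eigenfunction_bounds : exists c C, [/\ 0 < c, 0 < C &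
  forall x, Sigma x -> c <= go x <= C].
Proof.
have kS : compact Sigma by apply: subclosed_compact (@words_compact R W) _.
have gc := ucont_within go_ucont.
have [u Su umax] := compact_EVT_max Sigma0 kS gc.
have [v Sv vmin] := compact_EVT_min Sigma0 kS gc.
exists (go v), (go u); split; [exact/go_gt0/set_mem|exact/go_gt0/set_mem|].
by move=> x Sx; rewrite vmin ?umax ?mem_set.
Qed.

(* [go] is only known to be continuous. The eigenvalue equation turns a modulus
   [e + K tau^(n+1)] on [n.+1] common letters into [e + K tau^n] on [n] common
   letters, since [H + K tau = K]; uniform continuity starts this induction with
   an arbitrarily small [e]. *)
Lemma eigenfunction_log : exists2 K, 0 <= K & forall n x y, (M <= n)%N ->
  Sigma x -> Sigma y -> agree n x y -> go x <= expR (K * tau ^+ n) * go y.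
Proof.
have t1 : 0 < 1 - tau by rewrite subr_gt0.
pose K := H / (1 - tau).
have K0 : 0 <= K by rewrite divr_ge0// ltW.
have KE : H + K * tau = K by rewrite /K; field; rewrite gt_eqF.
have [c [C [c0 C0 gcC]]] := eigenfunction_bounds.
exists K => // n x y Mn Sx Sy xy.
suff eps e : 0 < e -> go x <= expR (e + K * tau ^+ n) * go y.
  rewrite -ler_pdivrMr ?go_gt0//.
  have q0 : 0 < go x / go y by rewrite divr_gt0 ?go_gt0.
  rewrite -ler_ln ?posrE ?expR_gt0// expRK; apply/ler_addgt0Pl => e /eps.
  rewrite -ler_pdivrMr ?go_gt0// => h.
  by rewrite -(expRK (e + _)) ler_ln ?posrE ?expR_gt0.
move=> e0; have ec0 : 0 < c * e by rewrite mulr_gt0.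
have [n1 gn1] := go_ucont ec0.
have base n' x' y' : (n1 <= n')%N -> Sigma x' -> Sigma y' -> agree n' x' y' ->
    go x' <= expR (e + K * tau ^+ n') * go y'.
  move=> n1n Sx' Sy' xy'; have := gn1 _ _ Sx' Sy' (agree_le n1n xy').
  rewrite ler_norml => /andP[_ h].
  have /andP[cy _] := gcC _ Sy'.
  have h1 : go x' <= (1 + e) * go y'.
    have := ler_wpM2r (ltW e0) cy; lra.
  rewrite (le_trans h1)// ler_wpM2r ?(ltW (go_gt0 _))//.
  by rewrite (le_trans (expR_ge1Dx _))// ler_expR lerDl mulr_ge0// ltW.
suff ind k : forall n x y, (M <= n)%N -> (n1 <= n + k)%N -> Sigma x -> Sigma y ->
    agree n x y -> go x <= expR (e + K * tau ^+ n) * go y.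
  by apply: (ind n1) => //; rewrite leq_addl.
elim: k {n x y Mn Sx Sy xy} => [|k IH] n x y Mn n1n Sx Sy xy.
  by apply: base => //; rewrite -(addn0 n).
rewrite -(ler_pM2l beta_gt0) mulrCA -!go_eigen// /ruelle_op mulr_sumr.
rewrite (eq_bigl _ _ (memE Sx Sy (agree_le Mn xy))).
apply: ler_sum => i /asboolP iy.
have ix : Sigma (wcons i x).
  by apply: Sigma_memory iy => //; apply: agree_sym; exact: agree_le xy.
have h1 := psi_log Mn Sx Sy xy ix.
have h2 : go (wcons i x) <= expR (e + K * tau ^+ n.+1) * go (wcons i y).
  by apply: IH => //; [exact: leqW|rewrite addSnnS|exact: agree_wcons].
apply: le_trans (ler_pM _ _ h1 h2) _.
- exact: le_trans (ltW pmin_gt0) (psi_ge Sx ix).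
- by rewrite ltW// go_gt0.
rewrite mulrACA -expRD (_ : _ + (e + _) = e + K * tau ^+ n)//.
by rewrite -[in RHS]KE exprS; ring.
Qed.

Definition normalized_op g x := beta^-1 * ruelle_op (fun z => go z * g z) x / go x.

Local Notation Q := normalized_op.

Let q i x := beta^-1 * psi i x * go (wcons i x) / go x.

Let QE g x : Q g x = \sum_(i | `[< Sigma (wcons i x) >]) q i x * g (wcons i x).
Proof.
rewrite /Q /ruelle_op mulr_sumr mulr_suml; apply: eq_bigr => i _.
by rewrite /q; ring.
Qed.

Let q_ge0 i x : Sigma x -> Sigma (wcons i x) -> 0 <= q i x.
Proof.
move=> Sx ix; rewrite /q !mulr_ge0 ?invr_ge0 ?(ltW (go_gt0 _)) ?(ltW beta_gt0)//.
exact: le_trans (ltW pmin_gt0) (psi_ge Sx ix).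
Qed.

Let q_sum x : Sigma x -> \sum_(i | `[< Sigma (wcons i x) >]) q i x = 1.
Proof.
move=> Sx; have : Q (fun=> 1) x = 1.
  rewrite /Q (_ : (fun z => go z * 1) = go); last by apply/funext => z; rewrite mulr1.
  by rewrite go_eigen// mulKf ?divff// ?gt_eqF// go_gt0.
by rewrite QE => <-; apply: eq_bigr => i _; rewrite mulr1.
Qed.

Lemma normalized_op_cst c x : Sigma x -> Q (fun=> c) x = c.
Proof. by move=> Sx; rewrite QE -mulr_suml q_sum// mul1r. Qed.

Lemma ruelle_normalized g x : Sigma x ->
  ruelle_op (fun z => go z * g z) x = beta * (go x * Q g x).
Proof. by move=> Sx; rewrite /Q; field; rewrite !gt_eqF// go_gt0. Qed.

Lemma normalized_op_range g c C : (forall x, Sigma x -> c <= g x <= C) ->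
  forall x, Sigma x -> c <= Q g x <= C.
Proof.
move=> gc x Sx; rewrite QE -(mul1r c) -(mul1r C) -(q_sum Sx) !mulr_suml.
by apply/andP; split; apply: ler_sum => i /asboolP ix;
  rewrite ler_wpM2l ?q_ge0//; case/andP: (gc _ ix).
Qed.

Lemma osc_range g L : (forall x y, Sigma x -> Sigma y -> `|g x - g y| <= L) ->
  exists c, forall x, Sigma x -> c <= g x <= c + L.
Proof.
move=> gL; have [x0 Sx0] := Sigma0.
have hi : has_inf (g @` Sigma).
  split; first by exists (g x0); exists x0.
  exists (g x0 - L) => _ [x Sx <-].
  by have := gL x x0 Sx Sx0; rewrite ler_norml => /andP[]; lra.
exists (inf (g @` Sigma)) => x Sx; apply/andP; split.
  by apply: ge_inf; [case: hi|exists x].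
rewrite -lerBlDr; apply: lb_le_inf; first by case: hi.
move=> _ [y Sy <-]; have := gL x y Sx Sy; rewrite ler_norml => /andP[]; lra.
Qed.

Lemma normalized_op_osc g L :
  (forall x y, Sigma x -> Sigma y -> `|g x - g y| <= L) ->
  forall x y, Sigma x -> Sigma y -> `|Q g x - Q g y| <= L.
Proof.
move=> /osc_range[c gc] x y Sx Sy.
have /andP[h1 h2] := normalized_op_range gc Sx.
have /andP[h3 h4] := normalized_op_range gc Sy.
by rewrite ler_norml; apply/andP; split; lra.
Qed.

(** The logarithmic modulus of the weights is [H + K + K]: one [K] from [go (wcons i x)], the other
    from the denominator [go x]. Since both families of weights sum to 1, summing over the letters
    contributes only a factor 2. *)
Lemma weights_modulus : exists2 H2, 0 <= H2 & forall n x y, (M <= n)%N ->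
  Sigma x -> Sigma y -> agree n x y ->
  \sum_(i | `[< Sigma (wcons i y) >]) `|q i x - q i y| <= H2 * tau ^+ n.
Proof.
have [K K0 gK] := eigenfunction_log.
pose H1 := H + K + K.
have H10 : 0 <= H1 by rewrite !addr_ge0.
have q_log n i x y : (M <= n)%N -> Sigma x -> Sigma y -> agree n x y ->
    Sigma (wcons i x) -> q i x <= expR (H1 * tau ^+ n) * q i y.
  move=> Mn Sx Sy xy ix.
  have iy : Sigma (wcons i y) by apply: Sigma_memory ix => //; exact: agree_le xy.
  have h1 := psi_log Mn Sx Sy xy ix.
  have h2 : go (wcons i x) <= expR (K * tau ^+ n) * go (wcons i y).
    have := gK n.+1 _ _ (leqW Mn) ix iy (@agree_wcons _ _ _ i _ _ xy).
    move=> /le_trans; apply.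
    rewrite ler_wpM2r ?(ltW (go_gt0 _))// ler_expR ler_wpM2l// exprS.
    by rewrite ler_piMl ?ltW.
  have h3 : go y <= expR (K * tau ^+ n) * go x.
    by apply: gK => //; exact: agree_sym.
  have p0 := lt_le_trans pmin_gt0 (psi_ge Sx ix).
  have gx0 := go_gt0 Sx; have gy0 := go_gt0 Sy; have gix0 := go_gt0 ix.
  rewrite /q ler_pdivrMr//.
  rewrite [leRHS](_ : _ = beta^-1 * (expR (H1 * tau ^+ n) * psi i y *
    go (wcons i y) * (go x / go y))); last by ring.
  rewrite -mulrA ler_wpM2l ?invr_ge0 ?(ltW beta_gt0)//.
  have h4 : 1 <= expR (K * tau ^+ n) * (go x / go y).
    by rewrite mulrA ler_pdivlMr// mul1r.
  rewrite (_ : expR (H1 * tau ^+ n) = expR (H * tau ^+ n) * expR (K * tau ^+ n)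
     * expR (K * tau ^+ n)); last by rewrite -!expRD /H1 !mulrDl.
  have := ler_pM (ltW p0) (ltW gix0) h1 h2.
  set u := psi i x * _; set v := _ * (expR _ * go _) => uv.
  have u0 : 0 <= u by rewrite mulr_ge0// ltW.
  rewrite (_ : _ * (go x / go y) = v * (expR (K * tau ^+ n) * (go x / go y))); last first.
    by rewrite /v; ring.
  by rewrite -[leLHS]mulr1 ler_pM.
exists (H1 * expR H1 * 2) => [|n x y Mn Sx Sy xy].
  by rewrite !mulr_ge0// expR_ge0.
set t := H1 * tau ^+ n.
have t0 : 0 <= t by rewrite mulr_ge0// ltW.
have tH : t <= H1 by rewrite /t ler_piMr.
have et : expR t - 1 <= t * expR H1.
  have h := expR_sub1_le_mul t.
  have h' : t * expR t <= t * expR H1 by rewrite ler_wpM2l// ler_expR.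
  lra.
have bd i : `[< Sigma (wcons i y) >] ->
    `|q i x - q i y| <= t * expR H1 * (q i x + q i y).
  move=> /asboolP iy.
  have ix : Sigma (wcons i x).
    by apply: Sigma_memory iy => //; apply: agree_sym; exact: agree_le xy.
  have a1 := q_log n i x y Mn Sx Sy xy ix.
  have a2 := q_log n i y x Mn Sy Sx (agree_sym xy) iy.
  have x0 := q_ge0 Sx ix; have y0 := q_ge0 Sy iy.
  rewrite -/t in a1 a2.
  have b1 := ler_wpM2r x0 et; have b2 := ler_wpM2r y0 et.
  have e0 : 0 <= t * expR H1 by rewrite mulr_ge0// expR_ge0.
  have c1 := mulr_ge0 e0 x0; have c2 := mulr_ge0 e0 y0.
  by rewrite ler_norml; apply/andP; split; lra.
rewrite (le_trans (ler_sum _ bd))// -mulr_sumr big_split/= (q_sum Sy).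
rewrite -(eq_bigl _ _ (memE Sx Sy (agree_le Mn xy))) (q_sum Sx) /t.
by rewrite le_eqVlt; apply/orP; left; apply/eqP; ring.
Qed.

(** The ball of radius L for the larger of the oscillation and 1/K times the tau-modulus, a seminorm
    that ignores constants. The weight K is fixed in [normalized_op_mod_lip]. *)
Definition mod_lip K g L :=
  (forall x y, Sigma x -> Sigma y -> `|g x - g y| <= L) /\
  (forall n x y, (M <= n)%N -> Sigma x -> Sigma y -> agree n x y ->
     `|g x - g y| <= L * K * tau ^+ n).

(** A Lasota-Yorke inequality: the modulus of [Q g] is at most tau times that of [g] plus [H2] times
    the oscillation. For large K the second term is absorbed at the rate (1 + tau) / 2. *)
Lemma normalized_op_mod_lip : exists2 K, 1 <= K & forall g L, mod_lip K g L ->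
  mod_lip K (Q g) L /\
  (forall n x y, (M <= n)%N -> Sigma x -> Sigma y -> agree n x y ->
     `|Q g x - Q g y| <= (1 + tau) / 2 * L * K * tau ^+ n).
Proof.
have [H2 H20 qH] := weights_modulus.
have t1 : 0 < 1 - tau by rewrite subr_gt0.
(* Then [(1 - tau) / 2 * K] exceeds [H2]; the added 1 gives [K >= 1], so that a function of modulus
   L starts inside the ball. *)
pose K := 2 * H2 / (1 - tau) + 1.
have K1 : 1 <= K by rewrite lerDr divr_ge0 ?mulr_ge0// ltW.
have KE : K * tau + H2 <= (1 + tau) / 2 * K.
  have E : (1 - tau) * K = 2 * H2 + (1 - tau).
    by rewrite /K; field; rewrite gt_eqF.
  lra.
exists K => // g L [gL gLn].
have L0 : 0 <= L by have [x Sx] := Sigma0; rewrite (le_trans _ (gL x x Sx Sx)).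
have step n x y : (M <= n)%N -> Sigma x -> Sigma y -> agree n x y ->
    `|Q g x - Q g y| <= (1 + tau) / 2 * L * K * tau ^+ n.
  move=> Mn Sx Sy xy.
  (* Subtracting [g y] in the second sum is free because both families of weights sum to 1; only the
     oscillation of [g] enters, not its size. *)
  have E : Q g x - Q g y =
      \sum_(i | `[< Sigma (wcons i y) >]) q i x * (g (wcons i x) - g (wcons i y)) +
      \sum_(i | `[< Sigma (wcons i y) >]) (q i x - q i y) * (g (wcons i y) - g y).
    have qx : \sum_(i | `[< Sigma (wcons i y) >]) q i x = 1.
      by rewrite -(eq_bigl _ _ (memE Sx Sy (agree_le Mn xy))) q_sum.
    rewrite !QE (eq_bigl _ _ (memE Sx Sy (agree_le Mn xy))) -big_split/=.
    have -> : \sum_(i | `[< Sigma (wcons i y) >]) (q i x * (g (wcons i x) - g (wcons i y)) +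
        (q i x - q i y) * (g (wcons i y) - g y)) =
      \sum_(i | `[< Sigma (wcons i y) >]) (q i x * g (wcons i x) - q i y * g (wcons i y)
        - (q i x * g y - q i y * g y)).
      by apply: eq_bigr => i _; ring.
    by rewrite !sumrB -mulr_suml qx -mulr_suml (q_sum Sy) subrr subr0.
  rewrite E (le_trans (ler_normD _ _))//.
  apply: (@le_trans _ _ (L * K * tau ^+ n.+1 + L * (H2 * tau ^+ n))).
    apply: lerD; rewrite (le_trans (ler_norm_sum _ _ _))//.
      apply: (@le_trans _ _ (\sum_(i | `[< Sigma (wcons i y) >])
          q i x * (L * K * tau ^+ n.+1))).
        apply: ler_sum => i /asboolP iy.
        have ix : Sigma (wcons i x).
          by apply: Sigma_memory iy => //; apply: agree_sym; exact: agree_le xy.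
        rewrite normrM ger0_norm ?q_ge0// ler_wpM2l ?q_ge0//.
        apply: gLn => //; [exact: leqW|exact: agree_wcons].
      rewrite -mulr_suml -(eq_bigl _ _ (memE Sx Sy (agree_le Mn xy))) q_sum//.
      by rewrite mul1r.
    rewrite -[leRHS]mulrC; apply: le_trans (ler_wpM2r L0 (qH n x y Mn Sx Sy xy)).
    rewrite mulr_suml; apply: ler_sum => i /asboolP iy.
    by rewrite normrM ler_wpM2l// gL.
  rewrite exprS.
  have := ler_wpM2l (mulr_ge0 L0 (ltW (taun0 n))) KE; lra.
split=> //; split; first exact: normalized_op_osc.
move=> n x y Mn Sx Sy xy; rewrite (le_trans (step n x y Mn Sx Sy xy))//.
rewrite !ler_wpM2r ?(ltW (taun0 n)) ?(le_trans ler01 K1)//.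
by rewrite ler_piMl// ler_pdivrMr// mul1r; lra.
Qed.

(** Of all backward branches only the one that leads back to z is kept; each of its steps has weight
    at least [beta^-1 * pmin * c / C]. *)
Lemma normalized_op_minorization : exists2 d, 0 < d <= 1 & forall N g z,
  (forall x, Sigma x -> 0 <= g x) -> Sigma z ->
  d ^+ N * g z <= iter N Q g (iter N shift z).
Proof.
have [c [C [c0 C0 gcC]]] := eigenfunction_bounds.
pose d := Num.min 1 (beta^-1 * pmin * c / C).
have d0 : 0 < d by rewrite lt_min ltr01 !mulr_gt0// invr_gt0.
exists d => [|N]; first by rewrite d0 ge_min lexx.
elim: N => [|N IH] g z g0 Sz; first by rewrite expr0 mul1r.
set x := iter N.+1 shift z; set z' := iter N shift z.
have Sx : Sigma x by exact: sft_iter_shift.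
have Sz' : Sigma z' by exact: sft_iter_shift.
pose i := z' 0%N.
have ix : wcons i x = z' by rewrite /x iterS wcons_shift.
have Six : Sigma (wcons i x) by rewrite ix.
rewrite [iter N.+1 Q g]iterS QE (bigD1 i)/=; last exact/asboolP.
have u0 y : Sigma y -> 0 <= iter N Q g y.
  elim: N y {IH x z' Sx Sz' i ix Six} => [|N IH] y Sy; first exact: g0.
  rewrite iterS QE; apply: sumr_ge0 => i /asboolP iy.
  by rewrite mulr_ge0 ?q_ge0 ?IH.
apply: (@le_trans _ _ (q i x * iter N Q g (wcons i x))); last first.
  rewrite lerDl; apply: sumr_ge0 => j /andP[/asboolP jx _].
  by rewrite mulr_ge0 ?q_ge0 ?u0.
rewrite ix exprS -mulrA ler_pM ?IH//.
- exact: ltW.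
- by rewrite mulr_ge0 ?g0// exprn_ge0// ltW.
rewrite ge_min; apply/orP; right; rewrite /q.
have /andP[cx xC] := gcC _ Sx; have /andP[cix _] := gcC _ Six.
rewrite !ler_pM ?mulr_ge0 ?invr_ge0 ?(ltW c0) ?(ltW C0) ?(ltW beta_gt0) ?(ltW pmin_gt0)//.
- exact: psi_ge.
- by rewrite lef_pV2 ?posrE// go_gt0.
Qed.

Lemma iter_mod_lip K : (forall g L, mod_lip K g L -> mod_lip K (Q g) L) ->
  forall n g L, mod_lip K g L -> mod_lip K (iter n Q g) L.
Proof. by move=> KQ; elim=> //= n IH g L /IH/KQ. Qed.

(** Any x and y have N-th preimages u and v near a common eta, where [g] differs by at most L / 2.
    Minorisation of [g - c] at v and of [c + L - g] at u takes d^N L / 2 off the oscillation, while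
    the modulus gains (1 + tau) / 2 at the last step. [sigma] is the larger of the two rates. *)
Lemma doeblin_contraction : exists K N sigma, [/\ 1 <= K, (0 < N)%N, 0 < sigma < 1,
  forall g L, mod_lip K g L -> mod_lip K (Q g) L &
  forall g L, mod_lip K g L -> mod_lip K (iter N Q g) (sigma * L)].
Proof.
have [K K1 HK] := normalized_op_mod_lip.
have [d /andP[d0 d1] Hd] := normalized_op_minorization.
have K0 : 0 < K := lt_le_trans ltr01 K1.
have [n1 Mn1 Kn1] : exists2 n1, (M <= n1)%N & K * tau ^+ n1 <= 2^-1.
  by apply: geometric_eventually_le => //; rewrite invr_gt0.
have [eta Seta] := Sigma0.
have [N N0 HN] := sft_mixing n1 Sigma_sft Sigma_mixing Seta.
pose sigma := Num.max (1 - d ^+ N / 2) ((1 + tau) / 2).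
have dN0 : 0 < d ^+ N by rewrite exprn_gt0.
have KQ g L : mod_lip K g L -> mod_lip K (Q g) L by move=> /HK[].
have t0 := tau_gt0; have t1 := tau_lt1.
have s0 : 0 < sigma by rewrite lt_max; apply/orP; right; lra.
exists K, N, sigma; split => //.
  by rewrite s0 /= gt_max; apply/andP; split; lra.
move=> g L gL; have [gosc gn] := gL.
have L0 : 0 <= L := le_trans (normr_ge0 _) (gosc _ _ Seta Seta).
split; last first.
  move=> n x y Mn Sx Sy xy; case: N N0 {HN dN0} @sigma s0 => // N _ sigma s0.
  have [_ hn] := HK _ _ (iter_mod_lip KQ N gL).
  rewrite iterS (le_trans (hn n x y Mn Sx Sy xy))//.
  rewrite !ler_wpM2r ?(ltW (taun0 n)) ?(ltW K0)//.
  by rewrite le_max lexx orbT.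
have [c gc] := osc_range gosc.
have half x y : Sigma x -> Sigma y ->
    iter N Q g x - iter N Q g y <= sigma * L.
  move=> Sx Sy.
  have [u [Su ue ux]] := HN x Sx; have [v [Sv ve vy]] := HN y Sy.
  have lin_cst n (f : words R W -> R) (t : R) w : Sigma w ->
      iter n Q (fun z => f z + t) w = iter n Q f w + t.
    elim: n w => [//|n IH] w Sw; rewrite !iterS !QE.
    rewrite -[X in _ = _ + X](normalized_op_cst t Sw) QE -big_split/=.
    by apply: eq_bigr => i /asboolP iw; rewrite IH// mulrDr.
  have neg n (f : words R W -> R) w : Sigma w ->
      iter n Q (fun z => - f z) w = - iter n Q f w.
    elim: n w => [//|n IH] w Sw; rewrite !iterS !QE -sumrN.
    by apply: eq_bigr => i /asboolP iw; rewrite IH// mulrN.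
  have h1 : d ^+ N * (g v - c) <= iter N Q g y - c.
    rewrite -lin_cst// -vy.
    apply: (Hd N (fun z => g z + - c)) => // z Sz.
    by have /andP[+ _] := gc _ Sz; rewrite subr_ge0.
  have h2 : d ^+ N * (c + L - g u) <= c + L - iter N Q g x.
    rewrite [leRHS]addrC -neg// -lin_cst// -ux [_ - g u]addrC.
    apply: (Hd N (fun z => - g z + (c + L))) => // z Sz.
    by have /andP[_] := gc _ Sz; lra.
  have h3 : g u - g v <= L / 2.
    have uv : agree n1 u v by move=> j jn; rewrite ue// ve.
    have := gn n1 u v Mn1 Su Sv uv; rewrite ler_norml => /andP[_ h].
    rewrite (le_trans h)// -mulrA ler_wpM2l//.
  have h4 := ler_wpM2l (ltW dN0) h3.
  have h5 : (1 - d ^+ N / 2) * L <= sigma * L by rewrite ler_wpM2r// le_max lexx.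
  lra.
move=> x y Sx Sy; rewrite ler_norml half// andbT lerNl opprB half//.
Qed.

Theorem normalized_op_decay : exists r C, [/\ 0 < r < 1, 0 < C & forall g L,
  (forall x y, Sigma x -> Sigma y -> `|g x - g y| <= L) ->
  (forall n x y, (M <= n)%N -> Sigma x -> Sigma y -> agree n x y ->
     `|g x - g y| <= L * tau ^+ n) ->
  forall n, ucont Sigma (iter n Q g) /\ forall x y, Sigma x -> Sigma y ->
    `|iter n Q g x - iter n Q g y| <= C * r ^+ n * L].
Proof.
have [K [N [sigma [K1 N0 /andP[s0 s1] KQ KN]]]] := doeblin_contraction.
have N0' : 0 < N%:R :> R by rewrite ltr0n.
(* Bernoulli's inequality gives [sigma <= r ^+ N], in place of an N-th root. *)
pose r := 1 - (1 - sigma) / N%:R.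
have r1 : r < 1 by rewrite /r ltrBlDr ltrDl divr_gt0// subr_gt0.
have r0 : 0 < r.
  rewrite /r subr_gt0 ltr_pdivrMr// mul1r.
  have : 1 <= N%:R :> R by rewrite ler1n.
  lra.
have rN : sigma <= r ^+ N.
  have bern n : 1 - n%:R * ((1 - sigma) / N%:R) <= r ^+ n.
    elim: n => [|n IH]; first by rewrite mul0r subr0 expr0.
    rewrite exprS; have := ler_wpM2l (ltW r0) IH.
    set t := (1 - sigma) / N%:R in r r1 r0 IH *.
    have t0 : 0 <= t by rewrite divr_ge0// ?ler0n// subr_ge0 ltW.
    move=> /(le_trans _); apply; rewrite -natr1 /r.
    have : 0 <= n%:R * (t * t) by rewrite mulr_ge0 ?ler0n// mulr_ge0.
    lra.
  apply: le_trans (bern N); rewrite mulrCA divff ?gt_eqF// mulr1; lra.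
(* The n mod N leftover steps merely preserve the oscillation bound; the factor [r ^- N] pays for
   them. *)
exists r, (r ^- N); split; [by rewrite r0|by rewrite invr_gt0 exprn_gt0|].
move=> g L gL gn n.
have gK : mod_lip K g L.
  split=> // k x y Mk Sx Sy xy; rewrite (le_trans (gn k x y Mk Sx Sy xy))//.
  have L0 : 0 <= L := le_trans (normr_ge0 _) (gL _ _ Sx Sx).
  by rewrite ler_wpM2r ?(ltW (taun0 k))// ler_peMr.
have [x0 Sx0] := Sigma0.
have L0 : 0 <= L := le_trans (normr_ge0 _) (gL _ _ Sx0 Sx0).
split.
  have [_ gQn] := iter_mod_lip KQ n gK.
  move=> e e0.
  have [k Mk Lk] := geometric_eventually_le (L * K) M tau_range e0.
  by exists k => x y Sx Sy xy; rewrite (le_trans (gQn k x y Mk Sx Sy xy)).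
have iterN k : mod_lip K (iter (k * N) Q g) (sigma ^+ k * L).
  elim: k => [|k IH]; first by rewrite mul0n expr0 mul1r.
  by rewrite mulSn iterD exprS -mulrA; exact: KN.
have [osc _] := iter_mod_lip KQ (n %% N) (iterN (n %/ N)%N).
move=> x y Sx Sy; have := osc x y Sx Sy.
rewrite -iterD addnC -divn_eq => /le_trans; apply.
rewrite ler_wpM2r//.
apply: (@le_trans _ _ ((r ^+ N) ^+ (n %/ N))); first by
  apply: lerXn2r; rewrite ?nnegrE ?(ltW s0) ?exprn_ge0 ?(ltW r0).
rewrite ler_pdivlMl ?exprn_gt0// -exprM -exprD.
rewrite ler_wiXn2l ?(ltW r0) ?(ltW r1)//.
rewrite {1}(divn_eq n N) mulnC addnC leq_add2r.
by rewrite ltnW// ltn_mod.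
Qed.

End spectral_gap.

(** * Annealed limits *)

(* The increments of [ln a_n] are [O(s^n)]: where [D s^n <= 1/2] this follows
   from the closeness of [a_n.+1] to [a_n], elsewhere from [c a_n <= a_n.+1]. *)
Lemma quasi_constant_limit (R : realType) (s D c : R) (k0 : nat) :
  0 < s < 1 -> 0 <= D -> 0 < c ->
  exists2 C, 0 < C & forall a : nat -> R, (forall n, (k0 <= n)%N -> 0 < a n) ->
    (forall n, (k0 <= n)%N -> `|a n.+1 - a n| <= D * s ^+ n * a n) ->
    (forall n, (k0 <= n)%N -> c * a n <= a n.+1) ->
    exists h, [/\ 0 < h, forall n, (k0 <= n)%N -> `|a n - h| <= C * s ^+ n * h,
      forall n, (k0 <= n)%N -> a n <= C * h &
      forall n, (k0 <= n)%N -> h <= C * a n].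
Proof.
move=> /andP[s0 s1] D0 c0.
(* The first summand uses ln (1 - t) >= - 2 t for t = D s^n <= 1/2. Where D s^n > 1/2, the lower
   bound [ln c] is absorbed by [2 * D * s^n * |ln c|]. *)
pose D1 := 2 * D + 2 * D * `|ln c|.
have D10 : 0 <= D1 by rewrite addr_ge0 ?mulr_ge0.
have s1' : 0 < 1 - s by rewrite subr_gt0.
pose D2 := D1 / (1 - s).
have D20 : 0 <= D2 by rewrite divr_ge0// ltW.
have D2E : D2 * (1 - s) = D1 by rewrite /D2; field; rewrite gt_eqF.
(* As ln a_n is within D2 s^n of ln h, the rate needs D2 e^D2 and the two comparisons need e^D2; the
   constant is their sum. *)
exists ((D2 + 1) * expR D2) => [|a a0 aD ac].
  by rewrite mulr_gt0 ?expR_gt0// ltr_wpDl.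
pose u n := ln (a n).
have sn0 n : 0 < s ^+ n by rewrite exprn_gt0.
have sn1 n : s ^+ n <= 1 by rewrite exprn_ile1// ltW.
have uD n : (k0 <= n)%N -> `|u n.+1 - u n| <= D1 * s ^+ n.
  move=> kn; have an0 := a0 _ kn; have an1 := a0 _ (leqW kn).
  have Ds0 : 0 <= D * s ^+ n by rewrite mulr_ge0// ltW.
  have := aD _ kn; rewrite ler_norml => /andP[l1 l2].
  have up : u n.+1 - u n <= D * s ^+ n.
    rewrite -lnV ?posrE//  -lnM ?posrE ?invr_gt0// -(expRK (D * _)).
    rewrite ler_ln ?posrE ?expR_gt0 ?divr_gt0//.
    rewrite (le_trans _ (expR_ge1Dx _))// ler_pdivrMr//; lra.
  have lo : - (D1 * s ^+ n) <= u n.+1 - u n.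
    have [small|big] := lerP (D * s ^+ n) 2^-1.
      have e1 : expR (- (2 * (D * s ^+ n))) <= 1 - D * s ^+ n.
        set t := D * s ^+ n in Ds0 small *.
        have t1 : 0 < 1 - t by lra.
        rewrite expRN -[leRHS]invrK lef_pV2 ?posrE ?expR_gt0 ?invr_gt0//.
        apply: le_trans (expR_ge1Dx _).
        have t2 : 0 <= t * (1 - 2 * t) by rewrite mulr_ge0//; lra.
        by rewrite -[X in X <= _]mul1r ler_pdivrMr//; lra.
      have : - (2 * (D * s ^+ n)) <= u n.+1 - u n.
        rewrite -lnV ?posrE// -lnM ?posrE ?invr_gt0//.
        rewrite -[leLHS]expRK ler_ln ?posrE ?expR_gt0 ?divr_gt0//.
        rewrite (le_trans e1)// ler_pdivlMr//; lra.
      have : 0 <= 2 * D * `|ln c| * s ^+ n by rewrite !mulr_ge0// ltW.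
      rewrite /D1; lra.
    have : ln c <= u n.+1 - u n.
      rewrite lerBrDr -lnM ?posrE// ler_ln ?posrE ?mulr_gt0//; exact: ac.
    have : 0 <= `|ln c| * (2 * (D * s ^+ n) - 1) by rewrite mulr_ge0//; lra.
    have := ler_norm (- ln c); rewrite normrN /D1; lra.
  have : 0 <= 2 * D * `|ln c| * s ^+ n by rewrite !mulr_ge0// ltW.
  have : D * s ^+ n <= 2 * (D * s ^+ n) by lra.
  by rewrite ler_norml lo/= /D1; lra.
(* Because [D2 * (1 - s) = D1], v is nondecreasing and w nonincreasing, so every v lies below every
   w. The supremum of v is the limit of ln a_n, with error D2 s^n. *)
pose v n := u n - D2 * s ^+ n; pose w n := u n + D2 * s ^+ n.
have vS n : (k0 <= n)%N -> v n <= v n.+1.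
  move=> kn; have := uD _ kn; rewrite ler_norml => /andP[h _].
  by rewrite /v exprS; rewrite -D2E in h; lra.
have wS n : (k0 <= n)%N -> w n.+1 <= w n.
  move=> kn; have := uD _ kn; rewrite ler_norml => /andP[_ h].
  by rewrite /w exprS; rewrite -D2E in h; lra.
have vM n j : (k0 <= n)%N -> v n <= v (n + j)%N.
  move=> kn; elim: j => [|j IH]; first by rewrite addn0.
  by rewrite addnS (le_trans IH)// vS// (leq_trans kn)// leq_addr.
have wM n j : (k0 <= n)%N -> w (n + j)%N <= w n.
  move=> kn; elim: j => [|j IH]; first by rewrite addn0.
  by rewrite addnS (le_trans _ IH)// wS// (leq_trans kn)// leq_addr.
have vw n k : (k0 <= n)%N -> (k0 <= k)%N -> v n <= w k.
  move=> kn kk; rewrite (le_trans (vM n k kn))// (le_trans _ (wM k n kk))//.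
  rewrite [(k + n)%N]addnC /v /w.
  have : 0 <= D2 * s ^+ (n + k) by rewrite mulr_ge0// ltW.
  lra.
pose A := [set v n | n in [set n | (k0 <= n)%N]].
have hA : has_sup A.
  split; first by exists (v k0); exists k0 => /=.
  by exists (w k0) => _ [n kn <-]; exact: vw.
have supP n : (k0 <= n)%N -> `|u n - sup A| <= D2 * s ^+ n.
  move=> kn; have h1 : v n <= sup A by apply: ub_le_sup; [case: hA|exists n].
  have h2 : sup A <= w n by apply: ge_sup; [case: hA|move=> _ [k kk <-]; exact: vw].
  by rewrite ler_norml; move: h1 h2; rewrite /v /w => h1 h2; apply/andP; split; lra.
have D2s n : D2 * s ^+ n <= D2 by rewrite ler_piMr.
have eD2 := expR_gt0 D2.
exists (expR (sup A)); split; first exact: expR_gt0.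
- move=> n kn; have h := supP n kn.
  have -> : a n - expR (sup A) = (expR (u n - sup A) - 1) * expR (sup A).
    by rewrite expRD expRN /u lnK ?posrE ?a0//; field; rewrite gt_eqF// expR_gt0.
  rewrite normrM (gtr0_norm (expR_gt0 _)) ler_wpM2r ?expR_ge0//.
  rewrite (le_trans (expR_sub1_le (le_trans h (D2s n))))//.
  rewrite mulrAC ler_wpM2r ?expR_ge0// (le_trans h)// ler_wpM2r ?(ltW (sn0 n))//.
  by rewrite lerDl.
- move=> n kn; have := supP n kn; rewrite ler_norml => /andP[_ h].
  rewrite -(@lnK _ (a n)) ?posrE ?a0//.
  apply: (@le_trans _ _ (expR (D2 + sup A))).
    by rewrite ler_expR -/(u n); have := D2s n; lra.
  by rewrite expRD ler_wpM2r ?expR_ge0// ler_peMl ?expR_ge0// lerDr.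
- move=> n kn; have := supP n kn; rewrite ler_norml => /andP[h _].
  rewrite -{1}(@lnK _ (a n)) ?posrE ?a0//.
  apply: (@le_trans _ _ (expR (D2 + u n))).
    by rewrite ler_expR; have := D2s n; lra.
  by rewrite expRD ler_wpM2r ?expR_ge0// ler_peMl ?expR_ge0// lerDr.
Qed.

(** * Pairings with the base measure and their limits *)

Section annealed_functionals.
Context (R : realType) (W : alphabetType).
Variables (Sigma : set (words R W)) (M : nat) (lam p : W -> words R W -> R).
Variables (pmin H tau beta : R) (go : words R W -> R).
Variables (rho m : probability (borel (words R W)) R).
Implicit Types (x y z : words R W) (g : words R W -> R).
Hypothesis Sigma_closed : closed Sigma.
Hypothesis Sigma0 : Sigma !=set0.
Hypothesis Sigma_sft : subshift_of_finite_type Sigma.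
Hypothesis Sigma_mixing : topologically_mixing_subshift Sigma.
Hypothesis Sigma_memory : forall i x y, Sigma x -> Sigma y -> agree M x y ->
  Sigma (wcons i x) -> Sigma (wcons i y).
Hypothesis tau_range : 0 < tau < 1.
Hypothesis H_ge0 : 0 <= H.
Hypothesis pmin_gt0 : 0 < pmin.
Local Notation psi := (fun i x => lam i x * p i x).
Hypothesis psi_ge : forall i x, Sigma x -> Sigma (wcons i x) -> pmin <= psi i x.
Hypothesis psi_log : forall n i x y, (M <= n)%N -> Sigma x -> Sigma y ->
  agree n x y -> Sigma (wcons i x) -> psi i x <= expR (H * tau ^+ n) * psi i y.
Hypothesis beta_gt0 : 0 < beta.
Hypothesis go_ucont : ucont Sigma go.
Hypothesis go_gt0 : forall x, Sigma x -> 0 < go x.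
Local Notation iota := (ruelle_op Sigma psi).
Hypothesis go_eigen : forall x, Sigma x -> iota go x = beta * go x.
Hypothesis m_eigen : forall g, ucont Sigma g ->
  \int[m]_(x in Sigma) iota g x = beta * \int[m]_(x in Sigma) g x.
Hypothesis go_mass : \int[m]_(x in Sigma) go x = 1.
Hypothesis rho_Sigma : rho Sigma = 1%E.
Hypothesis p_jacobian : base_jacobian rho Sigma p.
Hypothesis p_ucont : forall i, ucont Sigma (p i).
Hypothesis p_ge0 : forall i x, Sigma x -> 0 <= p i x.
Hypothesis lam_ucont : forall i, ucont Sigma (lam i).

Local Notation Q := (normalized_op Sigma psi beta go).

Let iotaE g x : iota g x = \sum_i lam i x * (p i x * g (wcons i x)).
Proof.
rewrite /ruelle_op big_mkcond/=; apply: eq_bigr => i _.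
case: asboolP => [ix|nix]; first by rewrite mulrA.
by have [_ ->//] := p_jacobian; rewrite mul0r mulr0.
Qed.

Let ucont_term i g : ucont Sigma g -> ucont Sigma (fun x => p i x * g (wcons i x)).
Proof.
move=> gu; exact: (ucont_pg Sigma_closed Sigma_memory p_jacobian p_ucont).
Qed.

Lemma ucont_iota g : ucont Sigma g -> ucont Sigma (iota g).
Proof.
move=> gu; rewrite (_ : iota g = fun x => \sum_i lam i x * (p i x * g (wcons i x))).
  by apply: ucont_sum => i _; apply: ucontM => //; exact: ucont_term.
by apply/funext => x; exact: iotaE.
Qed.

Let go_bounds : exists c C, [/\ 0 < c, 0 < C & forall x, Sigma x -> c <= go x <= C].
Proof. exact: (eigenfunction_bounds Sigma_closed Sigma0 go_ucont go_gt0). Qed.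

Lemma ucont_divgo g : ucont Sigma g -> ucont Sigma (fun x => g x / go x).
Proof.
move=> gu; have [c [C [c0 C0 gcC]]] := go_bounds.
apply: ucontM => //; apply: (ucont_inv c0) => // x /gcC/andP[]//.
Qed.

Lemma ucont_gom g : ucont Sigma g -> ucont Sigma (fun x => go x * g x).
Proof. by move=> gu; exact: ucontM. Qed.

Lemma ucont_Q g : ucont Sigma g -> ucont Sigma (Q g).
Proof.
move=> gu; apply: ucont_divgo; apply: ucontM => //; first exact: ucont_cst.
by apply: ucont_iota; exact: ucont_gom.
Qed.

(** Integration against the probability go m, which is invariant under [Q]. At g = F / go it is the
    integral of F against m. *)
Definition mean g := \int[m]_(x in Sigma) (go x * g x).

Let goQ g x : Sigma x -> go x * Q g x = beta^-1 * iota (fun z => go z * g z) x.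
Proof.
move=> Sx; rewrite (ruelle_normalized psi beta_gt0 go_gt0 g Sx) mulKf//.
by rewrite gt_eqF.
Qed.

Lemma mean_Q g : ucont Sigma g -> mean (Q g) = mean g.
Proof.
move=> gu; have ggu := ucont_gom gu.
rewrite /mean (wint_eq m (goQ g)) wintZ ?m_eigen ?mulKf ?gt_eqF//.
exact: ucont_iota.
Qed.

Lemma mean_iter_Q n g : ucont Sigma g -> mean (iter n Q g) = mean g.
Proof.
move=> gu; suff [] : ucont Sigma (iter n Q g) /\ mean (iter n Q g) = mean g by [].
elim: n => [//|n [IHu IH]] /=; split; first exact: ucont_Q.
by rewrite mean_Q.
Qed.

Lemma mean_dist g t e : ucont Sigma g -> (forall x, Sigma x -> `|t - g x| <= e) ->
  `|t - mean g| <= e.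
Proof.
move=> gu ge.
have -> : t = \int[m]_(x in Sigma) (t * go x) by rewrite wintZ// go_mass mulr1.
rewrite /mean -wintB//; [|by apply: ucontM => //; exact: ucont_cst|exact: ucont_gom].
rewrite (le_trans (wint_norm _ _ _))//.
  apply: ucontD; first by apply: ucontM => //; exact: ucont_cst.
  by apply: ucontN; exact: ucont_gom.
apply: (@le_trans _ _ (\int[m]_(x in Sigma) (e * go x))); last by rewrite wintZ// go_mass mulr1.
apply: wint_le => //.
- apply: ucont_norm; apply: ucontD; first by apply: ucontM => //; exact: ucont_cst.
  by apply: ucontN; exact: ucont_gom.
- by apply: ucontM => //; exact: ucont_cst.
move=> z Sz; have -> : t * go z - go z * g z = (t - g z) * go z by ring.
by rewrite normrM [X in _ * X]gtr0_norm ?go_gt0// ler_wpM2r ?ge// ltW// go_gt0.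
Qed.

Variables (k0 : nat) (s D c : R).
Hypothesis s_range : 0 < s < 1.
Hypothesis D_ge0 : 0 <= D.
Hypothesis c_gt0 : 0 < c.

(* Abstracts [G n w = L_{[w]_n}(1)(x)] for a fixed [x]; the limits below are
   uniform in [G], hence in [x]. *)
Definition cocycle_like (G : nat -> words R W -> R) :=
  [/\ forall n x y, agree n x y -> G n x = G n y,
      forall n x, 0 < G n x,
      forall n i x, (k0 <= n)%N -> `|G n.+1 (wcons i x) - lam i x * G n x| <=
        D * s ^+ n * (lam i x * G n x) &
      forall n i x, c * (lam i x * G n x) <= G n.+1 (wcons i x)].

(** The factors [beta ^- n] and [go] are there so that lowering n.+1 to n turns [g] into [Q g] up to
    a relative O(s^n); at g = 1 the sequence is then nearly constant. *)
Definition eigen_pairing (G : nat -> words R W -> R) n g : R :=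
  beta ^- n * \int[rho]_(x in Sigma) (G n x * (go x * g x)).

Section fixed_cocycle.
Variable G : nat -> words R W -> R.
Hypothesis G_cocycle : cocycle_like G.

Let Gu n : ucont Sigma (G n).
Proof. by case: G_cocycle => Gl _ _ _; apply: locally_constant_ucont (Gl n). Qed.

Let GMu n g : ucont Sigma g -> ucont Sigma (fun x => G n x * (go x * g x)).
Proof. by move=> gu; apply: ucontM => //; exact: ucont_gom. Qed.

Lemma eigen_pairing_le n g h : ucont Sigma g -> ucont Sigma h ->
  (forall x, Sigma x -> g x <= h x) -> eigen_pairing G n g <= eigen_pairing G n h.
Proof.
move=> gu hu gh; rewrite /eigen_pairing ler_wpM2l ?invr_ge0 ?exprn_ge0 ?(ltW beta_gt0)//.
apply: wint_le; [|exact: GMu|exact: GMu|] => // x Sx.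
have [_ G0 _ _] := G_cocycle.
by rewrite !ler_wpM2l ?(ltW (G0 _ _)) ?(ltW (go_gt0 _)) ?gh.
Qed.

Lemma eigen_pairingZ n t g : ucont Sigma g -> eigen_pairing G n (fun x => t * g x) = t * eigen_pairing G n g.
Proof.
move=> gu; rewrite /eigen_pairing mulrCA -(wintZ rho Sigma_closed t (GMu n gu)).
by congr (_ * _); apply: wint_eq => x _; ring.
Qed.

Lemma eigen_pairing_gt0 n : 0 < eigen_pairing G n (fun=> 1).
Proof.
have [cg [Cg [cg0 Cg0 gcC]]] := go_bounds.
have [Gl G0 _ _] := G_cocycle.
have [g1 g1u] : exists e, 0 < e /\ forall x, Sigma x -> e <= G n x.
  have kS : compact Sigma by apply: subclosed_compact (@words_compact R W) _.
  have [u _ umin] := compact_EVT_min Sigma0 kS (ucont_within (Gu n)).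
  by exists (G n u); split => // x Sx; apply: umin; exact/mem_set.
case: g1u => g10 g1G.
rewrite /eigen_pairing mulr_gt0 ?invr_gt0 ?exprn_gt0//.
apply: (@lt_le_trans _ _ (\int[rho]_(x in Sigma) (g1 * cg))).
  by rewrite wint_cst// rho_Sigma mulr1 mulr_gt0.
apply: wint_le => //; [exact: ucont_cst|by apply: GMu; exact: ucont_cst|].
move=> x Sx; rewrite mulr1; have /andP[cx _] := gcC x Sx.
by apply: ler_pM; [exact: ltW|exact: ltW|exact: g1G|exact: cx].
Qed.

(** The Jacobian turns the pairing at n.+1 into a sum over branches. [eigen_pairingQ] gives the same
    sum for [Q g] at n, with [lam i x * G n x] in place of [G n.+1 (wcons i x)], so that the cocycle
    bounds apply term by term. *)
Let eigen_pairingS n g : ucont Sigma g -> eigen_pairing G n.+1 g =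
  beta ^- n.+1 * \int[rho]_(x in Sigma)
    \sum_i p i x * (G n.+1 (wcons i x) * (go (wcons i x) * g (wcons i x))).
Proof.
move=> gu; congr (_ * _).
by apply: (jacobian_integral Sigma_closed (fun x => sft_shift Sigma_sft)
  Sigma_memory p_jacobian p_ucont); exact: GMu.
Qed.

Let ucont_S n g : ucont Sigma g -> ucont Sigma (fun x =>
  \sum_i p i x * (G n.+1 (wcons i x) * (go (wcons i x) * g (wcons i x)))).
Proof.
move=> gu; apply: ucont_sum => i _.
exact: (@ucont_term i (fun x => G n.+1 x * (go x * g x)) (GMu n.+1 gu)).
Qed.

Let ucont_T n g : ucont Sigma g -> ucont Sigma (fun x =>
  \sum_i p i x * (lam i x * G n x * (go (wcons i x) * g (wcons i x)))).
Proof.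
move=> gu; apply: ucont_sum => i _.
rewrite (_ : (fun x => _) = fun x =>
  lam i x * G n x * (p i x * (go (wcons i x) * g (wcons i x)))); last first.
  by apply/funext => x; ring.
apply: ucontM => //; first exact: ucontM.
exact: (@ucont_term i (fun x => go x * g x) (ucont_gom gu)).
Qed.

Let eigen_pairingQ n g : ucont Sigma g -> eigen_pairing G n (Q g) =
  beta ^- n.+1 * \int[rho]_(x in Sigma)
    \sum_i p i x * (lam i x * G n x * (go (wcons i x) * g (wcons i x))).
Proof.
move=> gu; have Tu := ucont_T n gu.
have E : \int[rho]_(x in Sigma) (G n x * (go x * Q g x)) =
    beta^-1 * \int[rho]_(x in Sigma)
      \sum_i p i x * (lam i x * G n x * (go (wcons i x) * g (wcons i x))).
  rewrite -wintZ//; apply: wint_eq => x Sx; rewrite goQ// mulrCA; congr (_ * _).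
  by rewrite iotaE mulr_sumr; apply: eq_bigr => i _; ring.
by rewrite /eigen_pairing E mulrA -invfM -exprSr.
Qed.

Lemma eigen_pairing_Q1 n : eigen_pairing G n (Q (fun=> 1)) = eigen_pairing G n (fun=> 1).
Proof.
congr (_ * _); apply: wint_eq => x Sx.
by rewrite (normalized_op_cst beta_gt0 go_gt0 go_eigen).
Qed.

Lemma eigen_pairing_step n g B : (k0 <= n)%N -> ucont Sigma g ->
  (forall x, Sigma x -> `|g x| <= B) ->
  `|eigen_pairing G n.+1 g - eigen_pairing G n (Q g)| <= D * s ^+ n * B * eigen_pairing G n (fun=> 1).
Proof.
move=> kn gu gB; have [_ G0 Gd _] := G_cocycle.
have b0 : 0 < beta ^- n.+1 by rewrite invr_gt0 exprn_gt0.
have cu := @ucont_cst R W Sigma 1.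
have Su := ucont_S n gu; have Tu := ucont_T n gu; have T1u := ucont_T n cu.
(* Writing 1 as [Q 1] brings the bound into the same form, a sum over branches, and reduces the
   claim to a comparison of summands. *)
rewrite -eigen_pairing_Q1 eigen_pairingS// !eigen_pairingQ// -mulrBr -(wintB rho Sigma_closed Su Tu).
rewrite normrM (gtr0_norm b0) mulrCA ler_pM2l// -(wintZ rho Sigma_closed _ T1u).
have du : ucont Sigma (fun x =>
    \sum_i p i x * (G n.+1 (wcons i x) * (go (wcons i x) * g (wcons i x))) -
    \sum_i p i x * (lam i x * G n x * (go (wcons i x) * g (wcons i x)))).
  by apply: ucontD => //; exact: ucontN.
rewrite (le_trans (wint_norm _ _ _))//.
apply: wint_le => //; first exact: ucont_norm.
  by apply: ucontM => //; exact: ucont_cst.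
move=> x Sx; rewrite -sumrB mulr_sumr (le_trans (ler_norm_sum _ _ _))//.
apply: ler_sum => i _; have [ix|nix] := pselect (Sigma (wcons i x)); last first.
  by have [_ ->//] := p_jacobian; rewrite !mul0r subr0 normr0 mulr0.
have -> : p i x * (G n.+1 (wcons i x) * (go (wcons i x) * g (wcons i x))) -
    p i x * (lam i x * G n x * (go (wcons i x) * g (wcons i x))) =
  p i x * (go (wcons i x) * ((G n.+1 (wcons i x) - lam i x * G n x) * g (wcons i x))).
  by ring.
have gi := go_gt0 ix.
rewrite normrM (ger0_norm (p_ge0 i Sx)) normrM (gtr0_norm gi) normrM mulr1.
rewrite [leRHS](_ : _ = p i x * (go (wcons i x) *
  ((D * s ^+ n * (lam i x * G n x)) * B))); last by ring.
rewrite !ler_wpM2l ?p_ge0 ?(ltW gi)//.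
by apply: ler_pM => //; [exact: Gd|exact: gB].
Qed.

Lemma eigen_pairing_lower n : c * eigen_pairing G n (fun=> 1) <= eigen_pairing G n.+1 (fun=> 1).
Proof.
have [_ G0 _ Gc] := G_cocycle; have cu := @ucont_cst R W Sigma 1.
rewrite -eigen_pairing_Q1 eigen_pairingS// eigen_pairingQ// mulrCA ler_wpM2l ?invr_ge0 ?exprn_ge0 ?(ltW beta_gt0)//.
have Su := ucont_S n cu; have Tu := ucont_T n cu.
rewrite -(wintZ rho Sigma_closed _ Tu).
apply: wint_le => //; first by apply: ucontM => //; exact: ucont_cst.
move=> x Sx; rewrite mulr_sumr; apply: ler_sum => i _.
have [ix|nix] := pselect (Sigma (wcons i x)); last first.
  by have [_ ->//] := p_jacobian; rewrite !mul0r mulr0.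
have := ler_wpM2l (p_ge0 i Sx) (ler_wpM2r (ltW (go_gt0 ix)) (Gc n i x)).
lra.
Qed.

Lemma eigen_pairing_iter C h k j g B : (k0 <= k)%N -> ucont Sigma g ->
  (forall x, Sigma x -> `|g x| <= B) ->
  (forall n, (k0 <= n)%N -> eigen_pairing G n (fun=> 1) <= C * h) -> 0 <= C * h ->
  `|eigen_pairing G (k + j)%N g - eigen_pairing G k (iter j Q g)| <=
    D / (1 - s) * B * (C * h) * s ^+ k.
Proof.
move=> kk gu gB EC Ch0; have /andP[s0 s1] := s_range.
have s1' : 0 < 1 - s by rewrite subr_gt0.
have B0 : 0 <= B by have [x0 Sx0] := Sigma0; exact: le_trans (gB _ Sx0).
(* The induction on j needs the partial geometric sum, s^k (1 - s^j) / (1 - s). *)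
suff H' : `|eigen_pairing G (k + j)%N g - eigen_pairing G k (iter j Q g)| <=
    D / (1 - s) * B * (C * h) * s ^+ k * (1 - s ^+ j).
  rewrite (le_trans H')// ler_piMr//; last by rewrite gerBl exprn_ge0// ltW.
  apply: mulr_ge0; last by rewrite exprn_ge0// ltW.
  by apply: mulr_ge0 => //; apply: mulr_ge0 => //; rewrite divr_ge0// ltW.
elim: j g gu gB => [|j IH] g gu gB.
  by rewrite addn0 subrr normr0 expr0 subrr mulr0.
have QB x : Sigma x -> `|Q g x| <= B.
  move=> Sx; rewrite ler_norml.
  have gr y : Sigma y -> - B <= g y <= B by move=> Sy; rewrite -ler_norml gB.
  exact: (normalized_op_range pmin_gt0 psi_ge beta_gt0 go_gt0 go_eigen gr).
have st := eigen_pairing_step (leq_trans kk (leq_addr j k)) gu gB.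
have ih := IH _ (ucont_Q gu) QB.
rewrite addnS iterSr -(subrKA (eigen_pairing G (k + j)%N (Q g))).
rewrite (le_trans (ler_normD _ _))// (le_trans (lerD st ih))//.
have e1 := EC _ (leq_trans kk (leq_addr j k)).
have e2 : D * s ^+ (k + j) * B * eigen_pairing G (k + j) (fun=> 1) <=
    D * s ^+ (k + j) * B * (C * h).
  by rewrite ler_wpM2l// mulr_ge0// mulr_ge0// exprn_ge0// ltW.
rewrite (le_trans (lerD e2 (lexx _)))// exprS exprD.
rewrite le_eqVlt; apply/orP; left; apply/eqP; field.
by rewrite gt_eqF.
Qed.

End fixed_cocycle.

(* Half of the [n] steps are spent on the decay of [Q], at a cost [O(s^(n/2))] for
   replacing [eigen_pairing G n] by [eigen_pairing G n./2]; both halves exceed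
   [k0]. *)
Theorem eigen_pairing_limit : exists r C, [/\ 0 < r < 1, 0 < C &
  forall G, cocycle_like G -> exists h, [/\ 0 < h,
    forall n, (k0 <= n)%N -> `|eigen_pairing G n (fun=> 1) - h| <= C * r ^+ n * h,
    forall n, (k0 <= n)%N -> eigen_pairing G n (fun=> 1) <= C * h,
    forall n, (k0 <= n)%N -> h <= C * eigen_pairing G n (fun=> 1) &
    forall g B L, ucont Sigma g -> (forall x, Sigma x -> `|g x| <= B) ->
      (forall x y, Sigma x -> Sigma y -> `|g x - g y| <= L) ->
      (forall n x y, (M <= n)%N -> Sigma x -> Sigma y -> agree n x y ->
        `|g x - g y| <= L * tau ^+ n) ->
      forall n, (2 * k0 <= n)%N ->
        `|eigen_pairing G n g - mean g * h| <= C * r ^+ n * (B + L) * h]].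
Proof.
have [r0 [C0 [/andP[r00 r01] C00 Hdecay]]] :=
  normalized_op_decay Sigma_closed Sigma0 Sigma_sft Sigma_mixing Sigma_memory
    tau_range H_ge0 pmin_gt0 psi_ge psi_log beta_gt0 go_ucont go_gt0 go_eigen.
have [C1 C10 Hlim] := quasi_constant_limit k0 s_range D_ge0 c_gt0.
have /andP[s0 s1] := s_range.
have s1' : 0 < 1 - s by rewrite subr_gt0.
pose q := Num.max s r0.
have q0 : 0 < q by rewrite lt_max s0.
have q1 : q < 1 by rewrite gt_max s1.
(* Halving n turns the rate q into its square root; for odd n the rounding costs the factor [r^-1]
   in [halfr]. *)
have [r /andP[r_gt0 r_lt1] rq] : exists2 r, 0 < r < 1 & r ^+ 2 = q.
  exists (Num.sqrt q); last by rewrite sqr_sqrtr// ltW.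
  by rewrite sqrtr_gt0 q0 -sqrtr1 ltr_sqrt.
have halfr n : q ^+ n./2 <= r^-1 * r ^+ n.
  rewrite -rq -exprM mulnC muln2 -{2}(odd_double_half n) exprD mulrA.
  rewrite ler_peMl ?exprn_ge0 ?(ltW r_gt0)//; case: (odd n).
    by rewrite expr1 mulVf ?gt_eqF.
  by rewrite expr0 mulr1 invf_ge1// ltW.
have qr n : s ^+ n <= r ^+ n.
  apply: lerXn2r; rewrite ?nnegrE ?(ltW s0) ?(ltW r_gt0)//.
  apply: (@le_trans _ _ q); first by rewrite le_max lexx.
  by rewrite -rq expr2 ler_piMl// ltW.
(* In this order: trading j letters for iterates of [Q] ([E1]), replacing the pairing of 1 at k by h
   ([E3]), and the decay of [Q] ([E2] with [E4]). *)
pose S3 := D / (1 - s) * C1 + C1 + C1 * C0; pose C2 := r^-1 * S3.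
have D3 : 0 <= D / (1 - s) by rewrite divr_ge0// ltW.
have S30 : 0 <= S3.
  have := mulr_ge0 D3 (ltW C10); have := mulr_gt0 C10 C00.
  by rewrite /S3 => h1 h2; rewrite addr_ge0 ?addr_ge0// ltW.
have C20 : 0 <= C2 by rewrite mulr_ge0// invr_ge0 ltW.
exists r, (C1 + C2); split; [by rewrite r_gt0|by rewrite ltr_pwDl|].
move=> G GG; have cu := @ucont_cst R W Sigma 1.
have aD n : (k0 <= n)%N ->
    `|eigen_pairing G n.+1 (fun=> 1) - eigen_pairing G n (fun=> 1)| <= D * s ^+ n * eigen_pairing G n (fun=> 1).
  move=> kn; have := @eigen_pairing_step G GG n _ 1 kn cu (fun x _ => _).
  by rewrite eigen_pairing_Q1 mulr1; apply => *; rewrite normr1.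
have [h [h0 hlim hup hlow]] := Hlim (fun n => eigen_pairing G n (fun=> 1))
  (fun n _ => eigen_pairing_gt0 GG n) aD (fun n _ => eigen_pairing_lower GG n).
have C1C t : 0 <= t -> C1 * t <= (C1 + C2) * t.
  by move=> t0; rewrite ler_wpM2r// lerDl.
exists h; split => //.
- move=> n kn; rewrite (le_trans (hlim n kn))// ler_wpM2r ?(ltW h0)//.
  rewrite ler_pM ?(ltW C10) ?exprn_ge0 ?(ltW s0)//; first by rewrite lerDl.
- by move=> n kn; rewrite (le_trans (hup n kn))// C1C// ltW.
- by move=> n kn; rewrite (le_trans (hlow n kn))// C1C// ltW// eigen_pairing_gt0.
move=> g B L gu gB gL gn n kn.
have [x0 Sx0] := Sigma0.
have B0 : 0 <= B := le_trans (normr_ge0 _) (gB _ Sx0).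
have L0 : 0 <= L := le_trans (normr_ge0 _) (gL _ _ Sx0 Sx0).
set k := n./2.
have kk : (k0 <= k)%N by rewrite /k -(doubleK k0) -mul2n half_leq.
have [j nkj kj] : exists2 j, n = (k + j)%N & (k <= j)%N.
  exists (odd n + k)%N; last exact: leq_addl.
  by rewrite addnCA addnn odd_double_half.
set e := C0 * r0 ^+ j * L.
have gjd x y : Sigma x -> Sigma y -> `|iter j Q g x - iter j Q g y| <= e.
  by have [_] := Hdecay g L gL gn j; exact.
have gju : ucont Sigma (iter j Q g) by have [] := Hdecay g L gL gn j.
have gjm x : Sigma x -> `|iter j Q g x - mean g| <= e.
  move=> Sx; rewrite -(mean_iter_Q j gu); apply: mean_dist => // y Sy.
  exact: gjd.
have mB : `|mean g| <= B.
  by have := @mean_dist g 0 B gu; rewrite sub0r normrN; apply => // x Sx;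
    rewrite sub0r normrN gB.
set ak := eigen_pairing G k (fun=> 1).
have ak0 : 0 <= ak by rewrite ltW// eigen_pairing_gt0.
have E1 := eigen_pairing_iter GG j kk gu gB hup (ltW (mulr_gt0 C10 h0)).
have E2 : `|eigen_pairing G k (iter j Q g) - mean g * ak| <= e * ak.
  have cst t : eigen_pairing G k (fun=> t) = t * ak.
    by rewrite -eigen_pairingZ//; congr eigen_pairing; apply/funext => x; rewrite mulr1.
  have up : eigen_pairing G k (iter j Q g) <= (mean g + e) * ak.
    rewrite -cst; apply: eigen_pairing_le => //; first exact: ucont_cst.
    by move=> x /gjm; rewrite ler_norml => /andP[_]; lra.
  have lo : (mean g - e) * ak <= eigen_pairing G k (iter j Q g).
    rewrite -cst; apply: eigen_pairing_le => //; first exact: ucont_cst.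
    by move=> x /gjm; rewrite ler_norml => /andP[+ _]; lra.
  by rewrite ler_norml; apply/andP; split; lra.
have E3 : `|mean g * ak - mean g * h| <= B * (C1 * s ^+ k * h).
  by rewrite -mulrBr normrM ler_pM// hlim.
have e0 : 0 <= e by rewrite !mulr_ge0 ?exprn_ge0 ?(ltW C00) ?(ltW r00).
have E4 : e * ak <= e * (C1 * h) by rewrite ler_wpM2l// hup.
have sq : s ^+ k <= q ^+ k.
  apply: lerXn2r; rewrite ?nnegrE ?(ltW s0) ?(ltW q0)//.
  by rewrite le_max lexx.
have rq' : r0 ^+ j <= q ^+ k.
  apply: (@le_trans _ _ (q ^+ j)).
    apply: lerXn2r; rewrite ?nnegrE ?(ltW r00) ?(ltW q0)//.
    by rewrite le_max lexx orbT.
  by rewrite ler_wiXn2l ?(ltW q0) ?(ltW q1).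
have -> : eigen_pairing G n g - mean g * h =
    (eigen_pairing G (k + j) g - eigen_pairing G k (iter j Q g)) +
    (eigen_pairing G k (iter j Q g) - mean g * ak) + (mean g * ak - mean g * h).
  by rewrite nkj; ring.
rewrite (le_trans (ler_normD _ _))// (le_trans (lerD (ler_normD _ _) (lexx _)))//.
rewrite (le_trans (lerD (lerD E1 E2) E3))//.
apply: (@le_trans _ _ (D / (1 - s) * B * (C1 * h) * q ^+ k +
    C0 * q ^+ k * L * (C1 * h) + B * (C1 * q ^+ k * h))).
  apply: lerD; first apply: lerD.
  - by rewrite ler_wpM2l//; apply: mulr_ge0; [exact: mulr_ge0|rewrite ltW// mulr_gt0].
  - apply: (le_trans E4); rewrite ler_wpM2r ?mulr_ge0 ?(ltW C10) ?(ltW h0)//.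
    by rewrite ler_wpM2r// ler_wpM2l// ltW.
  - by rewrite ler_wpM2l// ler_wpM2r ?(ltW h0)// ler_wpM2l// ltW.
apply: (@le_trans _ _ (S3 * q ^+ k * (B + L) * h)).
  have qk0 : 0 <= q ^+ k by rewrite exprn_ge0// ltW.
  have a1 : 0 <= D / (1 - s) * C1 * q ^+ k * L * h.
    by rewrite !mulr_ge0 ?(ltW C10) ?(ltW h0)// invr_ge0 ltW.
  have a2 : 0 <= C1 * q ^+ k * L * h by rewrite !mulr_ge0 ?(ltW C10) ?(ltW h0).
  have a3 : 0 <= C1 * C0 * q ^+ k * B * h.
    by rewrite !mulr_ge0 ?(ltW C10) ?(ltW C00) ?(ltW h0).
  rewrite /S3; lra.
rewrite ler_wpM2r ?(ltW h0)// ler_wpM2r ?addr_ge0//.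
apply: (@le_trans _ _ (C2 * r ^+ n)).
  rewrite (_ : C2 * r ^+ n = S3 * (r^-1 * r ^+ n)); last by rewrite /C2; ring.
  by rewrite ler_wpM2l//; exact: halfr.
by rewrite ler_wpM2r ?exprn_ge0 ?(ltW r_gt0)// lerDr ltW.
Qed.

Let inv_le b z : 0 < b -> b <= go z -> (go z)^-1 <= b^-1.
Proof.
by move=> b0 bz; rewrite lef_pV2 ?posrE//; exact: lt_le_trans bz.
Qed.

(** Apart from the difference of F, the quotient involves |go y - go x|, which the logarithmic
    modulus of [go] bounds by a multiple of [go x + go y]. Divided by [go x * go y], this symmetric
    form leaves at most 2 / b. *)
Let divgo_modulus F N E : (forall x, Sigma x -> `|F x| <= N) -> 0 <= E ->
  (forall n x y, (M <= n)%N -> Sigma x -> Sigma y -> agree n x y ->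
    `|F x - F y| <= E * tau ^+ n) ->
  forall b K, 0 < b -> 0 <= K -> (forall x, Sigma x -> b <= go x) ->
  (forall n x y, (M <= n)%N -> Sigma x -> Sigma y -> agree n x y ->
    go x <= expR (K * tau ^+ n) * go y) ->
  forall n x y, (M <= n)%N -> Sigma x -> Sigma y -> agree n x y ->
    `|F x / go x - F y / go y| <= (E + 2 * N * (K * expR K)) / b * tau ^+ n.
Proof.
move=> FN E0 FE b K b_gt0 K0 gc gK n x y Mn Sx Sy xy.
have /andP[t0 t1] := tau_range.
have tn0 : 0 <= tau ^+ n by rewrite exprn_ge0// ltW.
have tn1 : tau ^+ n <= 1 by rewrite exprn_ile1// ltW.
have gx0 := go_gt0 Sx; have gy0 := go_gt0 Sy.
have N0 : 0 <= N := le_trans (normr_ge0 _) (FN _ Sx).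
set k := K * tau ^+ n.
have k0' : 0 <= k by rewrite mulr_ge0.
have kK : k <= K by rewrite ler_piMr.
have h1 := gK n x y Mn Sx Sy xy; have h2 := gK n y x Mn Sy Sx (agree_sym xy).
rewrite -/k in h1 h2.
have ek : expR k - 1 <= k * expR K.
  by have := @expR_sub1_le R k K; rewrite ger0_norm// => /(_ kK); apply/le_trans/ler_norm.
have d1 : `|go y - go x| <= k * expR K * (go x + go y).
  have a1 := ler_wpM2r (ltW gx0) ek; have a2 := ler_wpM2r (ltW gy0) ek.
  have b0 : 0 <= k * expR K by rewrite mulr_ge0// expR_ge0.
  have c1 := mulr_ge0 b0 (ltW gx0); have c2 := mulr_ge0 b0 (ltW gy0).
  by rewrite ler_norml; apply/andP; split; lra.
have -> : F x / go x - F y / go y =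
    (F x - F y) / go x + F y * ((go y - go x) / (go x * go y)).
  by field; rewrite !gt_eqF.
have inv z : Sigma z -> (go z)^-1 <= b^-1.
  by move=> Sz; apply: inv_le => //; exact: gc.
have e1 : `|(F x - F y) / go x| <= E * tau ^+ n / b.
  rewrite normrM normfV (gtr0_norm gx0).
  by apply: ler_pM; rewrite ?invr_ge0 ?(ltW gx0) ?FE ?inv.
have e2 : `|F y * ((go y - go x) / (go x * go y))| <= N * (k * expR K * (2 / b)).
  rewrite normrM; apply: ler_pM; rewrite ?FN//.
  have -> : `|(go y - go x) / (go x * go y)| = `|go y - go x| / (go x * go y).
    by rewrite normrM normfV (gtr0_norm (mulr_gt0 gx0 gy0)).
  rewrite ler_pdivrMr ?mulr_gt0// (le_trans d1)// -[leRHS]mulrA.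
  rewrite ler_wpM2l ?mulr_ge0 ?expR_ge0//.
  have i1 : go x <= go x * (go y / b).
    by rewrite ler_peMr ?(ltW gx0)// ler_pdivlMr// mul1r gc.
  have i2 : go y <= go y * (go x / b).
    by rewrite ler_peMr ?(ltW gy0)// ler_pdivlMr// mul1r gc.
  lra.
rewrite (le_trans (ler_normD _ _))// (le_trans (lerD e1 e2))//.
by rewrite /k le_eqVlt; apply/orP; left; apply/eqP; field; rewrite gt_eqF.
Qed.

(** For G_n(w) = L_{[w]_n}(1)(x), F = 1 gives beta^-n A_n(1)(x) exactly, and the fibre integral F of
    f gives beta^-n A_n(f)(x) up to O(s^n) beta^-n A_n(1)(x) once n >= k0. *)
Definition pairing G n F := beta ^- n * \int[rho]_(x in Sigma) (G n x * F x).

Let pairing_eigen G n F : pairing G n F = eigen_pairing G n (fun x => F x / go x).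
Proof.
congr (_ * _); apply: wint_eq => x Sx; congr (_ * _).
by rewrite mulrC divfK// gt_eqF// go_gt0.
Qed.

(** This is [eigen_pairing_limit] at g = F / go. The clauses on [eigen_pairing] at 1 will make h
    Hoelder and bounded; the comparison of [pairing] at 1 with h will control the denominators. *)
Theorem annealed_limit : exists r C, [/\ 0 < r < 1, 0 < C &
  forall G, cocycle_like G -> exists h, [/\ 0 < h,
    forall n, (k0 <= n)%N -> `|eigen_pairing G n (fun=> 1) - h| <= C * r ^+ n * h,
    h <= C * eigen_pairing G k0 (fun=> 1),
    forall n, (k0 <= n)%N -> pairing G n (fun=> 1) <= C * h /\ h <= C * pairing G n (fun=> 1) &
    forall F N E, ucont Sigma F -> (forall x, Sigma x -> `|F x| <= N) -> 0 <= E ->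
      (forall n x y, (M <= n)%N -> Sigma x -> Sigma y -> agree n x y ->
        `|F x - F y| <= E * tau ^+ n) ->
      forall n, (2 * k0 <= n)%N ->
        `|pairing G n F - (\int[m]_(x in Sigma) F x) * h| <= C * r ^+ n * (E + N) * h]].
Proof.
have [r [C [r01 C0 HG]]] := eigen_pairing_limit.
have [cg [Cg [cg0 Cg0 gcC]]] := go_bounds.
have [K K0 gK] := eigenfunction_log Sigma_closed Sigma0 Sigma_memory tau_range
  H_ge0 pmin_gt0 psi_ge psi_log beta_gt0 go_ucont go_gt0 go_eigen.
have gc x : Sigma x -> cg <= go x by move=> /gcC/andP[].
(* [A * (E + N)] dominates the supremum [N / cg] of F / go plus its modulus L; the 3 collects one
   [N / cg] from the supremum and two from the oscillation. *)
pose A := 2 * (K * expR K) / cg + 3 / cg.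
have A1 : 0 <= 2 * (K * expR K) / cg.
  by rewrite divr_ge0 ?(ltW cg0)// !mulr_ge0// expR_ge0.
have A2 : 0 < 3 / cg by rewrite divr_gt0.
have A0 : 0 < A by rewrite ltr_wpDl.
have /andP[r0 r1] := r01.
pose C' := C * (1 + A + Cg + cg^-1).
have icg : 0 < cg^-1 by rewrite invr_gt0.
have CC' t : 0 <= t -> t <= 1 + A + Cg + cg^-1 -> C * t <= C'.
  by move=> t0 tt; rewrite ler_wpM2l// ltW.
have CC1 : C <= C'.
  by rewrite -[leLHS]mulr1 CC'//; move: A0 Cg0 icg; lra.
exists r, C'; split => //; first exact: lt_le_trans CC1.
move=> G GG; have [h [h0 hlim hup hlow hg]] := HG G GG.
have cu := @ucont_cst R W Sigma 1.
have e0 n := eigen_pairing_gt0 GG n.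
exists h; split => //.
- move=> n kn; rewrite (le_trans (hlim n kn))// !ler_wpM2r ?(ltW h0)//.
  by rewrite exprn_ge0// ltW.
- by rewrite (le_trans (hlow _ (leqnn _)))// ler_wpM2r// ltW.
- move=> n kn; have du := ucont_divgo cu; rewrite pairing_eigen; split.
    apply: (@le_trans _ _ (cg^-1 * eigen_pairing G n (fun=> 1))).
      rewrite -eigen_pairingZ//; apply: eigen_pairing_le => //; first by apply: ucontM => //; exact: ucont_cst.
      by move=> x Sx; rewrite mulr1 div1r inv_le ?gc.
    apply: (@le_trans _ _ (cg^-1 * (C * h))); first by rewrite ler_wpM2l ?hup// ltW.
    rewrite mulrA ler_wpM2r ?(ltW h0)// mulrC CC' ?(ltW icg)//.
    by move: A0 Cg0; lra.
  apply: (le_trans (hlow n kn)).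
  apply: (@le_trans _ _ (C * (Cg * eigen_pairing G n (fun x => 1 / go x)))).
    rewrite ler_wpM2l ?(ltW C0)// -eigen_pairingZ//; apply: eigen_pairing_le => //.
      by apply: ucontM => //; exact: ucont_cst.
    move=> x Sx; have /andP[_ xC] := gcC _ Sx.
    by rewrite mul1r ler_pdivlMr ?go_gt0// mul1r.
  rewrite mulrA ler_wpM2r//; last first.
    by apply: CC'; [exact: ltW|move: A0 icg; lra].
  rewrite /eigen_pairing mulr_ge0 ?invr_ge0 ?exprn_ge0 ?(ltW beta_gt0)//.
  apply: Rintegral_ge0 => x Sx; have [_ G0 _ _] := GG.
  by rewrite !mulr_ge0 ?invr_ge0 ?(ltW (G0 _ _)) ?(ltW (go_gt0 Sx)).
move=> F N E Fu FN E0 FE n kn.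
have [x0 Sx0] := Sigma0.
have N0 : 0 <= N := le_trans (normr_ge0 _) (FN _ Sx0).
have dB x : Sigma x -> `|F x / go x| <= N / cg.
  move=> Sx; rewrite normrM normfV (gtr0_norm (go_gt0 Sx)).
  by apply: ler_pM; rewrite ?invr_ge0 ?(ltW (go_gt0 Sx)) ?FN// inv_le ?gc.
pose L := (E + 2 * N * (K * expR K)) / cg + 2 * (N / cg).
have Ncg : 0 <= N / cg by rewrite divr_ge0// ltW.
have L1 : 0 <= (E + 2 * N * (K * expR K)) / cg.
  by rewrite divr_ge0 ?(ltW cg0)// addr_ge0// !mulr_ge0// expR_ge0.
have mean_F : mean (fun x => F x / go x) = \int[m]_(x in Sigma) F x.
  by apply: wint_eq => x Sx; rewrite mulrC divfK// gt_eqF// go_gt0.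
have := hg _ (N / cg) L (ucont_divgo Fu) dB _ _ n kn.
rewrite mean_F -pairing_eigen => H'; apply: le_trans (H' _ _) _.
- move=> x y Sx Sy; rewrite (le_trans (ler_normB _ _))//.
  by rewrite (le_trans (lerD (dB _ Sx) (dB _ Sy)))// /L; move: L1; lra.
- move=> k x y Mk Sx Sy xy.
  rewrite (le_trans (divgo_modulus FN E0 FE cg0 K0 gc gK Mk Sx Sy xy))//.
  rewrite ler_wpM2r//; last by rewrite /L; move: Ncg; lra.
  by have /andP[t0 _] := tau_range; rewrite exprn_ge0// ltW.
rewrite ler_wpM2r ?(ltW h0)//.
have LE : N / cg + L <= A * (E + N).
  rewrite /L /A; have := mulr_ge0 A1 E0; have : 0 <= E / cg by rewrite divr_ge0// ltW.
  lra.
rewrite mulrAC [leRHS]mulrAC ler_wpM2r ?exprn_ge0 ?(ltW r0)//.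
apply: (@le_trans _ _ (C * (A * (E + N)))); first by rewrite ler_wpM2l// ltW.
rewrite mulrA ler_wpM2r ?addr_ge0// CC' ?(ltW A0)//.
by move: Cg0 icg; lra.
Qed.

End annealed_functionals.

(** * Constants uniform over the finite alphabet, and the final estimates *)

Lemma log_hoelder_uniform (R : realType) (W : alphabetType)
    (Sigma : set (words R W)) (p : W -> words R W -> R) :
  log_hoelder Sigma p -> exists tau H pmin pmax, [/\ 0 < tau < 1, 0 <= H, 0 < pmin,
    forall i x, branch_dom Sigma i x -> pmin <= p i x <= pmax &
    forall n i x y, branch_dom Sigma i x -> branch_dom Sigma i y -> agree n x y ->
      p i x <= expR (H * tau ^+ n) * p i y].
Proof.
move=> ph.
have K i : exists k, 0 < k /\ exists H,
    forall x y, branch_dom Sigma i x -> branch_dom Sigma i y ->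
    `|ln (p i x) - ln (p i y)| <= H * mdist x y `^ k.
  by have [_ [k [H [k0 HH]]]] := ph i; exists k; split => //; exists H.
have [kappa kP] := boolp.choice K.
have [Hf HP] := boolp.choice (fun i => (kP i).2).
(* Distances of words are at most 1, so lowering all exponents to the smallest one only enlarges the
   powers. Agreement on n letters then gives the common rate tau^n with tau = 2^-k. *)
have [k k0 kk] := finite_min_gt0 (fun i => (kP i).1).
pose tau : R := 2^-1 `^ k.
have h0 : (0 : R) < 2^-1 by rewrite invr_gt0.
have h1 : 2^-1 < 1 :> R by rewrite invf_lt1// ltr1n.
have tau0 : 0 < tau by rewrite powR_gt0.
have tau1 : tau < 1.
  have -> : 1 = 1 `^ k :> R by rewrite powR1.
  by apply: gt0_ltr_powR; rewrite ?nnegrE// ltW.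
pose H := \sum_i `|Hf i|.
have H0 : 0 <= H by apply: sumr_ge0.
have ln_le n i x y : branch_dom Sigma i x -> branch_dom Sigma i y ->
    agree n x y -> `|ln (p i x) - ln (p i y)| <= H * tau ^+ n.
  move=> bx byy xy; rewrite (le_trans (HP i x y bx byy))//.
  have d1 : mdist x y `^ kappa i <= tau ^+ n.
    apply: (@le_trans _ _ ((2^-1 ^+ n) `^ kappa i)).
      apply: ge0_ler_powR; rewrite ?nnegrE ?mdist_ge0 ?exprn_ge0 ?(ltW h0)//.
        by apply: ltW; case: (kP i).
      exact/mdist_agree.
    rewrite -(powR_mulrn _ (ltW h0)) powRAC powR_mulrn ?powR_ge0//.
    apply: lerXn2r; rewrite ?nnegrE ?powR_ge0//.
    by apply: ger_powR; rewrite ?h0 ?(ltW h1)//; exact: kk.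
  have d0 : 0 <= mdist x y `^ kappa i by exact: powR_ge0.
  apply: (@le_trans _ _ (`|Hf i| * mdist x y `^ kappa i)).
    by rewrite ler_wpM2r// ler_norm.
  by apply: ler_pM => //; rewrite /H (bigD1 i)//= lerDl sumr_ge0.
have p_log n i x y : branch_dom Sigma i x -> branch_dom Sigma i y -> agree n x y ->
    p i x <= expR (H * tau ^+ n) * p i y.
  move=> bx byy xy; have [pp _] := ph i; have px := pp _ bx; have py := pp _ byy.
  have := ln_le n i x y bx byy xy; rewrite ler_norml => /andP[_ h].
  rewrite -ler_pdivrMr// -[leLHS]lnK ?posrE ?divr_gt0// ler_expR.
  by rewrite lnM ?posrE ?invr_gt0// lnV ?posrE.
have Qi i : exists c, 0 < c /\
    forall x, branch_dom Sigma i x -> c <= p i x <= c^-1.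
  have [[x0 bx0]|nb] := pselect (exists x, branch_dom Sigma i x); last first.
    by exists 1; split => // x bx; case: nb; exists x.
  have [pp _] := ph i; have p0 := pp _ bx0.
  (* Any two points agree on 0 letters, so [p_log] at n = 0 compares [p i] with its value at x0 up
     to [expR H]. Bounds of the form c and c^-1 let one minimum over i settle both sides. *)
  pose c := Num.min (expR (- H) * p i x0) (expR H * p i x0)^-1.
  have c0 : 0 < c by rewrite lt_min ?invr_gt0 !mulr_gt0 ?expR_gt0.
  exists c; split => // x bx; have px := pp _ bx.
  have ag0 : agree 0 x x0 by [].
  have := p_log 0%N i x x0 bx bx0 ag0.
  have := p_log 0%N i x0 x bx0 bx (agree_sym ag0).
  rewrite expr0 mulr1 => l1 l2; apply/andP; split.
    rewrite ge_min; apply/orP; left.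
    by rewrite expRN mulrC ler_pdivrMr ?expR_gt0// mulrC.
  rewrite -[leLHS]invrK lef_pV2 ?posrE ?invr_gt0// ge_min; apply/orP; right.
  by rewrite lef_pV2 ?posrE ?mulr_gt0 ?expR_gt0.
have [q qP] := boolp.choice Qi.
have [pmin pmin0 pminq] := finite_min_gt0 (fun i => (qP i).1).
exists tau, H, pmin, pmin^-1; split => //; first by rewrite tau0.
move=> i x bx; have [q0 /(_ x bx)/andP[l1 l2]] := qP i.
rewrite (le_trans (pminq i) l1)/= (le_trans l2)//.
by rewrite lef_pV2 ?posrE.
Qed.

(** The distortion constant K is the same for all [E n] and passes to the pointwise limit, which
    handles distances below [a]. Beyond [a] the bound [B] suffices, at the cost of
    [B / a ^ alpha]. *)
Lemma hoelder_space_limit (R : realType) (X : completeMetricType R)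
    (a alpha K r C B : R) (k0 : nat) (h : X -> R) (E : nat -> X -> R) :
  0 < a -> 0 < alpha -> 0 <= K -> 0 < r < 1 -> (forall x, 0 < h x) ->
  (forall x, h x <= B) ->
  (forall n x, (k0 <= n)%N -> `|E n x - h x| <= C * r ^+ n * h x) ->
  (forall n x y, mdist x y < a -> E n x <= expR (K * mdist x y `^ alpha) * E n y) ->
  hoelder_space alpha h.
Proof.
move=> a0 alpha0 K0 r01 h0 hB Eh EK.
have hK x y : mdist x y < a -> h x <= expR (K * mdist x y `^ alpha) * h y.
  move=> xya; set k := expR _; apply/ler_addgt0Pr => e e0.
  have [n kn ne] := geometric_eventually_le (C * (h x + k * h y)) k0 r01 e0.
  have := Eh n x kn; have := Eh n y kn; have := EK n x y xya; rewrite -/k.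
  rewrite !ler_norml => e1 /andP[_ e2] /andP[e3 _].
  have k1 : 0 <= k := expR_ge0 _.
  have := ler_wpM2l k1 e2; lra.
split; first by apply/bnd_bounded; exists B => x; rewrite gtr0_norm.
have B0 : 0 <= B := le_trans (ltW (h0 point)) (hB point).
pose A := B * (expR (K * a `^ alpha) * K); pose A' := B / a `^ alpha.
have A0 : 0 <= A by rewrite !mulr_ge0// expR_ge0.
have A'0 : 0 <= A' by rewrite divr_ge0// powR_ge0.
have half x y : h x - h y <= (A + A') * mdist x y `^ alpha.
  have d0 := powR_ge0 (mdist x y) alpha.
  have [xya|ayx] := ltP (mdist x y) a.
    apply: (@le_trans _ _ (A * mdist x y `^ alpha)); last by rewrite ler_wpM2r// lerDl.
    apply: expR_ratio_diff (hK x y xya); [exact: ltW|exact: hB|exact: mulr_ge0|].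
    by rewrite ler_wpM2l// ge0_ler_powR ?nnegrE ?mdist_ge0// ltW.
  apply: (@le_trans _ _ (A' * mdist x y `^ alpha)); last by rewrite ler_wpM2r// lerDr.
  apply: (@le_trans _ _ B); first by have := h0 y; have := hB x; lra.
  rewrite /A' mulrAC ler_pdivlMr ?powR_gt0// ler_wpM2l//.
  by rewrite ge0_ler_powR ?nnegrE ?mdist_ge0// ltW.
apply: (@hoelder_Dalpha _ _ _ _ (A + A')) => x y.
rewrite ler_norml half andbT lerNl opprB metric_sym; exact: half.
Qed.

Lemma Lop1_uniform_bound (R : realType) (X : completeMetricType R) (W : alphabetType)
    (T : W -> X -> X) (phi : W -> X -> R) (n : nat) :
  (forall i, summable_potential T phi i) ->
  exists2 B, 0 <= B & forall v x, size v = n -> Lop T phi v (cst 1) x <= B.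
Proof.
move=> phi_s; pose Bv (v : seq W) := projT1 (cid (Lop1_bnd phi_s v)).
have BvP v x : Lop T phi v (cst 1) x <= Bv v.
  by rewrite /Bv; case: cid => B HB /=; exact: le_trans (ler_norm _) (HB x).
have Bv0 v : 0 <= Bv v by apply: le_trans (BvP v point); exact: Lop_ge0.
exists (\sum_(v : n.-tuple W) Bv v) => [|v x sv]; first exact: sumr_ge0.
have sv' : size v == n by rewrite sv.
by rewrite (le_trans (BvP v x))// (bigD1 (Tuple sv'))//= lerDl sumr_ge0.
Qed.

Theorem theorem6p3 (R : realType) (X : completeMetricType R) (W : alphabetType)
  (T : W -> X -> X) (a lambda alpha : R) (phi : W -> X -> R)
  (rho : probability (borel (words R W)) R) (Sigma : set (words R W))
  (p : W -> words R W -> R) (k0 : nat) (s : R)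
  (mu : words R W -> probability (borel X) R)
  (beta : R) (m : probability (borel (words R W)) R) (go : words R W -> R)
  (X_separable : separable_space X)
  (T_continuous : forall i, continuous (T i))
  (T_surjective : forall i y, exists x, T i x = y)
  (T_expanding : ruelle_expanding T a lambda)
  (T_mixing : jointly_topologically_mixing T)
  (T_aperiodic : finitely_aperiodic T a)
  (alpha_range : 0 < alpha <= 1)
  (phi_hoelder : forall i, (Dalpha alpha (phi i) < +oo)%E)
  (phi_summable : forall i, summable_potential T phi i)
  (Sigma_support : Sigma = msupport rho)
  (Sigma_sft : subshift_of_finite_type Sigma)
  (Sigma_mixing : topologically_mixing_subshift Sigma)
  (rho_nonsingular : nonsingular_shift rho)
  (p_jacobian : base_jacobian rho Sigma p)
  (p_hoelder : log_hoelder Sigma p)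
  (s_range : 0 < s < 1)
  (k0_contraction : contraction_from T a lambda alpha phi k0 s)
  (mu_fiber : fiber_measures T phi mu)
  (m_RPF : RPF_data T phi mu Sigma p beta m go) :
  exists r C : R, [/\ 0 < r < 1, 0 < C,
    forall (f : X -> R) (x : X) (n : nat),
      hoelder_space alpha f -> (2 * k0 <= n)%N ->
      (`|annealed T phi rho Sigma n f x / annealed T phi rho Sigma n (cst 1) x
         - int_pi mu Sigma m f|%:E
       <= (C * r ^+ n)%:E *
          (Dbar a lambda alpha phi f + norm_m mu Sigma f))%E
  & exists h : X -> R, [/\ hoelder_space alpha h, forall x, 0 < h x &
    forall (f : X -> R) (x : X) (n : nat),
      hoelder_space alpha f -> (2 * k0 <= n)%N ->
      (`|annealed T phi rho Sigma n f x / (beta ^+ n * h x)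
         - int_pi mu Sigma m f|%:E
       <= (C * r ^+ n)%:E *
          (Dbar a lambda alpha phi f + norm_m mu Sigma f))%E]].

Proof.
have [a_gt0 _ _] := T_expanding.
have /andP[alpha_gt0 _] := alpha_range.
have /andP[s0 s1] := s_range.
have [beta_gt0 mS m_eig [go_within go_gt0 go_eigen go_mass]] := m_RPF.
have Sigma_closed : closed Sigma by rewrite Sigma_support; exact: msupport_closed.
have rho_Sigma : rho Sigma = 1%E by rewrite Sigma_support msupport_full.
have Sigma0 : Sigma !=set0.
  apply/set0P/eqP => S0; move: mS; rewrite S0 measure0 => /eqP.
  by rewrite eq_sym onee_eq0.
have [M0 mem0] := sft_memory Sigma_sft.
have [tau0 [H0 [pmin [pmax [/andP[tau00 tau01] H00 pmin0 prange plog]]]]] :=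
  log_hoelder_uniform p_hoelder.
(* M0 letters decide which letters may be prepended; the fibre estimates start at k0 letters. *)
pose M := maxn M0 k0.
have Sigma_memory i x y : Sigma x -> Sigma y -> agree M x y ->
    Sigma (wcons i x) -> Sigma (wcons i y).
  by move=> Sx Sy /(agree_le (leq_maxl _ _)); exact: mem0.
pose tau := Num.max s tau0.
have tau_range : 0 < tau < 1 by rewrite lt_max s0 gt_max s1 tau01.
have [tau_gt0 tau_lt1] := andP tau_range.
have s_tau n : s ^+ n <= tau ^+ n.
  by apply: lerXn2r; rewrite ?nnegrE ?(ltW s0) ?(ltW tau_gt0)// le_max lexx.
have tau0_tau n : tau0 ^+ n <= tau ^+ n.
  by apply: lerXn2r; rewrite ?nnegrE ?(ltW tau00) ?(ltW tau_gt0)// le_max lexx orbT.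
have tn0 n : 0 <= tau ^+ n by rewrite exprn_ge0// ltW.
have tn1 n : tau ^+ n <= 1 by rewrite exprn_ile1// ltW.
pose Li i := Lop T phi [:: i] (cst 1).
pose lam := lambda_fiber T phi mu.
have DLi i : (Dbar a lambda alpha phi (Li i) < +oo)%E.
  exact: Dbar_Lop1.
have [c c0 cLi] := Lop1_lower_bound T_surjective alpha_gt0 phi_hoelder
  phi_summable T_aperiodic.
have [S S0 LiS] := Lop1_uniform_bound 1 phi_summable.
have lam_range i w : c <= lam i w <= S.
  apply: (fiber_range T_surjective phi_summable a_gt0 alpha_gt0 k0_contraction mu_fiber
    w (DLi i)) => y.
  by rewrite cLi LiS.
have S_gt0 : 0 < S.
  by have /andP[l1 l2] := lam_range point point; exact: lt_le_trans c0 (le_trans l1 l2).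
pose D := \sum_i fine (Dbar a lambda alpha phi (Li i)).
have DLi0 i : 0 <= fine (Dbar a lambda alpha phi (Li i)).
  by apply: fine_ge0; exact: Dbar_ge0.
have DLiD i : fine (Dbar a lambda alpha phi (Li i)) <= D.
  by rewrite /D (bigD1 i)//= lerDl sumr_ge0.
have D_ge0 : 0 <= D by apply: sumr_ge0.
have lam_diff n i x y : (k0 <= n)%N -> agree n x y ->
    `|lam i x - lam i y| <= 2 * D * s ^+ n.
  move=> kn xy.
  have := fiber_diff T_surjective phi_summable a_gt0 alpha_gt0 k0_contraction mu_fiber
    kn xy (DLi i).
  move/le_trans; apply; rewrite ler_wpM2r ?exprn_ge0 ?(ltW s0)//.
  by rewrite ler_wpM2l.
have lam_ucont i : ucont Sigma (lam i).
  move=> e; exact: (fiber_ucont T_surjective phi_summable a_gt0 alpha_gt0 k0_contraction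
    mu_fiber s_range Sigma (DLi i)).
have lam_ge0 i x : 0 <= lam i x.
  by have /andP[h _] := lam_range i x; exact: le_trans (ltW c0) h.
have p_ge0 i x : Sigma x -> 0 <= p i x.
  move=> Sx; have [ix|nix] := pselect (Sigma (wcons i x)).
    have /andP[h _] := prange i x (conj Sx ix); exact: le_trans (ltW pmin0) h.
  by have [_ ->] := p_jacobian.
have p_ucont i : ucont Sigma (p i).
  move=> e e0.
  have tr0 : 0 < tau0 < 1 by rewrite tau00.
  (* The absolute value is due to [pmax] having a known sign only once a point of the branch domain
     is at hand. *)
  have [n Mn ne] := geometric_eventually_le (2 * (H0 * expR H0) * `|pmax|) M tr0 e0.
  exists n => x y Sx Sy xy.
  have [ix|nix] := pselect (Sigma (wcons i x)); last first.
    have niy : ~ Sigma (wcons i y).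
      move=> iy; apply: nix; apply: Sigma_memory iy => //.
      by apply: agree_sym; exact: agree_le xy.
    by have [_ J0] := p_jacobian; rewrite !J0// subrr normr0 ltW.
  have iy : Sigma (wcons i y) by apply: Sigma_memory ix => //; exact: agree_le xy.
  have h1 := plog n i x y (conj Sx ix) (conj Sy iy) xy.
  have h2 := plog n i y x (conj Sy iy) (conj Sx ix) (agree_sym xy).
  have /andP[_ x1] := prange i x (conj Sx ix); have /andP[_ y1] := prange i y (conj Sy iy).
  have px0 := p_ge0 i x Sx; have py0 := p_ge0 i y Sy.
  have pm0 : 0 <= pmax := le_trans px0 x1.
  rewrite (ger0_norm pm0) in ne.
  have t0n : 0 <= tau0 ^+ n by rewrite exprn_ge0// ltW.
  have k0' : 0 <= H0 * tau0 ^+ n by rewrite mulr_ge0.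
  have kH : H0 * tau0 ^+ n <= H0 by rewrite ler_piMr// exprn_ile1// ltW.
  have d1 := expR_ratio_diff py0 y1 k0' kH h1.
  have d2 := expR_ratio_diff px0 x1 k0' kH h2.
  have z0 : 0 <= pmax * (expR H0 * H0) * tau0 ^+ n.
    by rewrite !mulr_ge0// expR_ge0.
  by rewrite ler_norml; apply/andP; split; lra.
pose psi i x := lam i x * p i x.
have psi_ge i x : Sigma x -> Sigma (wcons i x) -> c * pmin <= psi i x.
  move=> Sx ix; have /andP[l1 _] := lam_range i x.
  have /andP[p1 _] := prange i x (conj Sx ix).
  by rewrite ler_pM ?(ltW c0) ?(ltW pmin0).
(* The modulus 2 D s^n of [lam] becomes logarithmic after division by its lower bound [c]; [H0]
   comes from [p]. *)
pose H := 2 * D / c + H0.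
have H_ge0 : 0 <= H by rewrite addr_ge0// divr_ge0 ?mulr_ge0// ltW.
have psi_log n i x y : (M <= n)%N -> Sigma x -> Sigma y -> agree n x y ->
    Sigma (wcons i x) -> psi i x <= expR (H * tau ^+ n) * psi i y.
  move=> Mn Sx Sy xy ix.
  have iy : Sigma (wcons i y) by apply: Sigma_memory ix => //; exact: agree_le xy.
  have kn : (k0 <= n)%N := leq_trans (leq_maxr _ _) Mn.
  have /andP[cy _] := lam_range i y.
  have l1 : lam i x <= expR (2 * D / c * tau ^+ n) * lam i y.
    have := lam_diff n i x y kn xy; rewrite ler_norml => /andP[_ h].
    apply: (@le_trans _ _ ((1 + 2 * D / c * tau ^+ n) * lam i y)); last first.
      by rewrite ler_wpM2r// expR_ge1Dx.
    have a1 : 2 * D * s ^+ n <= 2 * D * tau ^+ n by rewrite ler_wpM2l// mulr_ge0.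
    have a2 : 2 * D * tau ^+ n <= 2 * D / c * tau ^+ n * lam i y.
      rewrite [leRHS](_ : _ = 2 * D * tau ^+ n * (lam i y / c)); last by ring.
      by rewrite ler_peMr ?mulr_ge0// ler_pdivlMr// mul1r.
    lra.
  have l2 : p i x <= expR (H0 * tau ^+ n) * p i y.
    rewrite (le_trans (plog n i x y (conj Sx ix) (conj Sy iy) xy))//.
    by rewrite ler_wpM2r ?p_ge0// ler_expR ler_wpM2l.
  rewrite /psi (le_trans (ler_pM (lam_ge0 _ _) (p_ge0 i x Sx) l1 l2))//.
  by rewrite mulrACA -expRD -mulrDl.
have go_ucont : ucont Sigma go by exact: within_ucont.
have go_eig x : Sigma x -> ruelle_op Sigma psi go x = beta * go x by exact: go_eigen.
have m_eigen g : ucont Sigma g ->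
    \int[m]_(x in Sigma) ruelle_op Sigma psi g x = beta * \int[m]_(x in Sigma) g x.
  by move=> gu; apply: m_eig; exact: ucont_within.
have pm_gt0 : 0 < c * pmin by rewrite mulr_gt0.
have Dc_ge0 : 0 <= D / c by rewrite divr_ge0// ltW.
have cS_gt0 : 0 < c / S by rewrite divr_gt0.
pose G x n (w : words R W) := Lop T phi (prefix_word w n) (cst 1) x.
have G_gt0 x n w : 0 < G x n w by exact: Lop1_gt0.
have b1 := @bnd_cst R X 1.
(* [G x n.+1 (wcons i w)] is L_{[w]_n}(L_i(1))(x). Its distance to lam G_n is at most s^n D G_n,
   which lam >= c makes relative with constant [D / c]; L_i(1) >= c and lam <= S give the lower
   constant [c / S]. *)
have G_cocycle x : cocycle_like lam k0 s (D / c) (c / S) (G x).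
  have GS n i w : G x n.+1 (wcons i w) = Lop T phi (prefix_word w n) (Li i) x.
    by rewrite /G prefix_wcons Lop_cons.
  split=> [n w w' /agree_prefix ww'|//|n i w kn|n i w].
  - by rewrite /G ww'.
  - rewrite GS; have := fiber_approx T_surjective phi_summable a_gt0 alpha_gt0
      k0_contraction mu_fiber w x kn (DLi i).
    move/le_trans; apply.
    have /andP[l1 _] := lam_range i w.
    have -> : D / c * s ^+ n * (lam i w * G x n w) =
      s ^+ n * (D * (lam i w / c)) * G x n w by ring.
    rewrite ler_wpM2r ?(ltW (G_gt0 _ _ _))// ler_wpM2l ?exprn_ge0 ?(ltW s0)//.
    by rewrite (le_trans (DLiD i))// ler_peMr// ler_pdivlMr// mul1r.
  - rewrite GS; apply: (@le_trans _ _ (c * G x n w)).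
      have /andP[_ l1] := lam_range i w.
      have -> : c / S * (lam i w * G x n w) = c * G x n w * (lam i w / S) by ring.
      by rewrite ler_piMr ?mulr_ge0 ?(ltW c0) ?(ltW (G_gt0 _ _ _))// ler_pdivrMr// mul1r.
    rewrite -(Lop_cst phi_summable); apply: Lop_le => //; [exact: bnd_cst|exact: (Lop_bnd phi_summable [:: i])|].
    by move=> y; exact: cLi.
have [r1 [C1 [r1_range C1_gt0 HG]]] := annealed_limit Sigma_closed Sigma0 Sigma_sft
  Sigma_mixing Sigma_memory tau_range H_ge0 pm_gt0 psi_ge psi_log beta_gt0 go_ucont
  go_gt0 go_eig m_eigen go_mass rho_Sigma p_jacobian p_ucont p_ge0 lam_ucont k0
  s_range Dc_ge0 cS_gt0.
have [h hP] := boolp.choice (fun x => HG (G x) (G_cocycle x)).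
have [r10 r11] := andP r1_range.
pose r := Num.max s r1.
have r_range : 0 < r < 1 by rewrite lt_max s0 gt_max s1 r11.
have [r0 rl1] := andP r_range.
have sr n : s ^+ n <= r ^+ n.
  by apply: lerXn2r; rewrite ?nnegrE ?(ltW s0) ?(ltW r0)// le_max lexx.
have r1r n : r1 ^+ n <= r ^+ n.
  by apply: lerXn2r; rewrite ?nnegrE ?(ltW r10) ?(ltW r0)// le_max lexx orbT.
have rn0 n : 0 < r ^+ n by rewrite exprn_gt0.
have h_gt0 x : 0 < h x by case: (hP x).
pose An n f x := annealed T phi rho Sigma n f x.
have bn0 n : 0 < beta ^+ n by rewrite exprn_gt0.
have Lu n f x : ucont Sigma (fun w => Lop T phi (prefix_word w n) f x).
  by apply: (@locally_constant_ucont _ _ _ _ n) => w w' /agree_prefix ->.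
have A1E n x : An n (cst 1) x = beta ^+ n * pairing Sigma beta rho (G x) n (fun=> 1).
  by rewrite /pairing mulVKf ?gt_eqF//; apply: wint_eq => w _; rewrite mulr1.
pose I f := int_pi mu Sigma m f.
(* Of the factor 3, one part is the replacement of L f by its fibre integral times L 1, and two come
   from the modulus [2 * Df] of that integral. *)
have key f N n x : (Dbar a lambda alpha phi f < +oo)%E ->
    (forall w, Sigma w -> `|\int[mu w]_y f y| <= N) -> (2 * k0 <= n)%N ->
    `|An n f x / (beta ^+ n * h x) - I f| <=
    3 * C1 * r ^+ n * (fine (Dbar a lambda alpha phi f) + N).
  move=> fD FN n2; set Df := fine _.
  have Df0 : 0 <= Df by apply: fine_ge0; exact: Dbar_ge0.
  have kn : (k0 <= n)%N by rewrite (leq_trans _ n2)// leq_pmull.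
  pose F w := \int[mu w]_y f y.
  have Fu : ucont Sigma F.
    move=> e; exact: (fiber_ucont T_surjective phi_summable a_gt0 alpha_gt0
      k0_contraction mu_fiber s_range Sigma fD).
  have FE k y z : (M <= k)%N -> Sigma y -> Sigma z -> agree k y z ->
      `|F y - F z| <= 2 * Df * tau ^+ k.
    move=> Mk _ _ yz.
    have := fiber_diff T_surjective phi_summable a_gt0 alpha_gt0 k0_contraction mu_fiber
      (leq_trans (leq_maxr _ _) Mk) yz fD.
    by move/le_trans; apply; rewrite ler_wpM2l// mulr_ge0.
  have [_ _ _ hup hF] := hP x.
  have [up _] := hup n kn.
  have E0 : 0 <= 2 * Df by rewrite mulr_ge0.
  have main := hF F N (2 * Df) Fu FN E0 FE n n2.
  have N0 : 0 <= N by have [w Sw] := Sigma0; exact: le_trans (normr_ge0 _) (FN w Sw).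
  have GFu : ucont Sigma (fun w => G x n w * F w) by apply: ucontM => //; exact: Lu.
  have approx : `|An n f x - beta ^+ n * pairing Sigma beta rho (G x) n F| <=
      s ^+ n * Df * An n (cst 1) x.
    rewrite /pairing mulVKf ?gt_eqF// /An /annealed -(wintB rho Sigma_closed (Lu n f x) GFu).
    rewrite -(wintZ rho Sigma_closed _ (Lu n (cst 1) x)).
    rewrite (le_trans (wint_norm _ _ _))//.
      by apply: ucontD; [exact: Lu|exact: ucontN].
    apply: wint_le => //.
    - by apply: ucont_norm; apply: ucontD; [exact: Lu|exact: ucontN].
    - by apply: ucontM; [|exact: ucont_cst|exact: Lu].
    move=> w _; rewrite [G x n w * _]mulrC.
    exact: (fiber_approx T_surjective phi_summable a_gt0 alpha_gt0 k0_contraction mu_fiber).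
  have bh0 : 0 < beta ^+ n * h x by rewrite mulr_gt0.
  have -> : An n f x / (beta ^+ n * h x) - I f =
      (An n f x - I f * (beta ^+ n * h x)) / (beta ^+ n * h x).
    by field; rewrite !gt_eqF.
  rewrite normrM normfV [X in _ / X]gtr0_norm// ler_pdivrMr//.
  have -> : An n f x - I f * (beta ^+ n * h x) =
      (An n f x - beta ^+ n * pairing Sigma beta rho (G x) n F) +
      beta ^+ n * (pairing Sigma beta rho (G x) n F - I f * h x) by ring.
  rewrite (le_trans (ler_normD _ _))// normrM (gtr0_norm (bn0 n)).
  have e1 : s ^+ n * Df * An n (cst 1) x <= r ^+ n * Df * (beta ^+ n * (C1 * h x)).
    rewrite A1E; apply: ler_pM.
    - by rewrite mulr_ge0// exprn_ge0// ltW.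
    - rewrite mulr_ge0 ?(ltW (bn0 n))// /pairing mulr_ge0 ?invr_ge0 ?(ltW (bn0 n))//.
      by apply: Rintegral_ge0 => w _; rewrite mulr1 ltW.
    - by rewrite ler_wpM2r.
    - by rewrite ler_wpM2l ?(ltW (bn0 n)).
  have e2 : beta ^+ n * `|pairing Sigma beta rho (G x) n F - I f * h x| <=
      beta ^+ n * (C1 * r ^+ n * (2 * Df + N) * h x).
    rewrite ler_wpM2l ?(ltW (bn0 n))// (le_trans main)//.
    rewrite ler_wpM2r ?(ltW (h_gt0 x))// ler_wpM2r ?addr_ge0//.
    by rewrite ler_wpM2l// ltW.
  rewrite (le_trans (lerD (le_trans approx e1) e2))//.
  have z0 : 0 <= r ^+ n * beta ^+ n * C1 * h x * N.
    by rewrite !mulr_ge0 ?(ltW (rn0 n)) ?(ltW (bn0 n)) ?(ltW C1_gt0) ?(ltW (h_gt0 x)).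
  lra.
have D1lty : (Dbar a lambda alpha phi (cst 1%R) < +oo)%E.
  apply: (@Dbar_lty _ _ _ _ _ _ _ alpha_gt0 a_gt0 _ 0) => // x y _.
  by rewrite subrr normr0 mul0r.
pose D1 := fine (Dbar a lambda alpha phi (cst 1)).
have D10 : 0 <= D1 by apply: fine_ge0; exact: Dbar_ge0.
have F1 w : \int[mu w]_y (cst 1 y) = 1 :> R.
  have r11' (y : X) : 1 <= cst (1 : R) y <= 1 by rewrite lexx.
  have := fiber_range T_surjective phi_summable a_gt0 alpha_gt0 k0_contraction mu_fiber
    w D1lty r11'.
  by rewrite -eq_le => /eqP.
have I1 : I (cst 1) = 1.
  rewrite /I /int_pi (@wint_eq _ _ _ _ _ (fun=> 1)) => [|w _]; last exact: F1.
  by rewrite wint_cst// mS mulr1.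
pose K1 := 3 * C1; pose K2 := K1 * (D1 + 1).
have K10 : 0 < K1 by rewrite mulr_gt0.
have K20 : 0 < K2 by rewrite mulr_gt0// ltr_wpDl.
have key1 n x : (2 * k0 <= n)%N -> `|An n (cst 1) x / (beta ^+ n * h x) - 1| <= K2 * r ^+ n.
  move=> n2; have := key (cst 1) 1 n x D1lty _ n2.
  rewrite I1 => H1; apply: le_trans (H1 _) _; first by move=> w _; rewrite F1 normr1.
  by rewrite -/D1 -/K1 /K2 mulrAC.
(* [key1] gives no lower bound while [K2 * r ^+ n] is at least 1. The two-sided comparison in
   [annealed_limit] covers these n as well. *)
have low n x : (2 * k0 <= n)%N -> C1^-1 <= An n (cst 1) x / (beta ^+ n * h x).
  move=> n2; have kn : (k0 <= n)%N by rewrite (leq_trans _ n2)// leq_pmull.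
  have [_ _ _ hup _] := hP x; have [_ lo] := hup n kn.
  rewrite A1E -mulf_div divff ?gt_eqF// mul1r ler_pdivlMr// ler_pdivrMl//.
have I_le f N : (Dbar a lambda alpha phi f < +oo)%E ->
    (forall w, Sigma w -> `|\int[mu w]_y f y| <= N) -> `|I f| <= N.
  move=> fD FN; have Fu : ucont Sigma (fun w => \int[mu w]_y f y).
    move=> e; exact: (fiber_ucont T_surjective phi_summable a_gt0 alpha_gt0
      k0_contraction mu_fiber s_range Sigma fD).
  rewrite /I /int_pi (le_trans (wint_norm _ _ _))//.
  have -> : N = \int[m]_(w in Sigma) N by rewrite wint_cst// mS mulr1.
  by apply: wint_le => //; [exact: ucont_norm|exact: ucont_cst].
have key2 f N n x : (Dbar a lambda alpha phi f < +oo)%E ->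
    (forall w, Sigma w -> `|\int[mu w]_y f y| <= N) -> (2 * k0 <= n)%N ->
    `|An n f x / An n (cst 1) x - I f| <=
    C1 * (K1 + K2) * r ^+ n * (fine (Dbar a lambda alpha phi f) + N).
  move=> fD FN n2; set Df := fine _.
  have Df0 : 0 <= Df by apply: fine_ge0; exact: Dbar_ge0.
  have N0 : 0 <= N by have [w Sw] := Sigma0; exact: le_trans (normr_ge0 _) (FN w Sw).
  have := key f N n x fD FN n2; have := key1 n x n2; have := low n x n2.
  have bh0 : 0 < beta ^+ n * h x by rewrite mulr_gt0.
  set u := An n f x / _; set b := An n (cst 1) x / _ => lb k1 k2.
  have b0 : 0 < b by rewrite (lt_le_trans _ lb)// invr_gt0.
  have A10 : An n (cst 1) x != 0.
    by apply: contraTneq b0; rewrite /b => ->; rewrite mul0r ltxx.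
  (* The first claim divides the second by its case f = 1: both errors are O(r^n), the one for f = 1
     being multiplied by [I f], which is at most N. *)
  have -> : An n f x / An n (cst 1) x - I f = b^-1 * ((u - I f) - I f * (b - 1)).
    by rewrite /u /b; field; rewrite A10 !gt_eqF.
  rewrite normrM normfV (gtr0_norm b0).
  apply: (@le_trans _ _ (C1 * (K1 * r ^+ n * (Df + N) + N * (K2 * r ^+ n)))).
    apply: ler_pM => //; first by rewrite invr_ge0 ltW.
      by rewrite -[leRHS]invrK lef_pV2 ?posrE ?invr_gt0.
    rewrite (le_trans (ler_normB _ _))// lerD// normrM.
    by apply: ler_pM => //; exact: I_le.
  have z0 : 0 <= C1 * K2 * r ^+ n * Df.
    exact: mulr_ge0 (ltW (mulr_gt0 (mulr_gt0 C1_gt0 K20) (rn0 n))) Df0.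
  lra.
pose Ct := K1 + C1 * (K1 + K2).
have Ct2 : 0 < C1 * (K1 + K2) by rewrite mulr_gt0 ?addr_gt0.
have Ct0 : 0 < Ct by rewrite addr_gt0.
have wrap f n (t Ct' : R) : hoelder_space alpha f -> Ct' <= Ct ->
    (forall N, (forall w, Sigma w -> `|\int[mu w]_y f y| <= N) ->
      t <= Ct' * r ^+ n * (fine (Dbar a lambda alpha phi f) + N)) ->
    (t%:E <= (Ct * r ^+ n)%:E * (Dbar a lambda alpha phi f + norm_m mu Sigma f))%E.
  move=> fH CC Ht; have fD := hoelder_space_Dbar lambda phi alpha_gt0 a_gt0 fH.
  have Cr0 : 0 < Ct * r ^+ n by rewrite mulr_gt0.
  have nm w : Sigma w -> (`|\int[mu w]_y f y|%:E <= norm_m mu Sigma f)%E.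
    by move=> Sw; exact: (fiber_norm_m mu a_gt0 alpha_gt0 fD Sw).
  (* At the value +oo the right-hand side is infinite, and -oo is excluded because Sigma is
     nonempty. *)
  rewrite (Dbar_fin fD); move: nm; case: (norm_m mu Sigma f) => [N| |] nm.
  - have FN w : Sigma w -> `|\int[mu w]_y f y| <= N by move=> /nm; rewrite lee_fin.
    have N0 : 0 <= N by have [w Sw] := Sigma0; exact: le_trans (normr_ge0 _) (FN w Sw).
    rewrite -EFinD -EFinM lee_fin (le_trans (Ht N FN))//.
    rewrite ler_wpM2r ?addr_ge0 ?fine_ge0 ?Dbar_ge0// ler_wpM2r ?(ltW (rn0 n))//.
  - by rewrite addey// gt0_muley ?leey ?lte_fin.
  - by have [w /nm] := Sigma0; rewrite leeNy_eq.
exists r, Ct; split => // [f x n fH n2|].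
  apply: (wrap _ _ _ (C1 * (K1 + K2))) => //; first by rewrite lerDr ltW.
  by move=> N FN; apply: key2 => //; exact: hoelder_space_Dbar.
exists h; split => // [|f x n fH n2]; last first.
  apply: (wrap _ _ _ K1) => //; first by rewrite lerDl ltW.
  by move=> N FN; apply: key => //; exact: hoelder_space_Dbar.
have [K K0 HK] := Lop1_distortion T_expanding alpha_gt0 phi_hoelder phi_summable.
have [Bk Bk0 HBk] := Lop1_uniform_bound k0 phi_summable.
have [cg [Cg [cg0 Cg0 gcC]]] := eigenfunction_bounds Sigma_closed Sigma0 go_ucont go_gt0.
have gou1 : ucont Sigma (fun w => go w * 1).
  by apply: ucontM => //; exact: ucont_cst.
have eu n x : ucont Sigma (fun w => G x n w * (go w * 1)).
  by apply: ucontM => //; exact: Lu.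
(* The approximants integrate L_v(1)(x) over words v with weights free of x, so they inherit the
   distortion constant of [Lop1_distortion]. Boundedness of h is read off at n = k0, where only
   finitely many words v occur. *)
apply: (@hoelder_space_limit _ _ a alpha K r1 C1 (C1 * (beta ^- k0 * (Bk * Cg))) k0 h
  (fun n x => eigen_pairing Sigma beta go rho (G x) n (fun=> 1))) => //.
- move=> x; have [_ _ hk _ _] := hP x; rewrite (le_trans hk)//.
  rewrite ler_wpM2l ?(ltW C1_gt0)// /eigen_pairing ler_wpM2l ?invr_ge0 ?(ltW (bn0 _))//.
  have -> : Bk * Cg = \int[rho]_(w in Sigma) (Bk * Cg) by rewrite wint_cst// rho_Sigma mulr1.
  apply: wint_le => //; first exact: ucont_cst.
  move=> w Sw; have /andP[_ gC] := gcC w Sw.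
  rewrite mulr1 ler_pM ?(ltW (G_gt0 _ _ _)) ?(ltW (go_gt0 _ Sw))//.
  by apply: HBk; rewrite size_mkseq.
- by move=> n x kn; case: (hP x) => _ + _ _ _; exact.
- move=> n x y xya; rewrite /eigen_pairing mulrCA ler_wpM2l ?invr_ge0 ?(ltW (bn0 n))//.
  rewrite -(wintZ rho Sigma_closed _ (eu n y)); apply: wint_le => //.
    by apply: ucontM => //; exact: ucont_cst.
  move=> w Sw; rewrite !mulr1 mulrA ler_wpM2r ?(ltW (go_gt0 _ Sw))//.
  exact: HK.
Qed.
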